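(* Let $N=(p_1p_2\cdots p_t)^{2a}=m^2$, where $p_1,\ldots,p_t$ are distinct primes and $a$ is a positive integer. If $N$ is quasiperfect, then $N$ has a prime factor below $C=\exp(716.7944)$, where $C<1.995\cdot 10^{311}$.
   Context: $\sigma(N)$ denotes the sum of the positive divisors of $N$. A positive integer $N$ is called quasiperfect if $\sigma(N)=2N+1$. *)

(* Defs.v *)
From mathcomp Require Export all_boot all_order all_algebra.
From mathcomp Require Export reals sequences.

Set Implicit Arguments.
Unset Strict Implicit.
Unset Printing Implicit Defensive.

Definition sigma (N : nat) : nat := (\sum_(d <- divisors N) d)%N.

Definition quasiperfect (N : nat) : Prop :=
  (0 < N)%N /\ (sigma N = 2 * N + 1)%N.

(* Main.v *)
(* Since N = m^2 is quasiperfect, sigma(N) = 2 m^2 + 1, and every divisor of sigma(N) is 1 or 3 mod 8. Reducing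
   sigma(N) mod 3 shows that 3 divides 2 a + 1, so p^2 + p + 1 divides sigma(N) for every prime p | N; hence p is 1 or
   7 mod 8, and no prime q = 7, 13 mod 24 divides p^2 + p + 1. The primes p | N thus avoid three residue classes modulo
   such a q and one class modulo every other odd prime q < p, a sieve problem of dimension 3/2. Selberg's sieve on
   dyadic intervals bounds the sum of 1/p over the p | N with p > C by 0.64, and
   sigma(N)/N < prod (1 + 1/(p - 1)) < exp(2/3) <= 2 is a contradiction if all prime factors are >= C.

   The sieve mass needs an explicit lower bound of order (ln Q)^(3/2), that is, a lower bound for the divisor function
   summed over the integers composed of primes 7, 13 mod 24. The ideals of Q(sqrt -3) split into parts over the primes
   7, 13 mod 24 and 1, 19 mod 24 up to squares; their sum is bounded below through L(1, (-3/.)), while the square of the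
   second part is bounded above by counting the ideals of Q(sqrt -3, sqrt -2). *)

Require Import Defs.
From Stdlib Require BinNums BinNat Nnat.
From mathcomp Require boolp classical_sets topology normedtype.
From mathcomp Require Import fingroup finalg zmodp pgroup exp ring lra zify.
Import Order.TTheory GRing.Theory Num.Theory.
Local Open Scope ring_scope.
Set Implicit Arguments.
Unset Strict Implicit.
Unset Printing Implicit Defensive.

(** The primes 7, 13 mod 24 have density 1/4 and lose two classes besides 0, so the sieve dimension
    is 1 + 2/4. This extra 1/2 is indispensable: on the logarithmic scale the sum of 1/p over the
    i-th group of dyadic intervals becomes O(i^(-3/2)), which is summable, whereas the class 0 alone
    gives O(1/i).

    The obstacle is that the Dirichlet series attached to either set of split primes behaves like a
    square root of a product of L-functions, so elementary summation cannot evaluate it directly.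
    Only the total count of ideals and the square of one part are genuine products of L-functions of
    real characters mod 24. Hence the lower bound for one part is obtained as a quotient, total over
    other part.

    All sums are weighted by powers of ln x - ln n. With such weights, partial summation needs
    nothing but bounds L + e/n for the partial sums of chi(j)/j, and each convolution with a
    nonprincipal character costs an error term of one lower degree. The thresholds are tied
    together: i >= 114 gives ln Q >= (8/3) 114 = 304, the sums of squares live at 2 * 304 = 608, and
    the sieved primes start at 2^(9 * 114) = 2^1026, below C. *)

(** * Residue conditions on the prime factors of N *)

Lemma residue_closed (M : nat) (S : seq nat) (k : nat) : (0 < k)%N -> (1 %% M \in S)%N ->
  all (fun x => all (fun y => (x * y %% M \in S)%N) S) S ->
  (forall r, prime r -> (r %| k)%N -> (r %% M \in S)%N) -> (k %% M \in S)%N.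
Proof.
move=> + S1 /allP SM; elim/ltn_ind: k => k IH k0 H.
have [k1|k1] := leqP k 1; first by have -> : k = 1%N by lia.
have pp := pdiv_prime k1; have pd := pdiv_dvd k.
have e : k = (pdiv k * (k %/ pdiv k))%N by rewrite mulnC divnK.
have ql : (k %/ pdiv k < k)%N by rewrite ltn_Pdiv // prime_gt1.
have q0 : (0 < k %/ pdiv k)%N by rewrite divn_gt0 ?pdiv_gt0 // dvdn_leq.
have hq := IH _ ql q0 (fun r pr rd => H r pr (dvdn_trans rd (dvdn_div pd))).
have /allP := SM _ (H _ pp pd); move=> /(_ _ hq).
by rewrite modnMm -e.
Qed.

(** Fermat descent in place of reciprocity. An odd root z < q gives z^2 + 2 = k q with k < q and k q
    = 3 mod 8. The prime factors of k are smaller than q and divide z^2 + 2, so k is 1 or 3 mod 8 by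
    induction, and therefore so is q. *)
Lemma prime_dvd_sqr_plus2 (q x : nat) : prime q -> odd q -> (q %| x ^ 2 + 2)%N ->
  (q %% 8 \in [:: 1; 3])%N.
Proof.
elim/ltn_ind: q x => q IH x pq oq dq.
have q1 := prime_gt1 pq.
have [z [zo zq zd]] : exists z, [/\ odd z, (z < q)%N & (q %| z ^ 2 + 2)%N].
  have xq : (x %% q < q)%N by rewrite ltn_mod; lia.
  have dy : (q %| (x %% q) ^ 2 + 2)%N.
    by move: dq; rewrite /dvdn -modnDml -modnXm modnDml.
  case: (boolP (odd (x %% q))) => oy; first by exists (x %% q)%N.
  have y0 : (0 < x %% q)%N.
    rewrite lt0n; apply: contraTneq dy => ->; rewrite add0n.
    by apply: contraL oq => /(dvdn_leq (isT : 0 < 2)%N) h; have -> : q = 2%N by lia.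
  (* An even root is replaced by its negative mod [q], which is odd because [q] is. *)
  exists (q - x %% q)%N; split; [by rewrite oddB ?oq 1?ltnW// (negbTE oy) | lia | ].
  have : ((q - x %% q) ^ 2 + 2 + 2 * q * (x %% q) = q * q + ((x %% q) ^ 2 + 2))%N.
    move/ltnW/subnK: xq; move: (x %% q)%N => y; move: (q - y)%N => w <-; ring.
  move=> e; have h : (q %| 2 * q * (x %% q))%N by rewrite mulnAC dvdn_mull.
  rewrite -(dvdn_addl _ h) e.
  by rewrite dvdn_addr // dvdn_mulr.
have [k ek] := dvdnP zd.
have m8 : ((k * q) %% 8 = 3)%N.
  rewrite -ek; have [h ->] : exists h, z = (2 * h + 1)%N.
    by exists z./2; rewrite -{1}(odd_double_half z) zo addnC mul2n.
  have [T eT] : exists T, (h.+1 * h = T * 2)%N.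
    by apply/dvdnP; rewrite dvdn2 oddM /=; case: (odd h).
  have -> : ((2 * h + 1) ^ 2 + 2 = 4 * (h.+1 * h) + 3)%N by ring.
  have -> : (4 * (h.+1 * h) + 3 = T * 8 + 3)%N by rewrite eT; ring.
  by rewrite modnMDl.
have k0 : (0 < k)%N by case: (k) m8.
have kq : (k < q)%N.
  rewrite -(ltn_pmul2r (m := q)) ?prime_gt0 // -ek -mulnn.
  have z0 : (0 < z)%N by case: (z) zo.
  apply: leq_trans (leq_mul zq zq); rewrite mulSn mulnS; lia.
have ok : odd k.
  have : odd (k * q) by rewrite -ek oddD oddX /= zo.
  by rewrite oddM => /andP[].
have : (k %% 8 \in [:: 1; 3])%N.
  apply: residue_closed => // r pr rk; apply: (IH r _ z) => //.
  - by apply: leq_ltn_trans kq; apply: dvdn_leq.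
  - by apply: dvdn_odd rk ok.
  - by rewrite ek dvdn_mulr.
move: m8; rewrite -modnMm !inE.
have : (q %% 8 < 8)%N by rewrite ltn_mod.
by move: (q %% 8)%N => w; case: w => [|[|[|[|[|[|[|[|w]]]]]]]] // _ h /orP [] /eqP e; move: h; rewrite e.
Qed.

Lemma dvd_2sqr1_mod8 (d m : nat) : (d %| 2 * m ^ 2 + 1)%N -> (d %% 8 \in [:: 1; 3])%N.
Proof.
move=> dm; have d0 : (0 < d)%N by apply: dvdn_gt0 dm; rewrite addn1.
apply: residue_closed => // r pr rd.
have rm := dvdn_trans rd dm.
have ro : odd r by apply: dvdn_odd rm _; rewrite oddD oddM.
apply: (@prime_dvd_sqr_plus2 r (2 * m)) => //.
have -> : ((2 * m) ^ 2 + 2 = 2 * (2 * m ^ 2 + 1))%N by ring.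
exact: dvdn_mull.
Qed.

(** A divisor of [m * n] is a product of divisors of [m] and [n] in exactly one way; the inverse map
    is given by the two gcds. *)
Lemma big_divisors_coprime (V : Type) (idx : V) (op : Monoid.com_law idx) (m n : nat) (F : nat -> V) :
  (0 < m)%N -> (0 < n)%N -> coprime m n ->
  \big[op/idx]_(d <- divisors (m * n)) F d =
  \big[op/idx]_(d <- divisors m) \big[op/idx]_(e <- divisors n) F (d * e)%N.
Proof.
move=> m0 n0 cmn.
have pe : perm_eq (divisors (m * n)) [seq (d * e)%N | d <- divisors m, e <- divisors n].
  apply: uniq_perm; first exact: divisors_uniq.
    apply: allpairs_uniq; try exact: divisors_uniq.
    move=> [a b] [c d] /allpairsP [[a' b'] /= [+ + [-> ->]]] /allpairsP [[c' d'] /= [+ + [-> ->]]].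
    rewrite -!dvdn_divisors // => am bn cm dn e.
    have ac : forall x y z w, (x %| m)%N -> (w %| n)%N -> (x * y = z * w)%N -> (x %| z)%N.
      move=> x y z w xm wn h; rewrite -(@Gauss_dvdl x z w) -?h ?dvdn_mulr //.
      by apply: coprime_dvdl xm _; apply: coprime_dvdr wn _.
    have bd : forall x y z w, (y %| n)%N -> (z %| m)%N -> (x * y = z * w)%N -> (y %| w)%N.
      move=> x y z w yn zm h; rewrite -(@Gauss_dvdr y z w) -?h ?dvdn_mull //.
      by rewrite coprime_sym; apply: coprime_dvdl zm _; apply: coprime_dvdr yn _.
    congr pair; apply/eqP; rewrite eqn_dvd.
      by rewrite (ac _ _ _ _ am dn e) (ac _ _ _ _ cm bn (esym e)).
    by rewrite (bd _ _ _ _ bn cm e) (bd _ _ _ _ dn am (esym e)).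
  move=> d; rewrite -dvdn_divisors ?muln_gt0 ?m0 //.
  apply/idP/allpairsP => [dmn|[[a b] /= [+ + ->]]]; last first.
    by rewrite -!dvdn_divisors // => am bn; apply: dvdn_mul.
  exists (gcdn d m, gcdn d n); rewrite -!dvdn_divisors // !dvdn_gcdr; split=> //=.
  apply/eqP; rewrite eqn_dvd Gauss_dvd; last first.
    by apply: coprime_dvdl (dvdn_gcdr _ _) _; apply: coprime_dvdr (dvdn_gcdr _ _) _.
  by rewrite !dvdn_gcdl !muln_gcdr !muln_gcdl !dvdn_gcd dmn ?(dvdn_mull _ (dvdnn d)) ?(dvdn_mulr _ (dvdnn d)).
by rewrite (perm_big _ pe) big_allpairs_dep.
Qed.

Lemma perm_divisors_pfactor (q k : nat) : prime q ->
  perm_eq (divisors (q ^ k)) [seq (q ^ j)%N | j <- iota 0 k.+1].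
Proof.
move=> pq; apply: uniq_perm; first exact: divisors_uniq.
  by rewrite map_inj_uniq ?iota_uniq //; apply: expnI (prime_gt1 pq).
move=> d; rewrite -dvdn_divisors ?expn_gt0 ?prime_gt0 //.
apply/(dvdn_pfactor _ _ pq)/mapP => [] [j].
  by move=> jk ->; exists j => //; rewrite mem_iota.
by rewrite mem_iota => /= jk ->; exists j.
Qed.

Lemma sigma_pfactor (q k : nat) : prime q -> sigma (q ^ k) = (\sum_(j < k.+1) q ^ j)%N.
Proof.
move=> pq; rewrite /sigma (perm_big _ (perm_divisors_pfactor k pq)) big_map.
by rewrite -(big_mkord xpredT (fun j => q ^ j)%N).
Qed.

Lemma sigma_coprime (m n : nat) : (0 < m)%N -> (0 < n)%N -> coprime m n ->
  sigma (m * n) = (sigma m * sigma n)%N.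
Proof.
move=> m0 n0 c; rewrite /sigma big_divisors_coprime //= big_distrl /=.
by apply: eq_bigr => d _; rewrite big_distrr.
Qed.

Lemma sigma_prod_pfactor (I : eqType) (r : seq I) (p : I -> nat) (e : nat) :
  uniq r -> injective p -> (forall i, prime (p i)) ->
  sigma (\prod_(i <- r) p i ^ e)%N = (\prod_(i <- r) sigma (p i ^ e))%N.
Proof.
move=> + ip pp; elim: r => [|i r IH] /=; first by rewrite !big_nil /sigma -[divisors 1]/[:: 1%N] big_seq1.
move=> /andP [ir ur]; rewrite !big_cons sigma_coprime ?IH //.
- by rewrite expn_gt0 (prime_gt0 (pp _)).
- by apply: prodn_cond_gt0 => j _; rewrite expn_gt0 (prime_gt0 (pp _)).
apply: coprimeXl.
elim: r ir {ur IH} => [|j r IH] /=; first by rewrite big_nil coprimen1.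
rewrite inE negb_or => /andP [ij ir]; rewrite big_cons coprimeMr IH // andbT.
apply: coprimeXr; rewrite prime_coprime // dvdn_prime2 //.
by apply: contra ij => /eqP /ip ->.
Qed.

Lemma coprime6_mod24 (q : nat) : ~~ (2 %| q)%N -> ~~ (3 %| q)%N ->
  (q %% 24 \in [:: 1; 5; 7; 11; 13; 17; 19; 23])%N.
Proof.
have e2 := @modn_dvdm 24 q 2 isT; have e3 := @modn_dvdm 24 q 3 isT.
rewrite /dvdn -e2 -e3; have : (q %% 24 < 24)%N by rewrite ltn_mod.
by move: (q %% 24)%N; do 24 (case=> //).
Qed.

(** After the initial 1 the powers pair up as p^(2i+1) + p^(2i+2), and each pair is 1 + p mod 24. *)
Lemma geometric_mod24 (p a : nat) : (p ^ 2 = 1 %[mod 24])%N ->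
  (\sum_(j < (2 * a).+1) p ^ j = 1 + a * (1 + p) %[mod 24])%N.
Proof.
move=> p2; elim: a => [|a IH]; first by rewrite muln0 big_ord_recl big_ord0 expn0.
have -> : (2 * a.+1 = (2 * a).+2)%N by lia.
rewrite 2!big_ord_recr /= -addnA.
have -> : (p ^ (2 * a).+1 + p ^ (2 * a).+2 = (p ^ 2) ^ a * (p + p ^ 2))%N.
  by rewrite -expnM !expnS; ring.
have e : ((p ^ 2) ^ a * (p + p ^ 2) = 1 + p %[mod 24])%N.
  have e2 : (p + p ^ 2 = 1 + p %[mod 24])%N by rewrite -modnDmr p2 modnDmr addnC.
  by rewrite -modnMm -modnXm p2 modnXm exp1n e2 modnMm mul1n.
rewrite -modnDm.
by rewrite IH e modnDm mulSn; congr (_ %% _)%N; ring.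
Qed.

Lemma dvd_geometric3 (p b : nat) : (p ^ 2 + p + 1 %| \sum_(j < 3 * b) p ^ j)%N.
Proof.
elim: b => [|b IH]; first by rewrite muln0 big_ord0.
have -> : (3 * b.+1 = (3 * b).+3)%N by lia.
rewrite 3!big_ord_recr /= -[X in (_ %| X)%N]addnA -[X in (_ %| X)%N]addnA dvdn_addr //.
have -> : (p ^ (3 * b) + (p ^ (3 * b).+1 + p ^ (3 * b).+2) = p ^ (3 * b) * (p ^ 2 + p + 1))%N.
  by rewrite !expnS; ring.
by rewrite dvdn_mull.
Qed.

Lemma expn_prod (I : Type) (r : seq I) (F : I -> nat) (n : nat) :
  ((\prod_(i <- r) F i) ^ n = \prod_(i <- r) F i ^ n)%N.
Proof. exact: (big_morph (fun x => x ^ n)%N (fun x y => expnMn x y n) (exp1n n)). Qed.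

Section QuasiperfectPrimes.
Variables (t a N m : nat) (p : 'I_t -> nat).
Hypotheses (pp : forall i, prime (p i)) (ip : injective p) (p3 : forall i, (3 < p i)%N).
Hypotheses (eN : N = ((\prod_(i < t) p i) ^ (2 * a))%N) (em : N = (m ^ 2)%N).
Hypothesis qN : quasiperfect N.

Lemma sigma_quasiperfect : (\prod_(i < t) (\sum_(j < (2 * a).+1) p i ^ j) = 2 * N + 1)%N.
Proof.
case: qN => _ <-; rewrite eN expn_prod sigma_prod_pfactor ?index_enum_uniq //.
by apply: eq_bigr => i _; rewrite sigma_pfactor.
Qed.

Let coprime6 i : (p i %% 24 \in [:: 1; 5; 7; 11; 13; 17; 19; 23])%N.
Proof.
by apply: coprime6_mod24; rewrite dvdn_prime2 //; apply/eqP => h; have := p3 i; rewrite -h.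
Qed.

Let sqr24 i : (p i ^ 2 = 1 %[mod 24])%N.
Proof.
by rewrite -modnXm; have := coprime6 i; rewrite !inE; do ! (case/orP; [by move/eqP ->|]); move/eqP->.
Qed.

Let geom_dvd i : (\sum_(j < (2 * a).+1) p i ^ j %| 2 * m ^ 2 + 1)%N.
Proof.
by rewrite -em -sigma_quasiperfect (bigD1 i) //= dvdn_mulr.
Qed.

(** As N is a square prime to 3, 2 N + 1 is divisible by 3, hence so is the factor of sigma(N) at
    some p. That factor is 1 + a (1 + p) mod 3: it is 1 if p = 2 mod 3, and 1 + 2 a if p = 1 mod
    3. *)
Lemma three_dvd_exponent : (3 %| (2 * a).+1)%N.
Proof.
have N3 : (N %% 3 = 1)%N.
  rewrite eN expnM expnAC.
  suff h : ((\prod_(i < t) p i) ^ 2 = 1 %[mod 3])%N by rewrite expnAC -modnXm h modnXm exp1n.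
  rewrite expn_prod; elim/big_ind: _ => // [x y hx hy|i _]; first by rewrite -modnMm hx hy.
  by have := congr1 (modn^~ 3) (sqr24 i); rewrite !modn_dvdm.
have : (3 %| \prod_(i < t) (\sum_(j < (2 * a).+1) p i ^ j))%N.
  by rewrite sigma_quasiperfect /dvdn -modnDml -modnMmr N3.
have : forall r : seq 'I_t, (3 %| \prod_(i <- r) (\sum_(j < (2 * a).+1) p i ^ j))%N ->
   exists i, (3 %| \sum_(j < (2 * a).+1) p i ^ j)%N.
  elim=> [|i r IH]; first by rewrite big_nil.
  by rewrite big_cons Euclid_dvdM // => /orP [h|/IH //]; exists i.
move=> h /h {h} [i]; rewrite /dvdn.
have := congr1 (modn^~ 3) (geometric_mod24 a (sqr24 i)); rewrite !modn_dvdm // => ->.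
have : (p i %% 3 != 0)%N by rewrite -/(dvdn _ _) dvdn_prime2 //; apply/eqP => h; have := p3 i; rewrite -h.
have : (p i %% 3 < 3)%N by rewrite ltn_mod.
rewrite -modnDmr -modnMmr -[((1 + p i) %% 3)%N]modnDmr.
move: (p i %% 3)%N => w; case: w => [|[|[|w]]] // _ _; last by rewrite -[((1 + 2) %% 3)%N]/0%N muln0.
by rewrite -[((1 + 1) %% 3)%N]/2%N modnDmr add1n mulnC.
Qed.

Lemma dvd_p2p1_mod8 i d : (d %| p i ^ 2 + p i + 1)%N -> (d %% 8 \in [:: 1; 3])%N.
Proof.
move=> dd; apply: (@dvd_2sqr1_mod8 _ m); apply: dvdn_trans (geom_dvd i).
have [b ->] := dvdnP three_dvd_exponent.
by apply: dvdn_trans dd _; rewrite mulnC dvd_geometric3.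
Qed.

(** Since p^2 = 1 mod 8, the number p^2 + p + 1 is p + 2 mod 8, and it divides sigma(N), so p + 2 is
    1 or 3 mod 8. *)
Lemma prime_factor_mod8 i : (p i %% 8 \in [:: 1; 7])%N.
Proof.
have := @dvd_p2p1_mod8 i _ (dvdnn _).
rewrite -addnA -modnDml.
have := congr1 (modn^~ 8) (sqr24 i); rewrite !modn_dvdm // => ->.
rewrite modnDml addnA -modnDml -[((1 + p i) %% 8)%N]modnDmr.
have : (p i %% 8 < 8)%N by rewrite ltn_mod.
by move: (p i %% 8)%N; do 8 (case=> //).
Qed.
End QuasiperfectPrimes.

(** * Selberg's sieve *)

Section SubsetSums.
Variables (R : comPzRingType) (I : finType).

Lemma prodrD_subset (D : {set I}) (x y : I -> R) :
  \prod_(i in D) (x i + y i) =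
  \sum_(F : {set I} | F \subset D) (\prod_(i in F) x i) * \prod_(i in D :\: F) y i.
Proof.
rewrite big_mkcond /=.
rewrite (eq_bigr (fun i => (if i \in D then x i else 0) + (if i \in D then y i else 1))); last first.
  by move=> i _; case: ifP; rewrite ?add0r.
rewrite bigA_distr [RHS]big_mkcond /=; apply: eq_bigr => F _.
case: ifP => FD; last first.
  have /subsetPn [i iF iD] := negbT FD.
  by rewrite (bigD1 i) //= iF (negbTE iD) mul0r.
rewrite (bigID [pred i | i \in F]) /=; congr (_ * _).
  by apply: eq_bigr => i iF; rewrite iF (subsetP FD).
rewrite [RHS]big_mkcond [LHS]big_mkcond /=; apply: eq_bigr => i _.
by rewrite inE; case: (i \in F); case: (i \in D).
Qed.

Lemma prodr1D_subset (D : {set I}) (x : I -> R) :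
  \prod_(i in D) (1 + x i) = \sum_(F : {set I} | F \subset D) \prod_(i in F) x i.
Proof.
rewrite (eq_bigr (fun i => x i + 1)); last by move=> i _; rewrite addrC.
by rewrite prodrD_subset; apply: eq_bigr => F _; rewrite big1_eq mulr1.
Qed.

(** Moebius inversion on the interval of sets between [F] and [E]: the sum is a product over [E]
    with factors -1 on [F] and -1 + 1 off [F]. *)
Lemma sum_sign_between (F E : {set I}) : F \subset E ->
  \sum_(D : {set I} | (F \subset D) && (D \subset E)) (-1) ^+ #|D| =
  (if F == E then (-1) ^+ #|F| else 0) :> R.
Proof.
move=> FE.
transitivity (\prod_(i in E) (-1 + (i \notin F)%:R) : R).
  rewrite prodrD_subset [RHS]big_mkcond [LHS]big_mkcond /=; apply: eq_bigr => D _.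
  case: ifP => [/andP [FD DE]|]; [rewrite DE | case: ifP => // DE; rewrite andbT => /negbT /subsetPn [i iF iD]].
    rewrite prodr_const big1 ?mulr1 // => i; rewrite inE => /andP [iD _].
    by rewrite (contra _ iD) //; apply: (subsetP FD).
  by rewrite [X in _ * X](bigD1 i) /= ?inE ?iD ?(subsetP FE) // iF mul0r mulr0.
case: eqP => [->|/eqP nFE].
  rewrite -prodr_const; apply: eq_bigr => i iE; by rewrite iE addr0.
have /subsetPn [i iE iF] : ~~ (E \subset F) by apply: contra nFE => EF; rewrite eqEsubset FE.
by rewrite (bigD1 i) //= iF addNr mul0r.
Qed.
End SubsetSums.

Section SelbergWeights.
Variables (R : realFieldType) (I : finType) (q w : I -> nat) (Q : nat).
Hypotheses (w0 : forall i, (0 < w i)%N) (wq : forall i, (w i < q i)%N) (Q0 : (0 < Q)%N).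

(** A set of indices stands for the squarefree modulus prod q_i, so that union and inclusion replace
    lcm and divisibility. The four definitions after this one are the functions g, h, the sum of h,
    and the weights lambda_d of Selberg's sieve, with [(-1) ^+ #|D|] as Moebius function. *)
Definition sieve_level (D : {set I}) : bool := (\prod_(i in D) q i <= Q)%N.
Definition sieve_density (D : {set I}) : R := \prod_(i in D) ((w i)%:R / (q i)%:R).
Definition sieve_weight (D : {set I}) : R := \prod_(i in D) ((w i)%:R / ((q i)%:R - (w i)%:R)).
Definition sieve_mass : R := \sum_(D : {set I} | sieve_level D) sieve_weight D.
Definition selberg (D : {set I}) : R :=
  (-1) ^+ #|D| / sieve_density D / sieve_mass *
  \sum_(E : {set I} | sieve_level E && (D \subset E)) sieve_weight E.

Local Notation gS := sieve_density.
Local Notation hS := sieve_weight.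
Local Notation lev := sieve_level.
Local Notation L := sieve_mass.

Let q0 i : (0 < q i)%N. Proof. exact: leq_ltn_trans (wq i). Qed.
Let g_gt0 i : 0 < (w i)%:R / (q i)%:R :> R.
Proof. by rewrite divr_gt0 ?ltr0n. Qed.
Let h_gt0 i : 0 < (w i)%:R / ((q i)%:R - (w i)%:R) :> R.
Proof. by rewrite divr_gt0 ?ltr0n // subr_gt0 ltr_nat. Qed.

Lemma sieve_density_gt0 D : 0 < gS D. Proof. by apply: prodr_gt0 => i _; apply: g_gt0. Qed.
Lemma sieve_weight_gt0 D : 0 < hS D. Proof. by apply: prodr_gt0 => i _; apply: h_gt0. Qed.
Lemma sieve_level0 : lev set0. Proof. by rewrite /lev big_set0. Qed.

Lemma sieve_level_sub (D E : {set I}) : D \subset E -> lev E -> lev D.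
Proof.
move=> DE; apply: leq_trans; rewrite [X in (_ <= X)%N](big_setID D) /= (setIidPr DE).
by rewrite leq_pmulr // prodn_cond_gt0.
Qed.

Lemma sieve_mass_ge1 : 1 <= L.
Proof.
rewrite /L (bigD1 set0) ?sieve_level0 //= {1}/hS big_set0 lerDl.
by apply: sumr_ge0 => D _; apply: ltW (sieve_weight_gt0 D).
Qed.

Let L0 : 0 < L. Proof. exact: lt_le_trans sieve_mass_ge1. Qed.

(** Locally, q / w = 1 + (q - w) / w; the product is then expanded over subsets. *)
Lemma sieve_densityV D : (gS D)^-1 = \sum_(F : {set I} | F \subset D) (hS F)^-1.
Proof.
rewrite /gS -prodfV.
rewrite (eq_bigr (fun i => 1 + ((w i)%:R / ((q i)%:R - (w i)%:R))^-1)); last first.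
  move=> i _; rewrite !invf_div.
  have : (w i)%:R != 0 :> R by rewrite pnatr_eq0 -lt0n.
  by move=> ?; field.
by rewrite prodr1D_subset; apply: eq_bigr => F _; rewrite /hS -prodfV.
Qed.

Lemma sieve_densityUI (D E : {set I}) : gS (D :|: E) = gS D * gS E / gS (D :&: E).
Proof.
apply: (canRL (mulfK _)); first by rewrite gt_eqF ?sieve_density_gt0.
rewrite /gS (big_setID D) /= setUK setDUl setDv set0U.
by rewrite -mulrA; congr (_ * _); rewrite [RHS](big_setID D) /= setIC mulrC.
Qed.

(** These are the variables that diagonalise the quadratic form. Exchanging the sums leaves an
    alternating sum over the sets between [F] and [E], which survives only for [E = F]. *)
Lemma selberg_dual (F : {set I}) :
  \sum_(D : {set I} | F \subset D) selberg D * gS D =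
  if lev F then (-1) ^+ #|F| * hS F / L else 0.
Proof.
transitivity (\sum_(D : {set I} | F \subset D)
    \sum_(E : {set I} | lev E && (D \subset E)) (-1) ^+ #|D| * (hS E / L)).
  apply: eq_bigr => D FD; rewrite -mulr_sumr /selberg -mulr_suml.
  have : gS D != 0 by rewrite gt_eqF ?sieve_density_gt0.
  by have : L != 0; [rewrite gt_eqF | move=> ? ?; field; apply/andP].
rewrite (exchange_big_dep (fun E => lev E && (F \subset E))) /=; last first.
  by move=> D E FD /andP [-> DE]; apply: subset_trans DE.
rewrite (eq_bigr (fun E => (if F == E then (-1) ^+ #|F| else 0) * (hS E / L))); last first.
  move=> E /andP [lE FE]; rewrite -mulr_suml -(sum_sign_between _ FE); congr (_ * _).
  by apply: eq_bigl => D; rewrite lE.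
case: ifP => lF.
  rewrite (bigD1 F) ?lF ?subxx //= eqxx big1 ?addr0 ?mulrA // => E /andP [_ nE].
  by rewrite eq_sym (negbTE nE) mul0r.
rewrite big1 // => E /andP [lE FE]; case: eqP => [e|]; last by rewrite mul0r.
by rewrite e lE in lF.
Qed.

(** Expanding 1 / g(D :&: E) over the common subsets F turns the form into a sum of squares of the
    dual variables divided by h(F), that is, into the sum of h(F) / L^2 over the level sets. *)
Lemma selberg_quadratic :
  \sum_(D : {set I}) \sum_(E : {set I}) selberg D * selberg E * gS (D :|: E) = L^-1.
Proof.
transitivity (\sum_(D : {set I}) \sum_(E : {set I}) \sum_(F : {set I} | F \subset D :&: E)
    (hS F)^-1 * ((selberg D * gS D) * (selberg E * gS E))).
  apply: eq_bigr => D _; apply: eq_bigr => E _.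
  by rewrite sieve_densityUI sieve_densityV -mulr_suml mulrC; ring.
transitivity (\sum_(F : {set I}) (hS F)^-1 *
    (\sum_(D : {set I} | F \subset D) selberg D * gS D) ^+ 2).
  under eq_bigr => D _ do rewrite (exchange_big_dep xpredT) //=.
  rewrite exchange_big /=; apply: eq_bigr => F _.
  rewrite expr2 big_distrl /= mulr_sumr [RHS]big_mkcond /=; apply: eq_bigr => D _.
  case: (boolP (F \subset D)) => FD; last first.
    by rewrite big1 // => E; rewrite subsetI (negbTE FD).
  rewrite mulr_sumr mulr_sumr; apply: eq_bigl => E; first by rewrite subsetI FD.
rewrite (eq_bigr (fun F => if lev F then hS F / L ^+ 2 else 0)); last first.
  move=> F _; rewrite selberg_dual; case: ifP => _; last by rewrite expr0n mulr0.
  have : hS F != 0 by rewrite gt_eqF ?sieve_weight_gt0.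
  have : L != 0 by rewrite gt_eqF.
  rewrite 2!exprMn sqrr_sign mul1r => ? ?; field.
  by apply/andP.
rewrite -big_mkcond -mulr_suml -/L expr2 invfM mulrA mulfV ?mul1r // gt_eqF //.
Qed.

Lemma selberg0 : selberg set0 = 1.
Proof.
rewrite /selberg cards0 expr0 {1}/gS big_set0 divr1 mul1r.
rewrite (eq_bigl lev) ?mulVf ?gt_eqF // => E; by rewrite sub0set andbT.
Qed.

Lemma selberg_out (D : {set I}) : ~~ lev D -> selberg D = 0.
Proof.
move=> nl; rewrite /selberg big1 ?mulr0 // => E /andP [lE DE].
by rewrite (sieve_level_sub DE lE) in nl.
Qed.

(** After expanding 1 / g(D), the absolute value times L is the sum of h(E \ F) over F inside D
    inside E. The map (F, E) to E \ F is injective, as F = D \ (E \ F) and E = D with E \ F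
    adjoined, and it takes values in level sets; so the sum is at most L. *)
Lemma selberg_le1 (D : {set I}) : `|selberg D| <= 1.
Proof.
rewrite /selberg !normrM normrX normrN1 expr1n mul1r !normfV.
rewrite (gtr0_norm (sieve_density_gt0 D)) (gtr0_norm L0) ger0_norm; last first.
  by apply: sumr_ge0 => E _; apply: ltW (sieve_weight_gt0 E).
rewrite mulrAC ler_pdivrMr // mul1r sieve_densityV mulr_suml.
under eq_bigr => F _ do rewrite mulr_sumr.
rewrite pair_big_dep /=.
pose A := [set x : {set I} * {set I} | (x.1 \subset D) && (lev x.2 && (D \subset x.2))].
rewrite (eq_bigl (fun x => x \in A)); last by move=> x; rewrite inE.
rewrite (eq_bigr (fun x => hS (x.2 :\: x.1))); last first.
  move=> [F E]; rewrite inE /= => /and3P [FD lE DE].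
  have -> : hS E = hS F * hS (E :\: F).
    by rewrite /hS [LHS](big_setID F) /= (setIidPr (subset_trans FD DE)).
  by rewrite mulKf // gt_eqF ?sieve_weight_gt0.
rewrite -(big_imset (h := fun x => x.2 :\: x.1) hS) /=; last first.
  move=> [F E] [F' E']; rewrite !inE /= => /and3P [FD lE DE] /and3P [FD' lE' DE'] e.
  have eF : F = D :\: (E :\: F).
    by apply/setP => i; have /implyP := subsetP FD i; have /implyP := subsetP DE i; rewrite !inE; do 3 case: (i \in _).
  have eF' : F' = D :\: (E' :\: F').
    by apply/setP => i; have /implyP := subsetP FD' i; have /implyP := subsetP DE' i; rewrite !inE; do 3 case: (i \in _).
  have eE : E = D :|: (E :\: F).
    by apply/setP => i; have /implyP := subsetP FD i; have /implyP := subsetP DE i; rewrite !inE; do 3 case: (i \in _).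
  have eE' : E' = D :|: (E' :\: F').
    by apply/setP => i; have /implyP := subsetP FD' i; have /implyP := subsetP DE' i; rewrite !inE; do 3 case: (i \in _).
  by congr pair; [rewrite eF e -eF' | rewrite eE e -eE'].
rewrite /L [leLHS]big_mkcond [leRHS]big_mkcond; apply: ler_sum => E _.
case: ifP => [/imsetP [[F E']]|_]; last by case: ifP => // _; apply: ltW (sieve_weight_gt0 E).
rewrite inE /= => /and3P [_ lE' _] eE.
by rewrite (@sieve_level_sub E E') // eE subsetDl.
Qed.

Variables (X : nat) (bad : I -> nat -> bool).
Hypothesis equidistributed : forall D : {set I},
  `|(\sum_(n < X) [forall i in D, bad i n])%:R - X%:R * gS D| <= (\prod_(i in D) w i)%:R.

(** The indicator of the unsieved n is at most the square of the sum of lambda_D over the sets D of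
    conditions that n meets, because lambda at the empty set is 1. The main term is the quadratic
    form. *)
Lemma selberg_sieve :
  (\sum_(n < X) [forall i, ~~ bad i n])%:R <=
  X%:R / L + (\sum_(D : {set I} | lev D) (\prod_(i in D) w i)%:R) ^+ 2.
Proof.
pose B n := [set i | bad i n].
have sq (n : nat) : ([forall i, ~~ bad i n])%:R <= (\sum_(D : {set I} | D \subset B n) selberg D) ^+ 2.
  case: (boolP [forall i, _]) => [/forallP h|_]; last exact: sqr_ge0.
  have -> : B n = set0 by apply/setP => i; rewrite !inE (negbTE (h i)).
  by rewrite (big_pred1 set0) ?selberg0 ?expr1n // => D; rewrite subset0.
rewrite natr_sum.
apply: (@le_trans _ _ (\sum_(n < X) (\sum_(D : {set I} | D \subset B n) selberg D) ^+ 2)).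
  by apply: ler_sum => n _; apply: sq.
have -> : \sum_(n < X) (\sum_(D : {set I} | D \subset B n) selberg D) ^+ 2 =
   \sum_(D : {set I}) \sum_(E : {set I}) selberg D * selberg E *
      (\sum_(n < X) [forall i in D :|: E, bad i n])%:R.
  under [RHS]eq_bigr => D _ do under eq_bigr => E _ do rewrite natr_sum mulr_sumr.
  under [RHS]eq_bigr => D _ do rewrite exchange_big.
  rewrite [RHS]exchange_big /=; apply: eq_bigr => n _.
  rewrite expr2 big_distrl /= big_mkcond; apply: eq_bigr => D _.
  have e (F : {set I}) : [forall i in F, bad i n] = (F \subset B n).
    by apply/forall_inP/subsetP => h i iF; [rewrite inE h | have := h i iF; rewrite inE].
  case: ifP => DB; last first.
    by rewrite big1 // => E _; rewrite e subUset DB mulr0.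
  rewrite mulr_sumr big_mkcond; apply: eq_bigr => E _; rewrite e subUset DB /=.
  by case: (E \subset _); rewrite ?mulr1 ?mulr0.
rewrite -selberg_quadratic mulr_sumr.
have -> : (\sum_(D : {set I} | lev D) (\prod_(i in D) w i)%:R) ^+ 2 =
   \sum_(D : {set I}) \sum_(E : {set I}) (lev D)%:R * (lev E)%:R *
     ((\prod_(i in D) w i)%:R * (\prod_(i in E) w i)%:R) :> R.
  rewrite expr2 big_distrl /= big_mkcond; apply: eq_bigr => D _.
  case: (lev D); last by rewrite big1 // => E _; rewrite !mul0r.
  rewrite mulr_sumr big_mkcond; apply: eq_bigr => E _.
  by case: (lev E); rewrite ?mulr0 ?mul0r ?mul1r.
rewrite -big_split; apply: ler_sum => D _ /=.
rewrite mulr_sumr -big_split; apply: ler_sum => E _ /=.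
case: (boolP (lev D)) => lD; last by rewrite selberg_out // !mul0r mulr0 addr0.
case: (boolP (lev E)) => lE; last by rewrite (selberg_out lE) !mulr0 !mul0r mulr0 addr0.
rewrite -lerBlDl !mul1r (mulrCA _ (selberg D * selberg E)) -mulrBr.
apply: le_trans (ler_norm _) _; rewrite normrM (normrM (selberg D)) -[leRHS]mul1r ler_pM ?mulr_ge0 //.
  by rewrite mulr_ile1 ?selberg_le1.
(* The remainder for the union is at most w(D) w(E), since every [w i] is at least 1. *)
apply: le_trans (equidistributed _) _; rewrite -natrM ler_nat.
rewrite (big_setID D) /= setUK setDUl setDv set0U leq_mul2l.
by rewrite [X in (_ <= X)%N](big_setID D) /= leq_pmull ?orbT // prodn_cond_gt0.
Qed.
End SelbergWeights.

Lemma count_mod_mul (m q : nat) (A B : nat -> bool) : (0 < m)%N -> (0 < q)%N -> coprime m q ->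
  (forall n, A (n %% m)%N = A n) -> (forall n, B (n %% q)%N = B n) ->
  (\sum_(n < m * q) (A n && B n) = (\sum_(n < m) A n) * (\sum_(n < q) B n))%N.
Proof.
move=> m0 q0 cmq pA pB.
pose h (n : 'I_(m * q)) := (Ordinal (ltn_pmod n m0), Ordinal (ltn_pmod n q0)).
have hi : injective h.
  move=> x y [ex ey]; apply: val_inj => /=.
  have /eqP : (x == y %[mod m * q])%N by rewrite chinese_remainder // ex ey !eqxx.
  by rewrite !modn_small.
have hb : bijective h by apply: inj_card_bij => //; rewrite card_prod !card_ord.
rewrite big_distrl /=; under [RHS]eq_bigr => a _ do rewrite big_distrr /=.
rewrite pair_big /= (reindex h); last exact: onW_bij.
by apply: eq_bigr => n _ /=; rewrite pA pB; case: (A n); case: (B n).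
Qed.

(** Complete periods contribute exactly their share; in the incomplete one the count and its
    expected value both lie between 0 and the number of classes. *)
Lemma count_mod_interval (R : realFieldType) (m X : nat) (A : nat -> bool) : (0 < m)%N ->
  (forall n, A (n %% m)%N = A n) ->
  `|(\sum_(n < X) A n)%:R - X%:R * ((\sum_(n < m) A n)%:R / m%:R)| <= (\sum_(n < m) A n)%:R :> R.
Proof.
move=> m0 pA; set al := (\sum_(n < m) A n)%N.
have step Y : (\sum_(n < m + Y) A n = al + \sum_(n < Y) A n)%N.
  rewrite big_split_ord /=; congr (_ + _)%N; apply: eq_bigr => n _.
  by rewrite -pA modnDl pA.
have sum t Y : (\sum_(n < t * m + Y) A n = t * al + \sum_(n < Y) A n)%N.
  by elim: t => [//|t IH]; rewrite mulSn -addnA step IH mulSn addnA.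
have [t [e [em ->]]] : exists t e, (e <= m)%N /\ X = (t * m + e)%N.
  by exists (X %/ m)%N, (X %% m)%N; rewrite -divn_eq ltnW // ltn_mod.
rewrite sum.
have ce : (\sum_(n < e) A n <= al)%N.
  by rewrite /al -(subnKC em) big_split_ord /= leq_addr.
rewrite !natrD !natrM.
have m0' : 0 < m%:R :> R by rewrite ltr0n.
have -> : (t%:R * al%:R + (\sum_(n < e) A n)%:R - (t%:R * m%:R + e%:R) * (al%:R / m%:R) =
  (\sum_(n < e) A n)%:R - al%:R * (e%:R / m%:R) :> R) by field; rewrite gt_eqF.
have em1 : e%:R / m%:R <= 1 :> R by rewrite ler_pdivrMr // mul1r ler_nat.
have em0 : 0 <= e%:R / m%:R :> R by rewrite divr_ge0 ?ler0n.
have ce' : (\sum_(n < e) A n)%:R <= al%:R :> R by rewrite ler_nat.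
have c0 : 0 <= (\sum_(n < e) A n)%:R :> R by rewrite ler0n.
have a0 : 0 <= al%:R :> R by rewrite ler0n.
rewrite ler_norml; apply/andP; split; nra.
Qed.

Section ChineseEquidistribution.
Variables (R : realFieldType) (I : finType) (q w : I -> nat) (bad : I -> nat -> bool).
Hypotheses (q0 : forall i, (0 < q i)%N) (cq : forall i j, i != j -> coprime (q i) (q j)).
Hypotheses (per : forall i n, bad i (n %% q i)%N = bad i n).
Hypotheses (cnt : forall i, (\sum_(n < q i) bad i n = w i)%N).

Lemma equidistributed_crt (X : nat) (D : {set I}) :
  `|(\sum_(n < X) [forall i in D, bad i n])%:R - X%:R * sieve_density R q w D| <=
  (\prod_(i in D) w i)%:R.
Proof.
have allE n : [forall i in D, bad i n] = all (bad^~ n) (enum D).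
  apply/forall_inP/allP => h i; first by rewrite mem_enum => /h.
  by move=> iD; apply: h; rewrite mem_enum.
have gen : forall r : seq I, uniq r ->
    (forall n, all (bad^~ (n %% \prod_(i <- r) q i)%N) r = all (bad^~ n) r) /\
    (\sum_(n < \prod_(i <- r) q i) all (bad^~ n) r = \prod_(i <- r) w i)%N.
  elim=> [|i r IH] /=; first by rewrite !big_nil big_ord1.
  move=> /andP [ir /IH [IH1 IH2]]; rewrite !big_cons.
  have co : coprime (q i) (\prod_(j <- r) q j).
    elim: r ir {IH IH1 IH2} => [|j r IH] /=; first by rewrite big_nil coprimen1.
    by rewrite inE negb_or => /andP [ij ir]; rewrite big_cons coprimeMr IH // cq.
  split; last by rewrite (@count_mod_mul _ _ (bad i) (fun n => all (bad^~ n) r)) ?IH2 ?cnt // prodn_cond_gt0.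
  move=> n; rewrite -[in LHS]per modn_dvdm ?dvdn_mulr // per; congr (_ && _).
  by rewrite -[in LHS]IH1 modn_dvdm ?dvdn_mull // IH1.
have [g1 g2] := gen _ (enum_uniq D).
have -> : (\prod_(i in D) w i)%N = (\prod_(i <- enum D) w i)%N by rewrite big_enum.
have -> : sieve_density R q w D = (\prod_(i <- enum D) w i)%:R / (\prod_(i <- enum D) q i)%:R.
  by rewrite /sieve_density !big_enum prodf_div !natr_prod.
have -> : (\sum_(n < X) [forall i in D, bad i n] = \sum_(n < X) all (bad^~ n) (enum D))%N.
  by apply: eq_bigr => n _; rewrite allE.
rewrite -g2; apply: (@count_mod_interval R _ X (fun n => all (bad^~ n) (enum D))) => //.
by apply: prodn_cond_gt0.
Qed.
End ChineseEquidistribution.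

(** * Smoothed sums of characters modulo 24 *)

Section TruncatedPowers.
Variable R : realType.
Implicit Types (t d x y : R).

(** The [k]-fold integral of the unit step. It is taken at t = ln x - ln n: summation against 1/n
    raises the degree by one, summation against chi(n)/n keeps it. [phi 0 0 = 1], so the sharp
    cutoff includes n = x. *)
Definition phi (k : nat) t : R := if 0 <= t then t ^+ k / k`!%:R else 0.

Lemma phi_neg k t : t < 0 -> phi k t = 0.
Proof. by rewrite /phi leNgt => ->. Qed.

Lemma phi_ge0 k t : 0 <= phi k t.
Proof. by rewrite /phi; case: ifP => // t0; rewrite divr_ge0 // exprn_ge0. Qed.

Lemma phi_pos k t : 0 <= t -> phi k t = t ^+ k / k`!%:R.
Proof. by rewrite /phi => ->. Qed.

Lemma phi_mono k t t' : t <= t' -> phi k t <= phi k t'.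
Proof.
move=> tt; rewrite {1}/phi; case: ifP => t0; last exact: phi_ge0.
by rewrite phi_pos ?(le_trans t0) // ler_pM2r ?invr_gt0 ?ltr0n ?fact_gt0 // lerXn2r ?nnegrE ?(le_trans t0).
Qed.

Lemma subrX_bounds k x y : 0 <= y -> y <= x ->
  k.+1%:R * (x - y) * y ^+ k <= x ^+ k.+1 - y ^+ k.+1 <= k.+1%:R * (x - y) * x ^+ k.
Proof.
move=> y0 yx; have x0 := le_trans y0 yx.
elim: k => [|k /andP [IH1 IH2]]; first by rewrite !expr0 !expr1; apply/andP; split; lra.
have yk : 0 <= y ^+ k.+1 by exact: exprn_ge0.
have yxk : y ^+ k.+1 <= x ^+ k.+1 by rewrite lerXn2r ?nnegrE.
have -> : x ^+ k.+2 - y ^+ k.+2 = x * (x ^+ k.+1 - y ^+ k.+1) + (x - y) * y ^+ k.+1.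
  by rewrite !exprS; ring.
have h1 := ler_wpM2l x0 IH1; have h2 := ler_wpM2l x0 IH2.
have e1 : k.+2%:R * (x - y) * x ^+ k.+1 = x * (k.+1%:R * (x - y) * x ^+ k) + (x - y) * x ^+ k.+1.
  by rewrite -[k.+2%:R]natr1 exprS; ring.
have e2 : k.+2%:R * (x - y) * y ^+ k.+1 = y * (k.+1%:R * (x - y) * y ^+ k) + (x - y) * y ^+ k.+1.
  by rewrite -[k.+2%:R]natr1 exprS; ring.
have h3 : (x - y) * y ^+ k.+1 <= (x - y) * x ^+ k.+1 by rewrite ler_wpM2l // subr_ge0.
have h4 : y * (k.+1%:R * (x - y) * y ^+ k) <= x * (k.+1%:R * (x - y) * y ^+ k).
  by rewrite ler_wpM2r // !mulr_ge0 ?subr_ge0 ?exprn_ge0.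
apply/andP; split; rewrite ?e1 ?e2; lra.
Qed.

Let factS k x : x / (k.+1)`!%:R = x / k.+1%:R / k`!%:R.
Proof. by rewrite factS natrM invfM mulrA. Qed.

(** Mean value theorem: [phi k] is nondecreasing and is the derivative of [phi k.+1] away from 0.
    The case t - d < 0 < t, which crosses the kink, is treated separately. *)
Lemma phi_incr_le k t d : 0 <= d -> phi k.+1 t - phi k.+1 (t - d) <= d * phi k t.
Proof.
move=> d0; have [t0|t0] := ltP t 0.
  by rewrite !phi_neg ?subrr ?mulr0 //; lra.
have f0 : 0 < k`!%:R :> R by rewrite ltr0n fact_gt0.
have k0 : 0 < k.+1%:R :> R by rewrite ltr0n.
have [td|td] := ltP (t - d) 0.
  rewrite (phi_neg _ td) subr0 !phi_pos // factS mulrA ler_pM2r ?invr_gt0 // ler_pdivrMr //.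
  rewrite exprSr mulrC -mulrA [leRHS]mulrA -[leRHS]mulrA.
  have : t * t ^+ k <= d * t ^+ k by rewrite ler_wpM2r ?exprn_ge0 //; lra.
  have : d * t ^+ k <= d * (t ^+ k * k.+1%:R).
    by rewrite ler_wpM2l // ler_peMr ?exprn_ge0 // ler1n.
  by lra.
have /andP [_ h] := @subrX_bounds k t (t - d) td (ltac:(lra)).
rewrite !phi_pos // !factS -mulrBl mulrA ler_pM2r ?invr_gt0 // -mulrBl ler_pdivrMr //.
by apply: le_trans h _; rewrite (_ : t - (t - d) = d); [lra | ring].
Qed.

Lemma phi_incr_ge k t d : 0 <= d -> d * phi k (t - d) <= phi k.+1 t - phi k.+1 (t - d).
Proof.
move=> d0; have f0 : 0 < k`!%:R :> R by rewrite ltr0n fact_gt0.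
have k0 : 0 < k.+1%:R :> R by rewrite ltr0n.
have [td|td] := ltP (t - d) 0.
  by rewrite !(phi_neg _ td) subr0 mulr0 phi_ge0.
have t0 : 0 <= t by lra.
have /andP [h _] := @subrX_bounds k t (t - d) td (ltac:(lra)).
rewrite !phi_pos // !factS -mulrBl mulrA ler_pM2r ?invr_gt0 // -mulrBl ler_pdivlMr //.
by apply: le_trans h; rewrite (_ : t - (t - d) = d); [lra | ring].
Qed.

Lemma phi0E t : 0 <= t -> phi 0 t = 1.
Proof. by move=> t0; rewrite phi_pos // divr1. Qed.
Lemma phi1E t : 0 <= t -> phi 1 t = t.
Proof. by move=> t0; rewrite phi_pos // divr1. Qed.
Lemma phi2E t : 0 <= t -> phi 2 t = t ^+ 2 / 2%:R.
Proof. by move=> t0; rewrite phi_pos. Qed.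

Lemma phi1_diff_mono t t' d : 0 <= d -> t <= t' -> phi 1 t - phi 1 (t - d) <= phi 1 t' - phi 1 (t' - d).
Proof.
move=> d0 tt.
have [h1|h1] := ltP t 0; have [h2|h2] := ltP t' 0; have [h3|h3] := ltP (t - d) 0; have [h4|h4] := ltP (t' - d) 0;
  rewrite ?(phi_neg _ h1) ?(phi_neg _ h2) ?(phi_neg _ h3) ?(phi_neg _ h4)
    ?(phi1E h1) ?(phi1E h2) ?(phi1E h3) ?(phi1E h4); lra.
Qed.

Lemma phi2_diff_mono t t' d : 0 <= d -> t <= t' -> phi 2 t - phi 2 (t - d) <= phi 2 t' - phi 2 (t' - d).
Proof.
move=> d0 tt.
have [h1|h1] := ltP t 0; have [h2|h2] := ltP t' 0; have [h3|h3] := ltP (t - d) 0; have [h4|h4] := ltP (t' - d) 0;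
  rewrite ?(phi_neg _ h1) ?(phi_neg _ h2) ?(phi_neg _ h3) ?(phi_neg _ h4)
    ?(phi2E h1) ?(phi2E h2) ?(phi2E h3) ?(phi2E h4); nra.
Qed.

(** The derivative d phi_0(t) - (phi_1(t) - phi_1(t - d)) is nonnegative. Monotonicity of this
    remainder is what lets an increment bound pass through a sum over a character with changing
    sign. *)
Lemma phi2_remainder_mono t t' d : 0 <= d -> t <= t' ->
  d * phi 1 t - (phi 2 t - phi 2 (t - d)) <= d * phi 1 t' - (phi 2 t' - phi 2 (t' - d)).
Proof.
move=> d0 tt.
have [h1|h1] := ltP t 0; have [h2|h2] := ltP t' 0; have [h3|h3] := ltP (t - d) 0; have [h4|h4] := ltP (t' - d) 0;
  rewrite ?(phi_neg _ h1) ?(phi_neg _ h2) ?(phi_neg _ h3) ?(phi_neg _ h4)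
    ?(phi1E h1) ?(phi1E h2) ?(phi2E h1) ?(phi2E h2) ?(phi2E h3) ?(phi2E h4); nra.
Qed.
End TruncatedPowers.

(** * Logarithmically weighted Dirichlet sums and partial summation *)

Section DirichletSums.
Variable R : realType.
Implicit Types (c u v : nat -> R) (psi : R -> R) (t d : R) (N n : nat).

Definition dsum c N psi t : R := \sum_(1 <= n < N.+1) c n / n%:R * psi (t - ln n%:R).

Definition msum c n : R := \sum_(1 <= j < n.+1) c j / j%:R.

Lemma abel_summation c N (a : nat -> R) :
  \sum_(1 <= n < N.+1) c n / n%:R * a n =
  \sum_(1 <= n < N.+1) msum c n * (a n - a n.+1) + msum c N * a N.+1.
Proof.
elim: N => [|N IH]; first by rewrite /msum !big_geq // mul0r addr0.
rewrite !(@big_nat_recr _ _ _ N.+1) //= IH.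
have -> : msum c N.+1 = msum c N + c N.+1 / N.+1%:R by rewrite /msum big_nat_recr.
by ring.
Qed.

Lemma lnS_ge0 n : 0 <= ln n.+1%:R :> R.
Proof. by apply: ln_ge0; rewrite ler1n. Qed.

Lemma ln_nat_le n m : (0 < n)%N -> (n <= m)%N -> ln n%:R <= ln m%:R :> R.
Proof. by move=> n0 nm; rewrite ler_ln ?posrE ?ltr0n ?ler_nat // (leq_trans n0). Qed.

Lemma ln_succ_sub n : (0 < n)%N -> ln n.+1%:R - ln n%:R <= n%:R^-1 :> R.
Proof.
move=> n0; have n0' : 0 < n%:R :> R by rewrite ltr0n.
rewrite -ln_div ?posrE ?ltr0n //.
have -> : n.+1%:R / n%:R = 1 + n%:R^-1 :> R by rewrite -natr1; field; rewrite gt_eqF.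
by apply: le_ln1Dx; apply: lt_trans (_ : 0 < _); rewrite ?invr_gt0 // oppr_lt0.
Qed.

(* Only the range [t < ln (N + 1)] is constrained: there the truncation at [N] in [dsum] discards nothing. *)
Definition trunc_mono N psi : Prop :=
  (forall t, t < 0 -> psi t = 0) /\
  (forall t t', t <= t' -> t' < ln N.+1%:R -> psi t <= psi t').

Lemma trunc_mono_ge0 N psi t : trunc_mono N psi -> t < ln N.+1%:R -> 0 <= psi t.
Proof.
move=> [h0 h1] tN; have [t0|t0] := ltP t 0; first by rewrite h0.
by rewrite -(h0 (-1)) ?h1 //; lra.
Qed.

Lemma dsum_abel c N psi t : trunc_mono N psi -> t < ln N.+1%:R ->
  dsum c N psi t = \sum_(1 <= n < N.+1) msum c n * (psi (t - ln n%:R) - psi (t - ln n.+1%:R)).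
Proof.
move=> [h0 _] tN; rewrite /dsum (abel_summation c N (fun n => psi (t - ln n%:R))).
by rewrite (h0 (t - ln N.+1%:R)) ?mulr0 ?addr0 // subr_lt0.
Qed.

Lemma trunc_mono_step N psi t n : trunc_mono N psi -> t < ln N.+1%:R -> (0 < n)%N ->
  0 <= psi (t - ln n%:R) - psi (t - ln n.+1%:R).
Proof.
move=> [_ h1] tN n0; rewrite subr_ge0; apply: h1.
  by rewrite lerB // ln_nat_le.
by apply: le_lt_trans tN; case: n n0 => // n _; have := lnS_ge0 n; lra.
Qed.

Lemma dsum_ge0 c N psi t : (forall n, 0 <= msum c n) -> trunc_mono N psi -> t < ln N.+1%:R ->
  0 <= dsum c N psi t.
Proof.
move=> M0 h tN; rewrite dsum_abel // big_nat; apply: sumr_ge0 => n /andP [n1 _].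
by rewrite mulr_ge0 // (trunc_mono_step h).
Qed.

Lemma sum_steps N psi t : trunc_mono N psi -> t < ln N.+1%:R ->
  \sum_(1 <= n < N.+1) (psi (t - ln n%:R) - psi (t - ln n.+1%:R)) = psi t.
Proof.
move=> [h0 _] tN; rewrite big_nat -[LHS]opprK -sumrN -big_nat.
under eq_bigr => n _ do rewrite opprB.
by rewrite telescope_sumr // (h0 (t - ln N.+1%:R)) ?subr_lt0 // ln1 subr0 sub0r opprK.
Qed.

Lemma sum_inv_sqr N : \sum_(1 <= n < N.+1) (n%:R^-1 * n%:R^-1) <= 2 :> R.
Proof.
suff h : forall N, \sum_(1 <= n < N.+2) (n%:R^-1 * n%:R^-1) <= 2 - N.+1%:R^-1 :> R.
  case: N => [|N]; first by rewrite big_geq.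
  by apply: le_trans (h N) _; rewrite lerBlDr lerDl invr_ge0.
elim=> [|n IH]; first by rewrite big_nat1 invr1; lra.
rewrite big_nat_recr //=; apply: le_trans (lerD IH (lexx _)) _.
have n0 : 0 < n.+1%:R :> R by rewrite ltr0n.
rewrite -[n.+2%:R]natr1; move: n.+1%:R n0 => x x0.
have -> : 2 - x^-1 + (x + 1)^-1 * (x + 1)^-1 = 2 - (x + 1)^-1 - (x * (x + 1) * (x + 1))^-1.
  by field; apply/andP; split; apply/eqP; lra.
by rewrite lerBlDr lerDl invr_ge0 !mulr_ge0 //; lra.
Qed.

(** The step of the logarithm from n to n + 1 is at most 1/n, so the sum is at most [psi1 t] times
    the sum of 1/n^2, which is at most 2. *)
Lemma sum_steps_div N psi psi1 t : trunc_mono N psi -> trunc_mono N psi1 ->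
  (forall t d, 0 <= d -> t < ln N.+1%:R -> psi t - psi (t - d) <= d * psi1 t) ->
  t < ln N.+1%:R ->
  \sum_(1 <= n < N.+1) n%:R^-1 * (psi (t - ln n%:R) - psi (t - ln n.+1%:R)) <= 2 * psi1 t.
Proof.
move=> h h1 hd tN.
apply: (@le_trans _ _ (\sum_(1 <= n < N.+1) (n%:R^-1 * n%:R^-1) * psi1 t)); last first.
  by rewrite -mulr_suml ler_wpM2r ?sum_inv_sqr // (trunc_mono_ge0 h1).
rewrite big_nat [leRHS]big_nat; apply: ler_sum => n /andP [n1 _].
rewrite -mulrA ler_wpM2l ?invr_ge0 //.
have tn : t - ln n%:R <= t by case: n n1 => // n _; have := lnS_ge0 n; lra.
have p0 : 0 <= psi1 t by rewrite (trunc_mono_ge0 h1).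
have -> : t - ln n.+1%:R = t - ln n%:R - (ln n.+1%:R - ln n%:R) by ring.
have l0 : 0 <= ln n.+1%:R - ln n%:R :> R by rewrite subr_ge0 ln_nat_le.
apply: le_trans (hd _ _ l0 (le_lt_trans tn tN)) _.
apply: ler_pM => //; last by apply: h1.2.
- by rewrite (trunc_mono_ge0 h1) // (le_lt_trans tn).
- exact: ln_succ_sub.
Qed.

(** After partial summation the constant [L] telescopes to [L * psi t], and the error e / n is
    absorbed by [sum_steps_div]. Here [psi1] plays the derivative of [psi]. *)
Lemma dsum_upper c N psi psi1 t (L e : R) : 0 <= e ->
  (forall n, (0 < n)%N -> msum c n <= L + e / n%:R) ->
  trunc_mono N psi -> trunc_mono N psi1 ->
  (forall t d, 0 <= d -> t < ln N.+1%:R -> psi t - psi (t - d) <= d * psi1 t) ->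
  t < ln N.+1%:R -> dsum c N psi t <= L * psi t + 2 * e * psi1 t.
Proof.
move=> e0 hM h h1 hd tN; rewrite dsum_abel //.
have e2 : e * \sum_(1 <= n < N.+1) n%:R^-1 * (psi (t - ln n%:R) - psi (t - ln n.+1%:R)) <= 2 * e * psi1 t.
  by rewrite (mulrC 2) -mulrA ler_wpM2l // sum_steps_div.
apply: le_trans (lerD (lexx _) e2).
rewrite -(sum_steps h tN) !mulr_sumr -big_split /= big_nat [leRHS]big_nat.
apply: ler_sum => n /andP [n1 _]; rewrite mulrA -mulrDl ler_wpM2r ?hM //.
exact: trunc_mono_step h tN n1.
Qed.

Lemma dsum_lower c N psi psi1 t (L e : R) : 0 <= e ->
  (forall n, (0 < n)%N -> L - e / n%:R <= msum c n) ->
  trunc_mono N psi -> trunc_mono N psi1 ->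
  (forall t d, 0 <= d -> t < ln N.+1%:R -> psi t - psi (t - d) <= d * psi1 t) ->
  t < ln N.+1%:R -> L * psi t - 2 * e * psi1 t <= dsum c N psi t.
Proof.
move=> e0 hM h h1 hd tN; rewrite dsum_abel //.
have e2 : e * \sum_(1 <= n < N.+1) n%:R^-1 * (psi (t - ln n%:R) - psi (t - ln n.+1%:R)) <= 2 * e * psi1 t.
  by rewrite (mulrC 2) -mulrA ler_wpM2l // sum_steps_div.
apply: le_trans (lerB (lexx _) e2) _.
rewrite -(sum_steps h tN) !mulr_sumr -sumrB /= big_nat [leRHS]big_nat.
apply: ler_sum => n /andP [n1 _]; rewrite mulrA -mulrBl ler_wpM2r ?hM //.
exact: trunc_mono_step h tN n1.
Qed.

Lemma dsum_trunc c N psi t : (forall t, t < 0 -> psi t = 0) -> t < 0 -> dsum c N psi t = 0.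
Proof.
move=> h0 t0; rewrite /dsum big_nat big1 // => n /andP [n1 _]; rewrite h0 ?mulr0 //.
by case: n n1 => // n _; have := lnS_ge0 n; lra.
Qed.

Lemma dsum_pos_mono c N psi : (forall n, 0 <= c n) -> trunc_mono N psi -> trunc_mono N (dsum c N psi).
Proof.
move=> c0 [h0 h1]; split=> [t t0|t t' tt tN]; first exact: dsum_trunc.
rewrite /dsum big_nat [leRHS]big_nat; apply: ler_sum => n /andP [n1 _].
rewrite ler_wpM2l ?divr_ge0 // h1 ?lerB // (le_lt_trans _ tN) //.
by case: n n1 => // n _; have := lnS_ge0 n; lra.
Qed.

Lemma dsum_le c N psi psi1 t : (forall n, 0 <= c n) ->
  (forall t, t < ln N.+1%:R -> psi t <= psi1 t) -> t < ln N.+1%:R -> dsum c N psi t <= dsum c N psi1 t.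
Proof.
move=> c0 h tN; rewrite /dsum big_nat [leRHS]big_nat; apply: ler_sum => n /andP [n1 _].
rewrite ler_wpM2l ?divr_ge0 // h // (le_lt_trans _ tN) //.
by case: n n1 => // n _; have := lnS_ge0 n; lra.
Qed.

Lemma dsumB c N psi psi1 t : dsum c N (fun x => psi x - psi1 x) t = dsum c N psi t - dsum c N psi1 t.
Proof. by rewrite /dsum -sumrB; apply: eq_bigr => n _; rewrite mulrBr. Qed.

Lemma dsumZ c N psi a t : dsum c N (fun x => a * psi x) t = a * dsum c N psi t.
Proof. by rewrite /dsum mulr_sumr; apply: eq_bigr => n _; rewrite mulrCA. Qed.

Lemma dsum_shift c N psi d t : dsum c N (fun x => psi (x - d)) t = dsum c N psi (t - d).
Proof. by rewrite /dsum; apply: eq_bigr => n _; rewrite addrAC. Qed.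

Definition dconv u v n : R := \sum_(d <- divisors n) u d * v (n %/ d)%N.

Lemma big_divisors_nat (F : nat -> R) (N n : nat) : (0 < n <= N)%N ->
  \sum_(d <- divisors n) F d = \sum_(1 <= d < N.+1 | (d %| n)%N) F d.
Proof.
move=> /andP [n0 nN]; rewrite -[RHS]big_filter; apply: perm_big.
apply: uniq_perm; rewrite ?divisors_uniq ?filter_uniq ?iota_uniq //.
move=> d; rewrite -dvdn_divisors // mem_filter mem_index_iota ltnS.
case dn : (d %| n)%N => //=; rewrite (dvdn_gt0 n0 dn) /=.
by rewrite (leq_trans (dvdn_leq n0 dn) nN).
Qed.

Lemma dconvE (N : nat) u v n : (0 < n <= N)%N ->
  dconv u v n = \sum_(1 <= a < N.+1) \sum_(1 <= b < N.+1 | (a * b == n)%N) u a * v b.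
Proof.
move=> nN; have /andP [n0 nN'] := nN.
rewrite /dconv (big_divisors_nat _ nN) big_mkcond big_nat [RHS]big_nat; apply: eq_bigr => a /andP [a0 aN].
case: ifP => an; last first.
  by rewrite big1 // => b /eqP e; rewrite -e dvdn_mulr in an.
rewrite -big_filter (_ : [seq b <- _ | _] = [:: (n %/ a)%N]) ?big_seq1 //.
rewrite (eq_filter (a2 := pred1 (n %/ a)%N)); last first.
  by move=> b /=; rewrite eqn_div // mulnC.
rewrite filter_pred1_uniq ?iota_uniq // mem_index_iota divn_gt0 // dvdn_leq // ltnS.
by apply: leq_trans nN'; apply: leq_div.
Qed.

(** Because ln (a b) = ln a + ln b, a convolution becomes an iterated sum; pairs with a b > N carry
    weight 0, as t < ln (N + 1). *)
Lemma dsum_dconv u v N psi t : (forall t, t < 0 -> psi t = 0) -> t < ln N.+1%:R ->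
  dsum (dconv u v) N psi t = dsum u N (dsum v N psi) t.
Proof.
move=> h0 tN.
transitivity (\sum_(1 <= a < N.+1) \sum_(1 <= b < N.+1)
    u a * v b / (a * b)%:R * psi (t - ln (a * b)%:R)); last first.
  rewrite /dsum big_nat [RHS]big_nat; apply: eq_bigr => a /andP [a0 _].
  rewrite mulr_sumr big_nat [RHS]big_nat; apply: eq_bigr => b /andP [b0 _].
  rewrite natrM lnM ?posrE ?ltr0n // invfM opprD addrA; ring.
transitivity (\sum_(1 <= n < N.+1) \sum_(1 <= a < N.+1) \sum_(1 <= b < N.+1 | (a * b == n)%N)
    u a * v b / (a * b)%:R * psi (t - ln (a * b)%:R)).
  rewrite /dsum big_nat [RHS]big_nat; apply: eq_bigr => n nN; rewrite (dconvE (N := N)) //.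
  rewrite !mulr_suml; apply: eq_bigr => a _; rewrite !mulr_suml; apply: eq_bigr => b /eqP -> //.
rewrite exchange_big /= big_nat [RHS]big_nat; apply: eq_bigr => a /andP [a0 _].
rewrite (exchange_big_dep xpredT) //= big_nat [RHS]big_nat; apply: eq_bigr => b /andP [b0 _].
have ab0 : (0 < a * b)%N by rewrite muln_gt0 a0.
have [abN|abN] := leqP (a * b)%N N.
  rewrite -big_filter (eq_filter (a2 := pred1 (a * b)%N)); last by move=> n; rewrite /= eq_sym.
  by rewrite filter_pred1_uniq ?iota_uniq ?mem_index_iota ?ab0 // big_seq1.
rewrite h0 ?mulr0; last by rewrite subr_lt0 (lt_le_trans tN) // ln_nat_le.
by rewrite big1.
Qed.
End DirichletSums.

(** * Explicit partial sums of chi(n)/n for the real characters modulo 24 *)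

Section Characters.
Variable R : realType.

(* A real character mod 24 is given by the residues where it is 1 and -1, so that its identities are decided
   by computation on 0, .., 23. Below, chi3, chi8 and chi24 are (-3/n), (-2/n) and (6/n) for n coprime to 6. *)
Definition chz (pos neg : seq nat) (n : nat) : int :=
  (n %% 24 \in pos)%N%:Z - (n %% 24 \in neg)%N%:Z.

Definition chi0z := chz [:: 1; 5; 7; 11; 13; 17; 19; 23]%N [::].
Definition chi3z := chz [:: 1; 7; 13; 19]%N [:: 5; 11; 17; 23]%N.
Definition chi8z := chz [:: 1; 11; 17; 19]%N [:: 5; 7; 13; 23]%N.
Definition chi24z := chz [:: 1; 5; 19; 23]%N [:: 7; 11; 13; 17]%N.

Definition chi0 n : R := (chi0z n)%:~R.
Definition chi3 n : R := (chi3z n)%:~R.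
Definition chi8 n : R := (chi8z n)%:~R.
Definition chi24 n : R := (chi24z n)%:~R.

Lemma chzM pos neg : all (fun a => all (fun b => chz pos neg (a * b) == chz pos neg a * chz pos neg b)
     (iota 0 24)) (iota 0 24) ->
  forall a b, chz pos neg (a * b)%N = chz pos neg a * chz pos neg b.
Proof.
move=> /allP h a b; have ha : (a %% 24)%N \in iota 0 24 by rewrite mem_iota ltn_mod.
have hb : (b %% 24)%N \in iota 0 24 by rewrite mem_iota ltn_mod.
have /allP /(_ _ hb) /eqP := h _ ha.
by rewrite /chz modnMm !modn_mod.
Qed.

Lemma chi0M a b : chi0 (a * b)%N = chi0 a * chi0 b.
Proof. by rewrite /chi0 -intrM; congr _%:~R; apply: chzM; vm_compute. Qed.
Lemma chi3M a b : chi3 (a * b)%N = chi3 a * chi3 b.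
Proof. by rewrite /chi3 -intrM; congr _%:~R; apply: chzM; vm_compute. Qed.
Lemma chi8M a b : chi8 (a * b)%N = chi8 a * chi8 b.
Proof. by rewrite /chi8 -intrM; congr _%:~R; apply: chzM; vm_compute. Qed.

Lemma chi24E n : chi24 n = chi3 n * chi8 n.
Proof.
rewrite /chi24 /chi3 /chi8 -intrM; congr _%:~R; rewrite /chi24z /chi3z /chi8z /chz.
have : (n %% 24 < 24)%N by rewrite ltn_mod.
by move: (n %% 24)%N; do 24 (case=> //).
Qed.

Lemma chz_period pos neg k n : chz pos neg (24 * k + n)%N = chz pos neg n.
Proof. by rewrite /chz mulnC modnMDl. Qed.

Lemma chi3_table : (chi3 1 = 1) * (chi3 2 = 0) * (chi3 3 = 0) * (chi3 4 = 0) * (chi3 5 = -1) * (chi3 6 = 0) *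
    (chi3 7 = 1) * (chi3 8 = 0) * (chi3 9 = 0) * (chi3 10 = 0) * (chi3 11 = -1) * (chi3 12 = 0) * (chi3 13 =
    1) * (chi3 14 = 0) * (chi3 15 = 0) * (chi3 16 = 0) * (chi3 17 = -1) * (chi3 18 = 0) * (chi3 19 = 1) *
    (chi3 20 = 0) * (chi3 21 = 0) * (chi3 22 = 0) * (chi3 23 = -1) * (chi3 24 = 0).
Proof. by do 23 split. Qed.

Lemma chi8_table : (chi8 1 = 1) * (chi8 2 = 0) * (chi8 3 = 0) * (chi8 4 = 0) * (chi8 5 = -1) * (chi8 6 = 0) *
    (chi8 7 = -1) * (chi8 8 = 0) * (chi8 9 = 0) * (chi8 10 = 0) * (chi8 11 = 1) * (chi8 12 = 0) * (chi8 13 =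
    -1) * (chi8 14 = 0) * (chi8 15 = 0) * (chi8 16 = 0) * (chi8 17 = 1) * (chi8 18 = 0) * (chi8 19 = 1) *
    (chi8 20 = 0) * (chi8 21 = 0) * (chi8 22 = 0) * (chi8 23 = -1) * (chi8 24 = 0).
Proof. by do 23 split. Qed.

Lemma chi24_table : (chi24 1 = 1) * (chi24 2 = 0) * (chi24 3 = 0) * (chi24 4 = 0) * (chi24 5 = 1) * (chi24 6 =
    0) * (chi24 7 = -1) * (chi24 8 = 0) * (chi24 9 = 0) * (chi24 10 = 0) * (chi24 11 = -1) * (chi24 12 = 0) *
    (chi24 13 = -1) * (chi24 14 = 0) * (chi24 15 = 0) * (chi24 16 = 0) * (chi24 17 = -1) * (chi24 18 = 0) *
    (chi24 19 = 1) * (chi24 20 = 0) * (chi24 21 = 0) * (chi24 22 = 0) * (chi24 23 = 1) * (chi24 24 = 0).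
Proof. by do 23 split. Qed.

Section Blocks.
Variables (c : nat -> R).
Hypothesis per : forall k n, c (24 * k + n)%N = c n.

Definition bsum (X : nat -> R) j : R := \sum_(1 <= i < j.+1) c i * X i.

Lemma msum_block k j : msum c (24 * k + j) = msum c (24 * k) + bsum (fun i => (24 * k + i)%:R^-1) j.
Proof.
elim: j => [|j IH]; first by rewrite addn0 /bsum big_geq // addr0.
rewrite addnS /bsum big_nat_recr //= addrA -/(bsum _ j) -IH.
by rewrite /msum big_nat_recr //= -!addnS per.
Qed.

(** The upper bounds telescope through 1/(k (k + 1)) = 1/k - 1/(k + 1). *)
Lemma msum_block_bounds (b : R) :
  (forall k, (0 < k)%N -> 0 <= bsum (fun i => (24 * k + i)%:R^-1) 24 <= b / (k%:R * k.+1%:R)) ->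
  forall k, (0 < k)%N -> msum c 24 <= msum c (24 * k) <= msum c 24 + b * (1 - k%:R^-1).
Proof.
move=> h; elim=> [//|[_ _|k IH _]]; first by rewrite muln1 invr1 subrr mulr0 addr0 lexx.
have /andP [IH1 IH2] := IH isT; have /andP [h1 h2] := h k.+1 isT.
have -> : (24 * k.+2 = 24 * k.+1 + 24)%N by lia.
rewrite msum_block.
have e : b * (1 - k.+2%:R^-1) = b * (1 - k.+1%:R^-1) + b / (k.+1%:R * k.+2%:R).
  rewrite -[k.+2%:R]natr1; have : 0 < k.+1%:R :> R by rewrite ltr0n.
  move: k.+1%:R => x x0; field; apply/andP; split; apply/eqP; lra.
by rewrite e addrA (le_trans IH1) ?lerDl //= lerD.
Qed.
End Blocks.

Lemma periodic_chz pos neg k n : (chz pos neg (24 * k + n)%N)%:~R = (chz pos neg n)%:~R :> R.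
Proof. by rewrite chz_period. Qed.

Fixpoint isum (z : nat -> int) (j : nat) : int := if j is j'.+1 then isum z j' + z j else 0.

Lemma bsum_upper (z : nat -> int) (X : nat -> R) (b : nat) (m j : nat) :
  all (fun i => isum z i <= b%:Z) (iota 0 m.+1) ->
  (forall i, (0 < i)%N -> X i.+1 <= X i) -> (forall i, 0 <= X i) ->
  (j <= m)%N -> bsum (fun n => (z n)%:~R) X j <= b%:R * X 1.
Proof.
move=> /allP hb dX X0 jm.
have hs i : (i <= m)%N -> (isum z i)%:~R <= b%:R :> R.
  by move=> im; rewrite -[b%:R]/(b%:Z%:~R) ler_int hb // mem_iota.
case: j jm => [_|j jm]; first by rewrite /bsum big_geq // mulr_ge0.
(* The invariant of partial summation: the coefficient of [X j.+1] is nonpositive, so the right-hand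
   side only grows as [X] decreases. *)
suff h : bsum (fun n => (z n)%:~R) X j.+1 <= b%:R * X 1%N + ((isum z j.+1)%:~R - b%:R) * X j.+1.
  by apply: le_trans h _; rewrite gerDl mulr_le0_ge0 // subr_le0 hs.
elim: j jm => [|j IH] jm.
  by rewrite /bsum big_nat1 /= add0r mulrBl addrC subrK.
rewrite /bsum big_nat_recr //= -/(bsum _ _ _) -[isum z j + _]/(isum z j.+1).
apply: le_trans (lerD (IH (ltnW jm)) (lexx _)) _.
have h1 := hs _ (ltnW jm); have h2 := dX j.+1 isT.
have h3 : ((isum z j.+1)%:~R - b%:R) * X j.+1 <= ((isum z j.+1)%:~R - b%:R) * X j.+2.
  by rewrite ler_wnM2l // subr_le0.
rewrite intrD; apply: le_trans (_ : b%:R * X 1%N + ((isum z j.+1)%:~R - b%:R) * X j.+2 + (z j.+2)%:~R * X j.+2 <= _).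
  by rewrite lerD2r lerD2l.
by rewrite le_eqVlt; apply/orP; left; apply/eqP; ring.
Qed.

Lemma bsum_lower (z : nat -> int) (X : nat -> R) (b : nat) (m j : nat) :
  all (fun i => isum (fun n => - z n) i <= b%:Z) (iota 0 m.+1) ->
  (forall i, (0 < i)%N -> X i.+1 <= X i) -> (forall i, 0 <= X i) ->
  (j <= m)%N -> - (b%:R * X 1) <= bsum (fun n => (z n)%:~R) X j.
Proof.
move=> hb dX X0 jm; rewrite lerNl; apply: le_trans (bsum_upper hb dX X0 jm).
by rewrite /bsum -sumrN big_nat [leRHS]big_nat; apply: ler_sum => i _; rewrite intrN mulNr.
Qed.

(* An integer lower bound for [D * \sum_(i <= j) z i / i], which can be evaluated by computation. *)
Definition floor_sum (z : nat -> int) (D j : nat) : int :=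
  isum (fun i => ((z i * D%:Z) %/ i%:Z)%Z) j.

Lemma floor_sum_le (z : nat -> int) (D j : nat) :
  (floor_sum z D j)%:~R <= D%:R * msum (fun n => (z n)%:~R) j :> R.
Proof.
elim: j => [|j IH]; first by rewrite /msum big_geq // mulr0.
rewrite /floor_sum /= intrD /msum big_nat_recr //= mulrDr -/(msum _ _) lerD //.
rewrite mulrA ler_pdivlMr ?ltr0n // -[j.+1%:R]/(j.+1%:Z%:~R) -intrM -[D%:R]/(D%:Z%:~R) -intrM ler_int.
by rewrite (mulrC D%:Z) lez_floor.
Qed.

Lemma floor_sum_ge (z : nat -> int) (D j : nat) :
  D%:R * msum (fun n => (z n)%:~R) j <= (- floor_sum (fun n => - z n) D j)%:~R :> R.
Proof.
rewrite intrN lerNr; apply: le_trans (floor_sum_le _ _ _) _.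
rewrite -mulrN ler_wpM2l // /msum -sumrN big_nat [leRHS]big_nat; apply: ler_sum => i _.
by rewrite intrN mulNr.
Qed.
End Characters.

Section CharacterBounds.
Variable R : realType.

Definition blockinv (k i : nat) : R := (24 * k + i)%:R^-1.
Local Notation X := blockinv.

Lemma blockinv_decr k i j : (0 < i)%N -> (i <= j)%N -> X k j <= X k i.
Proof.
by move=> i0 ij; rewrite /blockinv lef_pV2 ?posrE ?ltr0n ?ler_nat ?leq_add2l // addn_gt0 ?i0 ?(leq_trans i0 ij) orbT.
Qed.

Lemma blockinv_ge0 k i : 0 <= X k i.
Proof. by rewrite /blockinv invr_ge0. Qed.

(* The residues i and 24 - i are paired: with w = 24 k + 12 and d = 11, 7, 5, 1, both 1/(w - d) - 1/(w + d) and
   1/(w - d) + 1/(w + d) are multiples of 1/(w^2 - d^2); b = 1/w^2. *)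
Lemma blockinv_pairs k : (0 < k)%N -> let z : R := (k%:R * k.+1%:R)^-1 in
  exists w a1 a5 a7 a11 b : R,
  [/\ [/\ X k 1 - X k 23 = 22 * a1, X k 5 - X k 19 = 14 * a5, X k 7 - X k 17 = 10 * a7 &
      X k 11 - X k 13 = 2 * a11],
      [/\ X k 1 + X k 23 = 2 * w * a1, X k 5 + X k 19 = 2 * w * a5, X k 7 + X k 17 = 2 * w * a7 &
      X k 11 + X k 13 = 2 * w * a11] &
      [/\ a5 <= a1, a7 <= a5, a11 <= a7, b <= a11 & 0 <= b] /\
      [/\ a1 - b = 121 * (a1 * b), 121 * (a1 * b) <= a1 / 10, w * (a1 - b) <= a1 * (27 / 8), 18 * a1 <= z / 32 &
       a1 - a7 >= a7 - a11 /\ 0 <= w]].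
Proof.
move=> k0 z; have k1 : 1 <= k%:R :> R by rewrite ler1n.
have e i : (24 * k + i)%:R = 24 * k%:R + i%:R :> R by rewrite natrD natrM.
have ek : k.+1%:R = k%:R + 1 :> R by rewrite -natr1.
rewrite /z /blockinv !e ek; move: (k%:R : R) k1 => x x1.
exists (24 * x + 12), ((24 * x + 1) * (24 * x + 23))^-1, ((24 * x + 5) * (24 * x + 19))^-1,
 ((24 * x + 7) * (24 * x + 17))^-1, ((24 * x + 11) * (24 * x + 13))^-1, ((24 * x + 12) ^+ 2)^-1.
have ne (c : R) : 0 <= c -> 24 * x + c != 0 by move=> c0; apply/eqP; lra.
have n1 := ne 1 ltac:(lra); have n23 := ne 23 ltac:(lra); have n5 := ne 5 ltac:(lra).
have n19 := ne 19 ltac:(lra); have n7 := ne 7 ltac:(lra); have n17 := ne 17 ltac:(lra).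
have n11 := ne 11 ltac:(lra); have n13 := ne 13 ltac:(lra); have n12 := ne 12 ltac:(lra).
have pos (c d : R) : 0 <= c -> 0 <= d -> 0 < (24 * x + c) * (24 * x + d).
  by move=> c0 d0; apply: mulr_gt0; lra.
split.
- by split; field; rewrite ?n1 ?n23 ?n5 ?n19 ?n7 ?n17 ?n11 ?n13.
- by split; field; rewrite ?n1 ?n23 ?n5 ?n19 ?n7 ?n17 ?n11 ?n13.
have p12 : 0 < (24 * x + 12) ^+ 2 by rewrite expr2 pos //; lra.
split.
  split; last by rewrite invr_ge0 sqr_ge0.
  - by rewrite lef_pV2 ?posrE ?pos //; nra.
  - by rewrite lef_pV2 ?posrE ?pos //; nra.
  - by rewrite lef_pV2 ?posrE ?pos //; nra.
  - by rewrite lef_pV2 ?posrE ?pos //; nra.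
split.
- by field; rewrite n12 n1 n23.
- rewrite mulrCA ler_pM2l ?invr_gt0 ?pos // ler_pdivrMr //; nra.
- rewrite [leLHS](_ : _ = ((24 * x + 1) * (24 * x + 23))^-1 * (121 / (24 * x + 12))); last first.
    by field; rewrite n12 n1 n23.
  rewrite ler_pM2l ?invr_gt0 ?pos // ler_pdivrMr; lra.
- rewrite ler_pdivrMr ?pos // mulrAC ler_pdivlMr // ler_pdivlMl; [nra | by apply: mulr_gt0; lra].
split; last by lra.
rewrite -subr_ge0.
have -> : ((24 * x + 1) * (24 * x + 23))^-1 - ((24 * x + 7) * (24 * x + 17))^-1 -
  (((24 * x + 7) * (24 * x + 17))^-1 - ((24 * x + 11) * (24 * x + 13))^-1) =
  ((24 * x + 7) * (24 * x + 17))^-1 * ((24 * x + 1) * (24 * x + 23))^-1 * ((24 * x + 11) * (24 * x + 13))^-1 *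
  (96 * ((24 * x + 11) * (24 * x + 13)) - 24 * ((24 * x + 1) * (24 * x + 23))).
  by field; rewrite n1 n23 n7 n17 n11 n13.
rewrite !mulr_ge0 ?invr_ge0 ?ltW ?pos //; nra.
Qed.

(** [chi3] and [chi8] are odd and see the differences 1/(w - d) - 1/(w + d); [chi24] is even and
    sees the sums. The upper bounds are 18 a1, 22 (a1 - b) <= 22 a1 / 10 and 4 w (a1 - b) <= 27 a1 /
    2, with a1 <= 1/(576 k (k + 1)). Nonnegativity for [chi8] uses a1 - a7 >= a7 - a11. *)
Lemma bsum24_bounds k : (0 < k)%N -> let z : R := k%:R * k.+1%:R in
  [/\ 0 <= bsum (@chi3 R) (X k) 24 <= (1 / 32) / z,
      0 <= bsum (@chi8 R) (X k) 24 <= (1 / 240) / z &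
      0 <= bsum (@chi24 R) (X k) 24 <= (3 / 128) / z].
Proof.
move=> k0 z; have [w [a1 [a5 [a7 [a11 [b [[d1 d5 d7 d11] [s1 s5 s7 s11]]]]]]]] := blockinv_pairs k0.
rewrite -/z => -[[a51 a75 a117 ba b0] [ab ab' wab az [cv w0]]].
have wa : w * (a1 + a5 - a7 - a11) <= w * (2 * (a1 - b)).
  by rewrite ler_wpM2l //; lra.
have wa0 : 0 <= w * (a1 + a5 - a7 - a11) by rewrite mulr_ge0 //; lra.
have e3 : bsum (@chi3 R) (X k) 24 = 22 * a1 - 14 * a5 + 10 * a7 - 2 * a11.
  by rewrite -d1 -d5 -d7 -d11 /bsum unlock /= ?(@chi3_table R); ring.
have e8 : bsum (@chi8 R) (X k) 24 = 22 * a1 - 14 * a5 - 10 * a7 + 2 * a11.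
  by rewrite -d1 -d5 -d7 -d11 /bsum unlock /= ?(@chi8_table R); ring.
have e24 : bsum (@chi24 R) (X k) 24 = 2 * (w * (a1 + a5 - a7 - a11)).
  rewrite (_ : _ * _ = 2 * w * a1 + 2 * w * a5 - 2 * w * a7 - 2 * w * a11); last by ring.
  by rewrite -s1 -s5 -s7 -s11 /bsum unlock /= ?(@chi24_table R); ring.
rewrite {}e3 {}e8 {}e24; clear d1 d5 d7 d11 s1 s5 s7 s11 k0.
have az' : 18 * a1 * 32 <= z^-1 by rewrite -ler_pdivlMr.
move: (z^-1) az' => y {}az; rewrite -ab in ab'.
split; apply/andP; split.
- by clear - a51 a75 a117 ba b0; lra.
- by clear - a51 a75 a117 ba b0 ab' az; lra.
- by clear - a51 a75 a117 ba b0 cv; lra.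
- by clear - a51 a75 a117 ba b0 ab' az; lra.
- by rewrite mulr_ge0.
by clear - wa wab az; lra.
Qed.

Lemma msum_floor_lower z (D v : nat) j : (0 < D)%N -> (v%:Z <= floor_sum z D j)%R ->
  v%:R / D%:R <= msum (fun n => (z n)%:~R) j :> R.
Proof.
move=> D0 h; rewrite ler_pdivrMr ?ltr0n // mulrC; apply: le_trans (floor_sum_le _ _ _ _).
by rewrite -[v%:R]/(v%:Z%:~R) ler_int.
Qed.

Lemma msum_floor_upper z (D v : nat) j : (0 < D)%N -> (- floor_sum (fun n => - z n) D j <= v%:Z)%R ->
  msum (fun n => (z n)%:~R) j <= v%:R / D%:R :> R.
Proof.
move=> D0 h; rewrite ler_pdivlMr ?ltr0n // mulrC; apply: le_trans (floor_sum_ge _ _ _ _) _.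
by rewrite -[v%:R]/(v%:Z%:~R) ler_int.
Qed.

Lemma natr_fracM (a b c : nat) : (0 < c)%N -> (a * c)%:R / (b * c)%:R = a%:R / b%:R :> R.
Proof. by move=> c0; rewrite !natrM -mulf_div divff ?mulr1 // pnatr_eq0 -lt0n. Qed.

Lemma msum24_bounds : [/\ 439 / 500 <= msum (@chi3 R) 24 <= 22 / 25,
     369 / 500 <= msum (@chi8 R) 24 <= 37 / 50 &
     msum (@chi24 R) 24 <= 116 / 125].
Proof.
split; [apply/andP; split | apply/andP; split |].
- rewrite -(@natr_fracM 439 500 6) //; apply: (@msum_floor_lower chi3z) => //; by vm_compute.
- rewrite -(@natr_fracM 22 25 120) //; apply: (@msum_floor_upper chi3z) => //; by vm_compute.
- rewrite -(@natr_fracM 369 500 6) //; apply: (@msum_floor_lower chi8z) => //; by vm_compute.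
- rewrite -(@natr_fracM 37 50 60) //; apply: (@msum_floor_upper chi8z) => //; by vm_compute.
- rewrite -(@natr_fracM 116 125 24) //; apply: (@msum_floor_upper chi24z) => //; by vm_compute.
Qed.

(** The limits are the values L(1, chi) without the Euler factors at 2 and 3: pi / (2 sqrt 3) =
    0.907, pi / (3 sqrt 2) = 0.740 and ln (5 + 2 sqrt 6) / sqrt 6 = 0.936, approximately. The first
    24 terms are computed and the blocks bound the rest. *)
Lemma msum_multiple24 k : (0 < k)%N ->
  [/\ 439 / 500 <= msum (@chi3 R) (24 * k) <= 114 / 125,
      369 / 500 <= msum (@chi8 R) (24 * k) <= 149 / 200 &
      msum (@chi24 R) (24 * k) <= 119 / 125].
Proof.
move=> k0; have [/andP [l3 u3] /andP [l8 u8] u24] := msum24_bounds.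
have tail (M u v b : R) : 0 <= b -> M <= u -> u + b <= v -> M + b * (1 - k%:R^-1) <= v.
  move=> b0 h1; apply: le_trans; apply: lerD => //.
  by rewrite ler_piMr // lerBlDr lerDl invr_ge0.
have /andP [l3' u3'] := @msum_block_bounds R (@chi3 R) (@periodic_chz R _ _) _ (fun k k0 => let: And3 h _ _ := bsum24_bounds k0 in h) _ k0.
have /andP [l8' u8'] := @msum_block_bounds R (@chi8 R) (@periodic_chz R _ _) _ (fun k k0 => let: And3 _ h _ := bsum24_bounds k0 in h) _ k0.
have /andP [l24' u24'] := @msum_block_bounds R (@chi24 R) (@periodic_chz R _ _) _ (fun k k0 => let: And3 _ _ h := bsum24_bounds k0 in h) _ k0.
split; [apply/andP; split | apply/andP; split |].
- exact: le_trans l3'.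
- by apply: le_trans u3' _; apply: tail u3 _; clear - R; lra.
- exact: le_trans l8'.
- by apply: le_trans u8' _; apply: tail u8 _; clear - R; lra.
by apply: le_trans u24' _; apply: tail u24 _; clear - R; lra.
Qed.

Lemma block_split (P : nat -> Prop) : (forall j, (0 < j < 24)%N -> P j) ->
  (forall k j, (0 < k)%N -> (j < 24)%N -> P (24 * k + j)%N) -> forall n, (0 < n)%N -> P n.
Proof.
move=> h0 h n n0; have e : n = (24 * (n %/ 24) + n %% 24)%N by rewrite mulnC -divn_eq.
have [k0|k0] := posnP (n %/ 24).
  by apply: h0; rewrite n0 /= e k0 muln0 add0n ltn_mod.
by rewrite e; apply: h => //; rewrite ltn_mod.
Qed.

Lemma blockinv1_le k j (c : R) : (0 < k)%N -> (j < 24)%N -> 0 <= c ->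
  c * X k 1 <= 2 * c / (24 * k + j)%:R.
Proof.
move=> k0 j24 c0; rewrite (mulrC 2) -mulrA ler_wpM2l // ler_pdivlMr ?ltr0n; last by lia.
rewrite /blockinv mulrC ler_pdivrMr ?ltr0n; last by lia.
by rewrite -natrM ler_nat; lia.
Qed.

Lemma blockinv1_small k : (0 < k)%N -> X k 1 <= 1 / 25.
Proof.
move=> k0; rewrite /blockinv div1r lef_pV2 ?posrE ?ltr0n //; last by rewrite addn1.
by rewrite ler_nat; lia.
Qed.

(** The initial indices j < 24 precede the telescoping blocks; multiplied by 1000 j, the bound
    becomes an integer test done by computation. *)
Lemma msum_small_upper z (U e j : nat) : (0 < j < 24)%N ->
  all (fun j => j%:Z * - floor_sum (fun n => - z n) 1000 j <= (j * U + 1000 * e)%N%:Z) (iota 1 23) ->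
  msum (fun n => (z n)%:~R) j <= U%:R / 1000 + e%:R / j%:R :> R.
Proof.
move=> /andP [j0 j24] /allP /(_ j) h; have {}h := h ltac:(rewrite mem_iota; lia).
have j0' : 0 < j%:R :> R by rewrite ltr0n.
have t0 : 0 < 1000 :> R by [].
have := floor_sum_ge R z 1000 j; rewrite -(ler_pM2l j0') => /le_trans h1.
have {h1}h : j%:R * (1000 * msum (fun n => (z n)%:~R) j) <= j%:R * U%:R + 1000 * e%:R :> R.
  apply: h1; rewrite -!natrM -natrD -[j%:R]/(j%:Z%:~R) -intrM -[(_ + _)%:R]/(_%:Z%:~R) ler_int.
  exact: h.
rewrite -(ler_pM2l (mulr_gt0 j0' t0)) -mulrA; apply: le_trans h _.
by rewrite le_eqVlt; apply/orP; left; apply/eqP; field; rewrite gt_eqF.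
Qed.

End CharacterBounds.

Section PartialSumBounds.
Variable R : realType.
Local Notation X := (@blockinv R).

Lemma msum_small_lower z (U e j : nat) : (0 < j < 24)%N ->
  all (fun j => (j * U)%N%:Z <= j%:Z * floor_sum z 1000 j + (1000 * e)%N%:Z) (iota 1 23) ->
  U%:R / 1000 - e%:R / j%:R <= msum (fun n => (z n)%:~R) j :> R.
Proof.
move=> /andP [j0 j24] /allP /(_ j) h; have {}h := h ltac:(rewrite mem_iota; lia).
have j0' : 0 < j%:R :> R by rewrite ltr0n.
have t0 : 0 < 1000 :> R by [].
have := floor_sum_le R z 1000 j; rewrite -(ler_pM2l j0').
set M := msum _ j => h1.
have h2 : j%:R * U%:R <= j%:R * (floor_sum z 1000 j)%:~R + 1000 * e%:R :> R.
  rewrite -!natrM -[(j * U)%:R]/(_%:Z%:~R) -[(1000 * e)%:R]/(_%:Z%:~R) -[j%:R]/(j%:Z%:~R) -intrM -intrD ler_int.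
  exact: h.
rewrite -(ler_pM2l (mulr_gt0 j0' t0)) -mulrA.
rewrite (_ : j%:R * (1000 * (U%:R / 1000 - e%:R / j%:R)) = j%:R * U%:R - 1000 * e%:R); last first.
  by field; rewrite gt_eqF.
lra.
Qed.

Lemma bsum_block_upper z (b : nat) k j : (0 < k)%N -> (j < 24)%N ->
  all (fun i => isum z i <= b%:Z) (iota 0 25) ->
  bsum (fun n => (z n)%:~R) (X k) j <= (2 * b)%:R / (24 * k + j)%:R.
Proof.
move=> k0 j24 hb; rewrite natrM; apply: le_trans (blockinv1_le k0 j24 (ler0n _ _)).
apply: (@bsum_upper R z (X k) b 24 j) => //.
- by move=> i i0; apply: blockinv_decr.
- exact: blockinv_ge0.
- exact: ltnW.
Qed.

Lemma bsum_block_lower z (b : nat) k j : (j < 24)%N ->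
  all (fun i => isum (fun n => - z n) i <= b%:Z) (iota 0 25) ->
  - (b%:R * X k 1) <= bsum (fun n => (z n)%:~R) (X k) j.
Proof.
move=> j24 hb; apply: (@bsum_lower R z (X k) b 24 j) => //.
- by move=> i i0; apply: blockinv_decr.
- exact: blockinv_ge0.
- exact: ltnW.
Qed.

Lemma msum_chi3_upper n : (0 < n)%N -> msum (@chi3 R) n <= 114 / 125 + 2 / n%:R.
Proof.
move: n; apply: block_split => [j j24|k j k0 j24].
  rewrite -(@natr_fracM R 114 125 8) //; exact: (@msum_small_upper R chi3z (114 * 8) 2 j j24 ltac:(by vm_compute)).
have [/andP [_ h] _ _] := msum_multiple24 R k0.
rewrite msum_block; last exact: periodic_chz.
by apply: lerD h (@bsum_block_upper chi3z 1 k j k0 j24 ltac:(by vm_compute)).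
Qed.

Lemma msum_chi3_lower n : (0 < n)%N -> 439 / 500 - 2 / n%:R <= msum (@chi3 R) n.
Proof.
move: n; apply: block_split => [j j24|k j k0 j24].
  rewrite -(@natr_fracM R 439 500 2) //; exact: (@msum_small_lower chi3z (439 * 2) 2 j j24 ltac:(by vm_compute)).
have [/andP [h _] _ _] := msum_multiple24 R k0.
rewrite msum_block; last exact: periodic_chz.
have b : - (0%:R * X k 1) <= bsum (@chi3 R) (X k) j.
  exact: (@bsum_block_lower chi3z 0 k j j24 ltac:(by vm_compute)).
have : 0 <= 2 / (24 * k + j)%:R :> R by rewrite divr_ge0.
rewrite mul0r oppr0 in b; lra.
Qed.

Lemma msum_chi8_upper n : (0 < n)%N -> msum (@chi8 R) n <= 149 / 200 + 2 / n%:R.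
Proof.
move: n; apply: block_split => [j j24|k j k0 j24].
  rewrite -(@natr_fracM R 149 200 5) //; exact: (@msum_small_upper R chi8z (149 * 5) 2 j j24 ltac:(by vm_compute)).
have [_ /andP [_ h] _] := msum_multiple24 R k0.
rewrite msum_block; last exact: periodic_chz.
by apply: lerD h (@bsum_block_upper chi8z 1 k j k0 j24 ltac:(by vm_compute)).
Qed.

(** Nonnegative partial sums make summation against [chi8] a positive functional on nondecreasing
    functions, although [chi8] changes sign. *)
Lemma msum_chi8_ge0 n : 0 <= msum (@chi8 R) n.
Proof.
have [->|] := posnP n; first by rewrite /msum big_geq.
move: n; apply: block_split => [j j24|k j k0 j24].
  have := @msum_small_lower chi8z 0 0 j j24 ltac:(by vm_compute).
  by rewrite !mul0r subr0.
have [_ /andP [h _] _] := msum_multiple24 R k0.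
rewrite msum_block; last exact: periodic_chz.
have b : - (1%:R * X k 1) <= bsum (@chi8 R) (X k) j.
  exact: (@bsum_block_lower chi8z 1 k j j24 ltac:(by vm_compute)).
have := blockinv1_small R k0; rewrite mul1r in b; lra.
Qed.

Lemma msum_chi24_upper n : (0 < n)%N -> msum (@chi24 R) n <= 119 / 125 + 4 / n%:R.
Proof.
move: n; apply: block_split => [j j24|k j k0 j24].
  rewrite -(@natr_fracM R 119 125 8) //; exact: (@msum_small_upper R chi24z (119 * 8) 4 j j24 ltac:(by vm_compute)).
have [_ _ h] := msum_multiple24 R k0.
rewrite msum_block; last exact: periodic_chz.
by apply: lerD h (@bsum_block_upper chi24z 2 k j k0 j24 ltac:(by vm_compute)).
Qed.
End PartialSumBounds.

(** * Representation numbers and split primes *)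

Lemma coprime_ind (P : nat -> Prop) : P 1%N ->
  (forall q k, prime q -> (0 < k)%N -> P (q ^ k)%N) ->
  (forall m n, (0 < m)%N -> (0 < n)%N -> coprime m n -> P m -> P n -> P (m * n)%N) ->
  forall n, (0 < n)%N -> P n.
Proof.
move=> P1 Pq PM; elim/ltn_ind => n IH n0.
have [n1|n1] := leqP n 1; first by have -> : n = 1%N by lia.
have pp := pdiv_prime n1; set q := pdiv n in pp.
have lq : (0 < logn q n)%N by rewrite logn_gt0 mem_primes pp n0 pdiv_dvd.
have e : n = (n`_q * n`_q^')%N by rewrite partnC.
have q1 : (1 < n`_q)%N by rewrite p_part (ltn_exp2l 0) // prime_gt1.
rewrite e; apply: PM; rewrite ?part_gt0 ?coprime_partC //; first by rewrite p_part; apply: Pq.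
by apply: IH; rewrite ?part_gt0 // [X in (_ < X)%N]e -[X in (X < _)%N]mul1n ltn_mul2r part_gt0.
Qed.

Section MultiplicativeFunctions.
Variable R : realType.
Implicit Types u v : nat -> R.

Definition multiplicative_on_coprime u : Prop :=
  forall m n, (0 < m)%N -> (0 < n)%N -> coprime m n -> u (m * n)%N = u m * u n.

Lemma dconv_mult u v : multiplicative_on_coprime u -> multiplicative_on_coprime v ->
  multiplicative_on_coprime (dconv u v).
Proof.
move=> hu hv m n m0 n0 cmn; rewrite /dconv big_divisors_coprime //= big_distrl /=.
rewrite big_seq [RHS]big_seq; apply: eq_bigr => d; rewrite -dvdn_divisors // => dm.
rewrite big_distrr /= big_seq [RHS]big_seq; apply: eq_bigr => e; rewrite -dvdn_divisors // => en.
have d0 := dvdn_gt0 m0 dm; have e0 := dvdn_gt0 n0 en.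
rewrite hu //; last by apply: coprime_dvdl dm _; apply: coprime_dvdr en _.
have -> : (m * n %/ (d * e) = (m %/ d) * (n %/ e))%N.
  have [k ->] := dvdnP dm; have [l ->] := dvdnP en.
  by rewrite mulnACA !mulnK // muln_gt0 d0.
have m0' : (0 < m %/ d)%N by rewrite divn_gt0 // dvdn_leq.
have n0' : (0 < n %/ e)%N by rewrite divn_gt0 // dvdn_leq.
have cde : coprime (m %/ d) (n %/ e).
  by apply: coprime_dvdl (dvdn_div dm) _; apply: coprime_dvdr (dvdn_div en) _.
by rewrite (hv _ _ m0' n0' cde) mulrACA.
Qed.

Lemma dconv_pfactor u v q k : prime q ->
  dconv u v (q ^ k)%N = \sum_(j < k.+1) u (q ^ j)%N * v (q ^ (k - j))%N.
Proof.
move=> pq; rewrite /dconv (perm_big _ (perm_divisors_pfactor k pq)) big_map.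
rewrite -[iota _ _]/(index_iota 0 k.+1) big_mkord; apply: eq_bigr => j _.
by rewrite expnB ?prime_gt0 // -ltnS.
Qed.

Lemma dconv1 u v : dconv u v 1 = u 1%N * v 1%N.
Proof. by rewrite /dconv -[divisors 1]/[:: 1%N] big_seq1 divn1. Qed.

Local Notation chi0 := (@chi0 R).
Local Notation chi3 := (@chi3 R).
Local Notation chi8 := (@chi8 R).

(* [rsum] counts the ideals of norm n of Q(sqrt -3), and [rho] those of Q(sqrt -3, sqrt -2), the Euler factors
   at 2 and 3 being removed. *)
Definition rsum : nat -> R := dconv chi3 chi0.
Definition rsum8 n : R := chi8 n * rsum n.
Definition rho : nat -> R := dconv rsum8 rsum.

Lemma rsum_mult : multiplicative_on_coprime rsum.
Proof. by apply: dconv_mult => m n _ _ _; [apply: chi3M | apply: chi0M]. Qed.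

Lemma rsum8_mult : multiplicative_on_coprime rsum8.
Proof. by move=> m n m0 n0 c; rewrite /rsum8 chi8M rsum_mult //; ring. Qed.

Lemma rho_mult : multiplicative_on_coprime rho.
Proof. exact: dconv_mult rsum8_mult rsum_mult. Qed.

Lemma chiX (chi : nat -> R) q j : (forall a b, chi (a * b)%N = chi a * chi b) -> chi 1%N = 1 ->
  chi (q ^ j)%N = chi q ^+ j.
Proof. by move=> hM h1; elim: j => [|j IH]; rewrite ?expn0 // expnS hM IH exprS. Qed.

Lemma rsum_pfactor q k : prime q ->
  rsum (q ^ k)%N = \sum_(j < k.+1) chi3 q ^+ j * chi0 q ^+ (k - j).
Proof.
move=> pq; rewrite /rsum dconv_pfactor //; apply: eq_bigr => j _.
by rewrite !chiX //; [apply: chi0M | apply: chi3M].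
Qed.

Lemma residue_ind (P : nat -> bool) : all P (iota 0 24) -> forall q, P (q %% 24)%N.
Proof. by move=> /allP h q; apply: h; rewrite mem_iota ltn_mod. Qed.

Lemma chi_cases q : [\/ chi0 q = 1 /\ chi3 q = 1, chi0 q = 1 /\ chi3 q = -1 | chi0 q = 0 /\ chi3 q = 0].
Proof.
have := @residue_ind (fun i => (chi0z i, chi3z i) \in [:: (1, 1); (1, -1); (0, 0)]) ltac:(by vm_compute) q.
have e pos neg : chz pos neg (q %% 24)%N = chz pos neg q by rewrite /chz modn_mod.
rewrite /chi0z /chi3z !e -/(chi0z q) -/(chi3z q) /chi0 /chi3 !inE !xpair_eqE.
by case/or3P => /andP [/eqP -> /eqP ->]; [apply: Or31 | apply: Or32; rewrite mulrN1z | apply: Or33].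
Qed.

Lemma chi8_cases q : [\/ chi8 q = 1, chi8 q = -1 | chi8 q = 0].
Proof.
have := @residue_ind (fun i => chi8z i \in [:: 1; -1; 0]) ltac:(by vm_compute) q.
have e pos neg : chz pos neg (q %% 24)%N = chz pos neg q by rewrite /chz modn_mod.
rewrite /chi8z !e -/(chi8z q) /chi8 !inE.
by case/or3P => /eqP ->; [apply: Or31 | apply: Or32; rewrite mulrN1z | apply: Or33].
Qed.

Lemma chi80 q : chi8 q * chi0 q = chi8 q.
Proof.
have := @residue_ind (fun i => chi8z i * chi0z i == chi8z i) ltac:(by vm_compute) q.
have e pos neg : chz pos neg (q %% 24)%N = chz pos neg q by rewrite /chz modn_mod.
by rewrite /chi8z /chi0z !e => /eqP h; rewrite /chi8 /chi0 -intrM h.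
Qed.
End MultiplicativeFunctions.

Section Positivity.
Variable R : realType.
Local Notation chi0 := (@chi0 R).
Local Notation chi3 := (@chi3 R).
Local Notation chi8 := (@chi8 R).
Local Notation chi24 := (@chi24 R).
Local Notation rsum := (@rsum R).
Local Notation rsum8 := (@rsum8 R).
Local Notation rho := (@rho R).

Lemma rsum_pfactor_split q k : prime q -> chi0 q = 1 -> chi3 q = 1 -> rsum (q ^ k)%N = k.+1%:R.
Proof.
move=> pq h0 h3; rewrite rsum_pfactor // h0 h3.
under eq_bigr => j _ do rewrite !expr1n mulr1.
by rewrite sumr_const card_ord.
Qed.

Lemma rsum_pfactor_inert q k : prime q -> chi0 q = 1 -> chi3 q = -1 -> rsum (q ^ k)%N = (~~ odd k)%:R.
Proof.
move=> pq h0 h3; rewrite rsum_pfactor // h0 h3.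
under eq_bigr => j _ do rewrite !expr1n mulr1.
elim: k => [|k IH]; first by rewrite big_ord1 expr0.
rewrite big_ord_recr /= IH -signr_odd /=; case: (odd k) => /=; rewrite ?expr0 ?expr1 ?add0r ?subrr //.
Qed.

Lemma rsum_pfactor_ramified q k : prime q -> chi0 q = 0 -> chi3 q = 0 -> rsum (q ^ k)%N = (k == 0)%N%:R.
Proof.
move=> pq h0 h3; rewrite rsum_pfactor // h0 h3 big_ord_recr /= subnn expr0 mulr1 expr0n big1 ?add0r //.
by move=> j _; rewrite [X in _ * X]expr0n subn_eq0 leqNgt ltn_ord mulr0.
Qed.

Lemma rsum_ge0 n : 0 <= rsum n.
Proof.
have [->|n0] := posnP n.
  by rewrite /rsum /dconv -[divisors 0]/[:: 1%N] big_seq1 [X in _ * X](_ : _ = 0) ?mulr0.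
elim/coprime_ind: n / n0.
- by rewrite /rsum dconv1 mulr_ge0.
- move=> q k pq _; have [[h0 h3]|[h0 h3]|[h0 h3]] := chi_cases R q.
  + by rewrite rsum_pfactor_split.
  + by rewrite rsum_pfactor_inert.
  + by rewrite rsum_pfactor_ramified.
- by move=> m n m0 n0 c hm hn; rewrite rsum_mult // mulr_ge0.
Qed.

Lemma sum_alt (k : nat) : \sum_(j < k.+1) (-1) ^+ j * j.+1%:R =
  (if odd k then - k./2.+1%:R else k./2.+1%:R) :> R.
Proof.
elim: k => [|k IH]; first by rewrite big_ord1 expr0 mul1r.
rewrite big_ord_recr /= IH -signr_odd /= uphalf_half; have := odd_double_half k.
move: (k./2) => h; case: (odd k) => /= <-; rewrite ?expr0 ?expr1 -muln2; ring.
Qed.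

(** The coefficient of x^k in (1 + x)^(-2) (1 - x)^(-2) = (1 - x^2)^(-2). *)
Lemma sum_alt_conv (k : nat) : \sum_(j < k.+1) (-1) ^+ j * (j.+1%:R * (k - j).+1%:R) =
  (if odd k then 0 else k./2.+1%:R) :> R.
Proof.
elim: k => [|k IH]; first by rewrite big_ord1 expr0 !mul1r.
rewrite big_ord_recr /= subnn.
have -> : \sum_(i < k.+1) (-1) ^+ i * (i.+1%:R * (k.+1 - i).+1%:R) =
  \sum_(j < k.+1) (-1) ^+ j * (j.+1%:R * (k - j).+1%:R) + \sum_(j < k.+1) (-1) ^+ j * j.+1%:R :> R.
  rewrite -big_split /=; apply: eq_bigr => i _.
  have ik : (i <= k)%N by rewrite -ltnS.
  by rewrite (subSn ik) -[(k - i).+2%:R]natr1 !mulrDr !mulr1.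
rewrite IH -addrA mulr1.
have := sum_alt k.+1; rewrite big_ord_recr /= => ->.
rewrite uphalf_half; case: (odd k) => /=; rewrite ?add0r ?add1n ?add0n ?addrN //.
Qed.

Lemma rho_pfactor q k : prime q ->
  rho (q ^ k)%N = \sum_(j < k.+1) chi8 q ^+ j * (rsum (q ^ j)%N * rsum (q ^ (k - j))%N).
Proof.
move=> pq; rewrite /rho dconv_pfactor //; apply: eq_bigr => j _.
by rewrite /rsum8 chiX ?mulrA //; apply: chi8M.
Qed.

(** Checked on prime powers. For q split in Q(sqrt -3) the Euler factor is (1 - x)^(-4) or (1 -
    x^2)^(-2) according to the sign of [chi8 q]; for q inert, [rsum] lives on even exponents, where
    the sign of [chi8] disappears. *)
Lemma rho_ge0 n : (0 < n)%N -> 0 <= rho n.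
Proof.
elim/coprime_ind: n /.
- by rewrite /rho dconv1 /rsum8 !mulr_ge0 ?rsum_ge0.
- move=> q k pq _; rewrite rho_pfactor //; have [[h0 h3]|[h0 h3]|[h0 h3]] := chi_cases R q.
  + have [h8|h8|h8] := chi8_cases R q; rewrite h8; last first.
    * by apply: sumr_ge0 => j _; rewrite !mulr_ge0 ?rsum_ge0 // exprn_ge0.
    * under eq_bigr => j _ do rewrite !rsum_pfactor_split //.
      by rewrite sum_alt_conv; case: ifP.
    * by apply: sumr_ge0 => j _; rewrite !mulr_ge0 ?rsum_ge0 // exprn_ge0.
  + apply: sumr_ge0 => j _; rewrite (rsum_pfactor_inert _ pq) //.
    case oj : (odd j); first by rewrite mul0r mulr0.
    by rewrite mul1r mulr_ge0 ?rsum_ge0 // exprn_even_ge0 ?oj.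
  + apply: sumr_ge0 => j _; rewrite (rsum_pfactor_ramified _ pq) //.
    by case: (nat_of_ord j) => [|i]; rewrite ?mul0r ?mulr0 // expr0 !mul1r rsum_ge0.
- by move=> m n m0 n0 c hm hn; rewrite rho_mult // mulr_ge0.
Qed.

(** Twisting by [chi8] sends [chi3] to [chi24] and [chi0] to [chi8]. Thus [rho] is the convolution
    of all four characters, that is, a product of L-functions. *)
Lemma rsum8_dconv n : rsum8 n = dconv chi24 chi8 n.
Proof.
rewrite /rsum8 /rsum /dconv; have [->|n0] := posnP n.
  rewrite -[divisors 0]/[:: 1%N] !big_seq1 -[(0 %/ 1)%N]/0%N (_ : chi8 0%N = 0) ?mulr0 ?mul0r //.
rewrite mulr_sumr big_seq [RHS]big_seq; apply: eq_bigr => d; rewrite -dvdn_divisors // => dn.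
have {1}-> : n = (d * (n %/ d))%N by rewrite mulnC divnK.
rewrite chi8M chi24E.
by rewrite -[in RHS](@chi80 R (n %/ d)); ring.
Qed.
End Positivity.

(** * Factoring n into its parts over 7, 13 mod 24, over 1, 19 mod 24, and a square *)

Lemma ler_sum_inj (R : numDomainType) (S T : eqType) (r : seq S) (t : seq T) (f : S -> T) (G : T -> R) :
  uniq r -> uniq t -> {in r &, injective f} -> {in r, forall n, f n \in t} ->
  (forall y, 0 <= G y) -> \sum_(n <- r) G (f n) <= \sum_(y <- t) G y.
Proof.
move=> ur ut fi ft G0; rewrite -(big_map f xpredT G).
have um : uniq (map f r) by rewrite map_inj_in_uniq.
have -> : \sum_(y <- map f r) G y = \sum_(y <- t | y \in map f r) G y.
  rewrite -[RHS]big_filter; apply: perm_big; apply: uniq_perm; rewrite ?filter_uniq //.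
  move=> y; rewrite mem_filter; case h : (y \in map f r) => //=.
  by move/mapP: h => [n nr ->]; rewrite ft.
by rewrite big_mkcond; apply: ler_sum => y _; case: ifP.
Qed.

(** On a nonsquare, [index] returns the length [b.+1]; [rsum_split] only meets squares, since
    [rsum n != 0]. *)
Definition sqrt_nat (b : nat) : nat := index b [seq (c ^ 2)%N | c <- iota 0 b.+1].

Lemma sqrt_natK c : sqrt_nat (c ^ 2) = c.
Proof.
rewrite /sqrt_nat (index_map (f := fun c => (c ^ 2)%N)); last by move=> x y /eqP; rewrite eqn_sqr => /eqP.
have h : (c < (c ^ 2).+1)%N by have [->//|c0] := posnP c; rewrite ltnS -mulnn leq_pmulr.
by have := nth_iota 0 0 h; rewrite add0n => e; rewrite -{1}e index_uniq ?size_iota ?iota_uniq.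
Qed.

(* The primes 1 mod 3 fall into those that are 5 or 7 mod 8, which never divide p^2 + p + 1 for p | N, and those that
   are 1 or 3 mod 8. *)
Definition piQ : nat_pred := [pred p | (p %% 24)%N \in [:: 7; 13]%N].
Definition piS : nat_pred := [pred p | (p %% 24)%N \in [:: 1; 19]%N].

Section SplitPart.
Variable R : realType.
Local Notation chi0 := (@chi0 R).
Local Notation chi3 := (@chi3 R).
Local Notation rsum := (@rsum R).

Definition dpi (pi : nat_pred) (n : nat) : R := if pi.-nat n then (size (divisors n))%:R else 0.

Lemma dpi_ge0 pi n : 0 <= dpi pi n.
Proof. by rewrite /dpi; case: ifP. Qed.

Lemma rsum_le_divisors n : rsum n <= (size (divisors n))%:R.
Proof.
rewrite /rsum /dconv -sum1_size natr_sum; apply: ler_sum => d _.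
have [[h0 h3]|[h0 h3]|[h0 h3]] := chi_cases R d; have [[h0' h3']|[h0' h3']|[h0' h3']] := chi_cases R (n %/ d);
  rewrite h3 h0' ?mul0r ?mulr0 ?mulr1 //; lra.
Qed.

(** At an inert prime [rsum] is the indicator of even exponents, and at 2 and 3 that of exponent
    0. *)
Lemma rsum_nonsplit b : (0 < b)%N -> (forall q, prime q -> (q %| b)%N -> chi3 q != 1) ->
  rsum b = 0 \/ (rsum b = 1 /\ exists c, b = (c ^ 2)%N).
Proof.
elim/coprime_ind: b /.
- by move=> _; right; split; [rewrite /rsum dconv1 mulr1 | exists 1%N].
- move=> q k pq k0 /(_ q pq); rewrite dvdn_exp // => /(_ isT).
  have [[h0 h3]|[h0 h3]|[h0 h3]] := chi_cases R q; first by rewrite h3 eqxx.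
    rewrite rsum_pfactor_inert // => _; case ok : (odd k); first by left.
    right; split => //; exists (q ^ k./2)%N; rewrite -expnM muln2.
    by rewrite -{1}(odd_double_half k) ok.
  by rewrite rsum_pfactor_ramified // => _; left; rewrite gtn_eqF.
- move=> m n m0 n0 cmn hm hn h; rewrite rsum_mult //.
  case: (hm (fun q pq qm => h q pq (dvdn_mulr _ qm))) => [->|[-> [c ->]]]; first by left; rewrite mul0r.
  case: (hn (fun q pq qm => h q pq (dvdn_mull _ qm))) => [->|[-> [d ->]]]; first by left; rewrite mulr0.
  by right; split; [rewrite mulr1 | exists (c * d)%N; rewrite expnMn].
Qed.

Lemma chi_not_coprime6 q n : q \in [:: 2; 3]%N -> (q %| n)%N -> chi0 n = 0 /\ chi3 n = 0.
Proof.
move=> hq hn.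
have := @residue_ind (fun i => ((2 %| i) || (3 %| i))%N ==> ((chi0z i == 0) && (chi3z i == 0)))
  ltac:(by vm_compute) n.
have e pos neg : chz pos neg (n %% 24)%N = chz pos neg n by rewrite /chz modn_mod.
rewrite /chi0z /chi3z !e.
have -> : ((2 %| n %% 24) || (3 %| n %% 24))%N.
  rewrite /dvdn !modn_dvdm //; move: hq hn; rewrite !inE => /orP [] /eqP ->; rewrite /dvdn => -> //.
  by rewrite orbT.
by rewrite /= => /andP [/eqP h0 /eqP h3]; rewrite /chi0 /chi3 /chi0z /chi3z h0 h3.
Qed.

Lemma rsum_not_coprime6 q n : (0 < n)%N -> q \in [:: 2; 3]%N -> (q %| n)%N -> rsum n = 0.
Proof.
move=> n0 hq qn; rewrite /rsum /dconv big_seq big1 // => d; rewrite -dvdn_divisors // => dn.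
have pq : prime q by move: hq; rewrite !inE => /orP [] /eqP ->.
have : (q %| d * (n %/ d))%N by rewrite mulnC divnK.
rewrite Euclid_dvdM // => /orP [] h; have [h0 h3] := chi_not_coprime6 hq h.
  by rewrite h3 mul0r.
by rewrite h0 mulr0.
Qed.

(** The roots c that occur are prime to 6. Omitting only 3 among the odd multiples of 3 keeps a
    telescoping majorant and already brings the total, pi^2/8 - 1/9, below 9/8. *)
Definition sq_weight (c : nat) : R := if odd c && (c != 3)%N then (c%:R ^+ 2)^-1 else 0.

Lemma sq_weight_ge0 c : 0 <= sq_weight c.
Proof. by rewrite /sq_weight; case: ifP => // _; rewrite invr_ge0 exprn_ge0. Qed.

Lemma sum_sq_weight N : \sum_(1 <= c < N.+1) sq_weight c <= 9 / 8.
Proof.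
(* The tail works because 1/(4m) - 1/(4(m + 1)) = 1/((2m + 1)^2 - 1); at m = 2 both sides equal
   1. *)
have h m : (1 < m)%N -> \sum_(1 <= c < (2 * m).+1) sq_weight c <= 9 / 8 - (4 * m%:R)^-1.
  elim: m => [//|m IH]; rewrite ltnS leq_eqVlt => /orP [/eqP <-|m1].
    by rewrite unlock /= /sq_weight /= expr1n invr1; lra.
  have -> : (2 * m.+1 = (2 * m).+2)%N by lia.
  have m2 : (0 < 2 * m)%N by lia.
  rewrite big_nat_recr //= big_nat_recr //=.
  have -> : sq_weight (2 * m).+2 = 0 by rewrite /sq_weight /= oddM.
  have -> : sq_weight (2 * m).+1 = ((2 * m).+1%:R ^+ 2)^-1.
    by rewrite /sq_weight /= oddM /= ifT //; lia.
  rewrite addr0.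
  apply: le_trans (lerD (IH m1) (lexx _)) _.
  have mm : 1 <= m%:R :> R by rewrite ler1n; lia.
  rewrite -[(2 * m).+1%:R]natr1 natrM -[m.+1%:R]natr1; move: (m%:R : R) mm => x x1.
  have -> : 9 / 8 - (4 * x)^-1 + ((2 * x + 1) ^+ 2)^-1 =
    9 / 8 - (4 * (x + 1))^-1 - (4 * x * (x + 1) * (2 * x + 1) ^+ 2)^-1.
    field; do ! (apply/andP; split); apply/eqP; lra.
  by rewrite lerBlDr lerDl invr_ge0 !mulr_ge0 ?sqr_ge0 //; lra.
apply: le_trans (_ : \sum_(1 <= c < (2 * N.+2).+1) sq_weight c <= _).
  rewrite [leRHS](@big_cat_nat _ _ _ N.+1) //=; last by lia.
  by rewrite lerDl sumr_ge0 // => c _; apply: sq_weight_ge0.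
by apply: le_trans (h _ _) _ => //; rewrite lerBlDr lerDl invr_ge0 mulr_ge0.
Qed.
End SplitPart.

Section SplitBound.
Variable R : realType.
Local Notation chi3 := (@chi3 R).
Local Notation rsum := (@rsum R).
Local Notation dpi := (@dpi R).

Definition split_parts (n : nat) : nat * nat * nat :=
  (n`_piQ, (n`_piQ^')`_piS, sqrt_nat (n`_piQ^')`_piS^')%N.

Lemma rsum_split n : (0 < n)%N -> rsum n != 0 ->
  [/\ n = ((split_parts n).1.1 * (split_parts n).1.2 * (split_parts n).2 ^ 2)%N,
      rsum n <= dpi piQ (split_parts n).1.1 * dpi piS (split_parts n).1.2,
      (0 < (split_parts n).2)%N & odd (split_parts n).2 && ((split_parts n).2 != 3)%N].
Proof.
move=> n0 rn; rewrite /split_parts /=; set x := (n`_piQ)%N; set m := (n`_piQ^')%N; set y := (m`_piS)%N; set b := (m`_piS^')%N.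
have m0 : (0 < m)%N by rewrite part_gt0.
have x0 : (0 < x)%N by rewrite part_gt0.
have y0 : (0 < y)%N by rewrite part_gt0.
have b0 : (0 < b)%N by rewrite part_gt0.
have en : n = (x * m)%N by rewrite partnC.
have em : m = (y * b)%N by rewrite partnC.
have er : rsum n = rsum x * (rsum y * rsum b).
  by rewrite {1}en rsum_mult ?coprime_partC // em rsum_mult ?coprime_partC.
have nb : forall q, prime q -> (q %| b)%N -> chi3 q != 1.
  move=> q pq qb; have qm : (q %| m)%N by rewrite em dvdn_mull.
  have hQ : q \in piQ^' by apply: (pnatP _ m0 (part_pnat _ _)).
  have hS : q \in piS^' by apply: (pnatP _ b0 (part_pnat _ _)).
  have := @residue_ind (fun i => (i \notin [:: 7; 13]%N) ==> (i \notin [:: 1; 19]%N) ==> (chi3z i != 1)) ltac:(by vm_compute) q.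
  move: hQ hS; rewrite !inE /= => -> -> /=.
  by rewrite /chi3z /chz modn_mod -/(chz _ _ q) -/(chi3z q) -(eqr_int R).
have [r0|[r1 [c ec]]] := rsum_nonsplit b0 nb; first by rewrite er r0 !mulr0 eqxx in rn.
have -> : sqrt_nat b = c by rewrite ec sqrt_natK.
have c0 : (0 < c)%N by move: b0; rewrite ec expn_gt0 orbF.
split => //; first by rewrite {1}en em ec mulnA.
  rewrite er r1 mulr1 /dpi !part_pnat ler_pM ?rsum_ge0 ?rsum_le_divisors //.
have nd q : q \in [:: 2; 3]%N -> ~~ (q %| c)%N.
  move=> hq; apply: contra rn => qc; apply/eqP; apply: (@rsum_not_coprime6 R q) => //.
  by rewrite en em ec mulnA dvdn_mull // dvdn_exp.
apply/andP; split; first by rewrite -[odd c]negbK -dvdn2 nd.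
by apply: contra (nd 3%N isT) => /eqP ->.
Qed.

(* Write n = x y c^2 with x a product of primes of [piQ] and y of primes of [piS]; the factor 1 / s comes from
   (s - ln x - ln y) s <= (s - ln x) (s - ln y). *)
Lemma rsum_split_bound (Q : nat) (s := ln Q%:R : R) : (1 < Q)%N ->
  dsum rsum Q (phi 1) s <=
  9 / 8 / s * (dsum (dpi piQ) Q (phi 1) s * dsum (dpi piS) Q (phi 1) s).
Proof.
move=> Q1; have s0 : 0 < s by rewrite ln_gt0 // ltr1n.
have ls n : (0 < n <= Q)%N -> 0 <= s - ln n%:R.
  by move=> /andP [n0 nQ]; rewrite subr_ge0 ln_nat_le.
pose A (pi : nat_pred) (x : nat) : R := dpi pi x / x%:R * phi 1 (s - ln x%:R).
have A0 pi x : 0 <= A pi x by rewrite /A !mulr_ge0 ?dpi_ge0 ?invr_ge0 ?phi_ge0.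
pose G (z : nat * nat * nat) : R := A piQ z.1.1 * A piS z.1.2 * sq_weight R z.2 / s.
have G0 z : 0 <= G z by apply: divr_ge0 (ltW s0); apply: mulr_ge0 (sq_weight_ge0 _ _); apply: mulr_ge0.
have l1 n : (0 < n)%N -> 0 <= ln n%:R :> R by move=> n0; rewrite ln_ge0 // ler1n.
have main n : (0 < n <= Q)%N -> rsum n != 0 -> rsum n / n%:R * phi 1 (s - ln n%:R) <= G (split_parts n).
  move=> nQ rn; have /andP [n0 nQ'] := nQ; move: (rsum_split n0 rn).
  move: (split_parts n) => [[x y] c] /= [en rle c0 oc]; rewrite /G /A /sq_weight /= oc.
  have xy0 : (0 < x * y)%N by move: n0; rewrite en muln_gt0 => /andP [].
  have /andP [x0 y0] : (0 < x)%N && (0 < y)%N by rewrite -muln_gt0.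
  have xn : (x <= n)%N by rewrite en -mulnA leq_pmulr // muln_gt0 y0 expn_gt0 c0.
  have yn : (y <= n)%N by rewrite en mulnAC leq_pmull // muln_gt0 x0 expn_gt0 c0.
  have xQ := leq_trans xn nQ'; have yQ := leq_trans yn nQ'.
  rewrite !phi1E ?ls ?x0 ?y0 //.
  have eln : ln n%:R = ln x%:R + ln y%:R + ln (c ^ 2)%:R :> R.
    by rewrite en 2!natrM !lnM ?posrE ?mulr_gt0 ?ltr0n ?expn_gt0 ?c0.
  have hl : s - ln n%:R <= (s - ln x%:R) * (s - ln y%:R) / s.
    rewrite ler_pdivlMr // eln; have lx := l1 _ x0; have ly := l1 _ y0.
    have lc : 0 <= ln (c ^ 2)%:R :> R by rewrite l1 // expn_gt0 c0.
    by clear - s0 lx ly lc; nra.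
  move: hl (ls n nQ); move: (s - ln n%:R) => t hl t0.
  have -> : n%:R = x%:R * y%:R * c%:R ^+ 2 :> R by rewrite en 2!natrM natrX.
  have p0 : 0 <= (x%:R * y%:R * c%:R ^+ 2)^-1 :> R by rewrite invr_ge0 !mulr_ge0 ?exprn_ge0.
  apply: (@le_trans _ _ (dpi piQ x * dpi piS y / (x%:R * y%:R * c%:R ^+ 2) *
     ((s - ln x%:R) * (s - ln y%:R) / s))).
    apply: ler_pM => //; first by rewrite mulr_ge0 ?rsum_ge0.
    by rewrite ler_wpM2r.
  rewrite !invfM le_eqVlt; apply/orP; left; apply/eqP; ring.
pose r := [seq n <- index_iota 1 Q.+1 | rsum n != 0].
have e1 : dsum rsum Q (phi 1) s <= \sum_(n <- r) G (split_parts n).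
  rewrite /r big_filter /dsum (bigID (fun n => rsum n != 0)) /=.
  rewrite [X in _ + X]big1 ?addr0; last by move=> n /negPn /eqP ->; rewrite !mul0r.
  by rewrite big_nat_cond [leRHS]big_nat_cond; apply: ler_sum => n /andP [h1 h2]; apply: main.
apply: le_trans e1 _.
pose io := index_iota 1 Q.+1.
pose t := [seq (z, c) | z <- [seq (x, y) | x <- io, y <- io], c <- io].
apply: (@le_trans _ _ (\sum_(z <- t) G z)).
  apply: ler_sum_inj => //.
  - by rewrite filter_uniq ?iota_uniq.
  - by do ! (apply: allpairs_uniq; rewrite ?iota_uniq //; try by move=> [? ?] [? ?] _ _ [-> ->]).
  - move=> n m; rewrite !mem_filter !mem_index_iota => /and3P [rn n0 _] /and3P [rm m0 _].
    move: (rsum_split n0 rn) (rsum_split m0 rm).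
    by move: (split_parts n) (split_parts m) => [[x y] c] [[x' y'] c'] /= [-> _ _ _] [-> _ _ _] [-> -> ->].
  - move=> n; rewrite mem_filter mem_index_iota => /and3P [rn n0 nQ].
    move: (rsum_split n0 rn); move: (split_parts n) => [[x y] c] /= [en _ c0 _].
    have n0' := n0; rewrite en !muln_gt0 in n0'; have /andP [/andP [x0 y0] cc0] := n0'.
    apply: allpairs_f; first apply: allpairs_f; rewrite mem_index_iota ?x0 ?y0 ?c0 /= (leq_ltn_trans _ nQ) // en.
    + by rewrite -mulnA leq_pmulr // muln_gt0 y0 expn_gt0 c0.
    + by rewrite mulnAC leq_pmull // muln_gt0 x0 expn_gt0 c0.
    + rewrite -mulnn mulnA leq_pmull // !muln_gt0 x0 y0 c0 //.
rewrite /t big_allpairs_dep /= big_allpairs_dep /=.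
have -> : \sum_(x <- io) \sum_(y <- io) \sum_(c <- io) G (x, y, c) =
  (\sum_(c <- io) sq_weight R c) / s * ((\sum_(x <- io) A piQ x) * (\sum_(y <- io) A piS y)).
  rewrite [X in _ * X]big_distrl /= mulr_sumr; apply: eq_bigr => x _.
  rewrite [X in _ * X]big_distrr /= mulr_sumr; apply: eq_bigr => y _.
  by rewrite -mulrA big_distrl /=; apply: eq_bigr => c _; rewrite /G /=; ring.
rewrite -/(dsum (dpi piQ) Q (phi 1) s) -/(dsum (dpi piS) Q (phi 1) s).
apply: ler_wpM2r; first by apply: mulr_ge0; rewrite /dsum; apply: sumr_ge0 => *; apply: A0.
by apply: ler_wpM2r; [rewrite invr_ge0 ltW | apply: sum_sq_weight].
Qed.
End SplitBound.

Section QuadraticBound.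
Variable R : realType.
Local Notation chi0 := (@chi0 R).
Local Notation chi3 := (@chi3 R).
Local Notation chi8 := (@chi8 R).
Local Notation rsum := (@rsum R).
Local Notation rsum8 := (@rsum8 R).
Local Notation rho := (@rho R).
Local Notation dpi := (@dpi R).

Lemma chi_piS n : piS.-nat n -> [/\ chi0 n = 1, chi3 n = 1 & chi8 n = 1].
Proof.
move=> nS; have n0 := part_gt0 piS n; rewrite (part_pnat_id nS) in n0.
have h : (n %% 24 \in [:: 1; 19])%N.
  apply: residue_closed => // r pr rn.
  by have := pnatP _ n0 nS r pr rn.
have := @residue_ind (fun i => (i \in [:: 1; 19]%N) ==> [&& chi0z i == 1, chi3z i == 1 & chi8z i == 1]) ltac:(by vm_compute) n.
have e pos neg : chz pos neg (n %% 24)%N = chz pos neg n by rewrite /chz modn_mod.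
rewrite h /= /chi0z /chi3z /chi8z !e => /and3P [/eqP h0 /eqP h3 /eqP h8].
by rewrite /chi0 /chi3 /chi8 /chi0z /chi3z /chi8z h0 h3 h8.
Qed.

Lemma dpi_piS_rsum n : (0 < n)%N -> piS.-nat n -> rsum n = dpi piS n /\ rsum8 n = dpi piS n.
Proof.
move=> n0 nS; have e : rsum n = dpi piS n.
  rewrite /dpi nS /rsum /dconv -sum1_size natr_sum big_seq [RHS]big_seq; apply: eq_bigr => d.
  rewrite -dvdn_divisors // => dn.
  have [_ -> _] := chi_piS (pnat_dvd dn nS).
  by have [-> _ _] := chi_piS (pnat_dvd (dvdn_div dn) nS); rewrite mulr1.
by split=> //; rewrite /rsum8 e; have [_ _ ->] := chi_piS nS; rewrite mul1r.
Qed.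

(** All the characters are 1 on integers composed of primes 1, 19 mod 24, so the two sides agree
    there; elsewhere the left side is 0 and [rho] is nonnegative. *)
Lemma dconv_piS_le_rho n : (0 < n)%N -> dconv (dpi piS) (dpi piS) n <= rho n.
Proof.
move=> n0; case nS : (piS.-nat n); last first.
  rewrite /dconv big_seq big1 ?rho_ge0 // => d; rewrite -dvdn_divisors // => dn; rewrite /dpi.
  case: ifP => dS; last by rewrite mul0r.
  case: ifP => eS; last by rewrite mulr0.
  by move: nS; rewrite -(divnK dn) pnatM dS eS.
rewrite /rho /dconv big_seq [leRHS]big_seq; apply: ler_sum => d; rewrite -dvdn_divisors // => dn.
have [_ ->] := dpi_piS_rsum (dvdn_gt0 n0 dn) (pnat_dvd dn nS).
have nd0 : (0 < n %/ d)%N by rewrite divn_gt0 ?(dvdn_gt0 n0 dn) // dvdn_leq.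
by have [-> _] := dpi_piS_rsum nd0 (pnat_dvd (dvdn_div dn) nS).
Qed.

(* AM-GM in the form p q <= ((p + q)^2 / 2) / 2, with p = s - ln y and q = s - ln z. *)
Lemma dsum_piS_sqr (Q : nat) (s := ln Q%:R : R) : (0 < Q)%N ->
  (dsum (dpi piS) Q (phi 1) s) ^+ 2 <= dsum rho (Q ^ 2) (phi 2) (2 * s) / 2.
Proof.
move=> Q0; set u := dpi piS; set N := (Q ^ 2)%N.
have eN : 2 * s = ln N%:R by rewrite /N natrX lnXn ?ltr0n // mulr_natl.
have N0 : (0 < N)%N by rewrite expn_gt0 Q0.
have QN : (Q <= N)%N by rewrite /N -mulnn leq_pmulr.
have tN : 2 * s < ln N.+1%:R by rewrite eN ltr_ln ?posrE ?ltr0n ?ltr_nat.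
have u0 n : 0 <= u n by apply: dpi_ge0.
apply: (@le_trans _ _ (dsum u N (dsum u N (phi 2)) (2 * s) / 2)); last first.
  rewrite ler_wpM2r ?invr_ge0 // -dsum_dconv //; last by move=> t; apply: phi_neg.
  rewrite /dsum big_nat [leRHS]big_nat; apply: ler_sum => n /andP [n1 _].
  by rewrite ler_wpM2r ?phi_ge0 // ler_wpM2r ?invr_ge0 // dconv_piS_le_rho.
pose B y z : R := u y / y%:R * (u z / z%:R * phi 2 (2 * s - ln y%:R - ln z%:R)).
have B0 y z : 0 <= B y z by rewrite /B !mulr_ge0 ?u0 ?invr_ge0 ?phi_ge0.
have -> : dsum u N (dsum u N (phi 2)) (2 * s) = \sum_(1 <= y < N.+1) \sum_(1 <= z < N.+1) B y z.
  by rewrite /dsum; apply: eq_bigr => y _; rewrite mulr_sumr.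
have ext (F : nat -> R) : (forall n, 0 <= F n) -> \sum_(1 <= n < Q.+1) F n <= \sum_(1 <= n < N.+1) F n.
  by move=> F0; rewrite [leRHS](@big_cat_nat _ _ _ Q.+1) //= lerDl sumr_ge0.
apply: (@le_trans _ _ ((\sum_(1 <= y < Q.+1) \sum_(1 <= z < Q.+1) B y z) / 2)); last first.
  rewrite ler_wpM2r ?invr_ge0 //; apply: le_trans (ext _ _); last by move=> n; apply: sumr_ge0.
  by apply: ler_sum => y _; apply: ext.
rewrite expr2 /dsum big_distrl /= mulr_suml big_nat [leRHS]big_nat; apply: ler_sum => y /andP [y0 yQ].
rewrite big_distrr /= mulr_suml big_nat [leRHS]big_nat; apply: ler_sum => z /andP [z0 zQ].
have ly : 0 <= s - ln y%:R by rewrite subr_ge0 ln_nat_le.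
have lz : 0 <= s - ln z%:R by rewrite subr_ge0 ln_nat_le.
rewrite /B !phi1E // phi2E; last by lra.
have y00 : 0 <= u y / y%:R by rewrite divr_ge0.
have z00 : 0 <= u z / z%:R by rewrite divr_ge0.
move: (u y / y%:R) (u z / z%:R) y00 z00 => a b a0 b0.
have -> : 2 * s - ln y%:R - ln z%:R = (s - ln y%:R) + (s - ln z%:R) by ring.
move: (s - ln y%:R) (s - ln z%:R) => p q.
have -> : a * p * (b * q) = a * b * (p * q) by ring.
have -> : a * (b * ((p + q) ^+ 2 / 2)) / 2 = a * b * ((p + q) ^+ 2 / 4) by field.
rewrite ler_wpM2l ?mulr_ge0 // -subr_ge0.
have -> : (p + q) ^+ 2 / 4 - p * q = ((p - q) / 2) ^+ 2 by field.
exact: sqr_ge0.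
Qed.
End QuadraticBound.

(** * Sums over integers prime to 6, and their convolutions with the characters *)

Section Harmonic6.
Variable R : realType.
Local Notation chi0 := (@chi0 R).
Implicit Types (t : R) (k n m : nat).

Lemma chi0_ge0 n : 0 <= chi0 n.
Proof. by have [[-> _]|[-> _]|[-> _]] := chi_cases R n. Qed.

Lemma chi0_mod6 m : [/\ chi0 (6 * m + 1) = 1, chi0 (6 * m + 2) = 0, chi0 (6 * m + 3) = 0 &
  chi0 (6 * m + 4) = 0] /\ chi0 (6 * m + 5) = 1 /\ chi0 (6 * m + 6) = 0.
Proof.
have e j : chi0 (6 * m + j) = chi0 (6 * (m %% 4)%N + j).
  have em : (6 * m + j = m %/ 4 * 24 + (6 * (m %% 4) + j))%N by rewrite {1}(divn_eq m 4); lia.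
  by rewrite em /chi0 /chi0z /chz modnMDl.
rewrite !e; have : (m %% 4 < 4)%N by rewrite ltn_mod.
by move: (m %% 4)%N; do 4 (case=> [_|]; [by []|]).
Qed.

Lemma ln_step6_ge n : (0 < n)%N -> 6 / (n + 6)%:R <= ln (n + 6)%:R - ln n%:R :> R.
Proof.
move=> n0; have p : 0 < n%:R :> R by rewrite ltr0n.
have p6 : 0 < (n + 6)%:R :> R by rewrite ltr0n addn_gt0 n0.
rewrite -lerN2 opprB -ln_div ?posrE //.
have -> : n%:R / (n + 6)%:R = 1 + - (6 / (n + 6)%:R) :> R.
  by rewrite natrD in p6 *; field; rewrite gt_eqF.
apply: le_ln1Dx; rewrite ltrN2 ltr_pdivrMr // mul1r natrD; lra.
Qed.

Lemma ln_step6_le n : (0 < n)%N -> ln (n + 6)%:R - ln n%:R <= 6 / n%:R :> R.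
Proof.
move=> n0; have p : 0 < n%:R :> R by rewrite ltr0n.
rewrite -ln_div ?posrE // ?ltr0n ?addn_gt0 ?n0 //.
have -> : (n + 6)%:R / n%:R = 1 + 6 / n%:R :> R by rewrite natrD; field; rewrite gt_eqF.
by apply: le_ln1Dx; have : 0 <= 6 / n%:R :> R; [rewrite divr_ge0 | lra].
Qed.

Lemma harmonic_step_le k n t : (0 < n)%N ->
  (n + 6)%:R^-1 * phi k (t - ln (n + 6)%:R) <=
  (phi k.+1 (t - ln n%:R) - phi k.+1 (t - ln (n + 6)%:R)) / 6.
Proof.
move=> n0; have h := ln_step6_ge n0.
have d0 : 0 <= ln (n + 6)%:R - ln n%:R :> R by apply: le_trans h; rewrite divr_ge0.
have := phi_incr_ge k (t - ln n%:R) d0.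
rewrite (_ : t - ln n%:R - (ln (n + 6)%:R - ln n%:R) = t - ln (n + 6)%:R); last by ring.
move=> h2; rewrite ler_pdivlMr //; apply: le_trans h2.
by rewrite mulrAC (mulrC _ 6) ler_wpM2r ?phi_ge0.
Qed.

Lemma harmonic_step_ge k n t : (0 < n)%N ->
  (phi k.+1 (t - ln n%:R) - phi k.+1 (t - ln (n + 6)%:R)) / 6 <= n%:R^-1 * phi k (t - ln n%:R).
Proof.
move=> n0; have h := ln_step6_le n0.
have d0 : 0 <= ln (n + 6)%:R - ln n%:R :> R by rewrite subr_ge0 ln_nat_le // leq_addr.
have := phi_incr_le k (t - ln n%:R) d0.
rewrite (_ : t - ln n%:R - (ln (n + 6)%:R - ln n%:R) = t - ln (n + 6)%:R); last by ring.
move=> h2; rewrite ler_pdivrMr //; apply: le_trans h2 _.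
by rewrite mulrAC (mulrC _ 6) ler_wpM2r ?phi_ge0.
Qed.

Let sum6 (F : nat -> R) m : (forall n, chi0 n = 0 -> F n = 0) ->
  \sum_(1 <= n < 6 * m.+1 + 1) F n = \sum_(1 <= n < 6 * m + 1) F n + F (6 * m + 1)%N + F (6 * m + 5)%N.
Proof.
move=> hF; have rec j : \sum_(1 <= n < 6 * m + j.+2) F n = \sum_(1 <= n < 6 * m + j.+1) F n + F (6 * m + j.+1)%N.
  by rewrite addnS big_nat_recr ?addnS.
have [[_ /hF h2 /hF h3 /hF h4] [_ /hF h6]] := chi0_mod6 m.
by rewrite (_ : 6 * m.+1 + 1 = 6 * m + 7)%N ?rec ?h2 ?h3 ?h4 ?h6 ?addr0 //; lia.
Qed.

Let term0 k t n : chi0 n = 0 -> chi0 n / n%:R * phi k (t - ln n%:R) = 0.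
Proof. by move=> ->; rewrite !mul0r. Qed.

(** The progressions 1 and 5 mod 6 are each compared with an integral in steps of 6, giving 1/6 +
    1/6 in the main term; their first terms give 1 + 1/5. *)
Lemma dsum_chi0_upper N k t : dsum chi0 N (phi k) t <= 6 / 5 * phi k t + phi k.+1 t / 3.
Proof.
have h m : \sum_(1 <= n < 6 * m.+1 + 1) chi0 n / n%:R * phi k (t - ln n%:R) <=
  6 / 5 * phi k t + (phi k.+1 t - phi k.+1 (t - ln (6 * m + 1)%:R)) / 6 +
  (phi k.+1 t - phi k.+1 (t - ln (6 * m + 5)%:R)) / 6.
  have l5 : 0 <= ln 5 :> R by rewrite ln_ge0 // ler1n.
  elim: m => [|m IH].
    rewrite sum6; last exact: term0.
    have [[h1 _ _ _] [h5 _]] := chi0_mod6 0.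
    rewrite big_geq // h1 h5 !muln0 !add0n ln1 !subr0 subrr mul0r add0r addr0.
    have : phi k (t - ln 5%:R) <= phi k t by apply: phi_mono; lra.
    have : 0 <= phi k.+1 t - phi k.+1 (t - ln 5%:R) by rewrite subr_ge0; apply: phi_mono; lra.
    by lra.
  rewrite sum6; last exact: term0.
  have [[-> _ _ _] [-> _]] := chi0_mod6 m.+1.
  have s1 := @harmonic_step_le k (6 * m + 1) t ltac:(by rewrite addn1).
  have s5 := @harmonic_step_le k (6 * m + 5) t ltac:(by lia).
  rewrite (_ : 6 * m + 1 + 6 = 6 * m.+1 + 1)%N in s1; last by lia.
  rewrite (_ : 6 * m + 5 + 6 = 6 * m.+1 + 5)%N in s5; last by lia.
  by rewrite !mul1r; lra.
apply: (@le_trans _ _ (\sum_(1 <= n < 6 * N.+1 + 1) chi0 n / n%:R * phi k (t - ln n%:R))).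
  rewrite [leRHS](@big_cat_nat _ _ _ N.+1) //=; last by lia.
  by rewrite lerDl sumr_ge0 // => n _; rewrite !mulr_ge0 ?chi0_ge0 ?invr_ge0 ?phi_ge0.
apply: le_trans (h N) _.
have := phi_ge0 k.+1 (t - ln (6 * N + 1)%:R); have := phi_ge0 k.+1 (t - ln (6 * N + 5)%:R).
lra.
Qed.

Lemma ln5_le2 : ln 5 <= 2 :> R.
Proof.
have e : 1 + 2^-1 <= expR 2^-1 :> R by apply: expR_ge1Dx.
rewrite -[leRHS]expRK ler_ln ?posrE ?expR_gt0 //.
(* Numerically, (3/2)^4 = 81/16 exceeds 5. *)
have -> : 2 = 4%:R * 2^-1 :> R by field.
rewrite expRM_natl; apply: le_trans (_ : (1 + 2^-1) ^+ 4 <= _); first by lra.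
by rewrite lerXn2r ?nnegrE ?expR_ge0 //; lra.
Qed.

(** The progression 5 mod 6 begins at ln 5 instead of 0. The loss is at most ln 5 * [phi k t] / 6,
    and ln 5 <= 2 turns it into [phi k t] / 3. *)
Lemma dsum_chi0_lower N k t : t < ln N.+1%:R -> (0 < k)%N ->
  phi k.+1 t / 3 - phi k t / 3 <= dsum chi0 N (phi k) t.
Proof.
move=> tN k0.
have h m : (phi k.+1 t - phi k.+1 (t - ln (6 * m + 1)%:R)) / 6 +
  (phi k.+1 (t - ln 5) - phi k.+1 (t - ln (6 * m + 5)%:R)) / 6 <=
  \sum_(1 <= n < 6 * m + 1) chi0 n / n%:R * phi k (t - ln n%:R).
  elim: m => [|m IH].
    by rewrite !muln0 !add0n ln1 subr0 !subrr !mul0r addr0 big_geq.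
  rewrite sum6; last exact: term0.
  have [[-> _ _ _] [-> _]] := chi0_mod6 m.
  have s1 := @harmonic_step_ge k (6 * m + 1) t ltac:(by rewrite addn1).
  have s5 := @harmonic_step_ge k (6 * m + 5) t ltac:(by lia).
  rewrite (_ : 6 * m + 1 + 6 = 6 * m.+1 + 1)%N in s1; last by lia.
  rewrite (_ : 6 * m + 5 + 6 = 6 * m.+1 + 5)%N in s5; last by lia.
  by rewrite !mul1r; lra.
have z n : (N < n)%N -> t - ln n%:R < 0.
  by move=> Nn; rewrite subr_lt0 (lt_le_trans tN) // ln_nat_le.
have -> : dsum chi0 N (phi k) t = \sum_(1 <= n < 6 * N.+1 + 1) chi0 n / n%:R * phi k (t - ln n%:R).
  rewrite [RHS](@big_cat_nat _ _ _ N.+1) //=; last by lia.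
  rewrite [X in _ + X]big_nat [X in _ + X]big1 ?addr0 // => n /andP [Nn _].
  by rewrite phi_neg ?mulr0 ?z.
apply: le_trans (h N.+1).
rewrite (phi_neg k.+1 (z _ (_ : (N < 6 * N.+1 + 1)%N))); last by lia.
rewrite (phi_neg k.+1 (z _ (_ : (N < 6 * N.+1 + 5)%N))); last by lia.
have l5 : 0 <= ln 5 :> R by rewrite ln_ge0 // ler1n.
have := phi_incr_le k t l5.
have : ln 5 * phi k t <= 2 * phi k t by rewrite ler_wpM2r ?phi_ge0 ?ln5_le2.
lra.
Qed.
End Harmonic6.

Section CharacterSums.
Variables (R : realType) (N : nat).
Local Notation chi0 := (@chi0 R).
Local Notation chi3 := (@chi3 R).
Local Notation chi8 := (@chi8 R).
Local Notation chi24 := (@chi24 R).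
Local Notation rsum := (@rsum R).
Local Notation rho := (@rho R).
Local Notation T := (ln N.+1%:R : R).
Implicit Types (t d : R).

Lemma trunc_mono_phi k : trunc_mono N (@phi R k).
Proof. by split=> [t|t t' tt _]; [apply: phi_neg | apply: phi_mono]. Qed.

Lemma trunc_mono_ext (f g : R -> R) : f =1 g -> trunc_mono N f -> trunc_mono N g.
Proof. by move=> e [h0 h1]; split=> [t t0|t t' tt tT]; rewrite -!e; [apply: h0 | apply: h1]. Qed.

Section Positive.
Variable c : nat -> R.
Hypothesis c0 : forall n, 0 <= c n.
Local Notation P k := (dsum c N (@phi R k)).

Lemma pos_mono k : trunc_mono N (P k).
Proof. exact: dsum_pos_mono c0 (trunc_mono_phi k). Qed.

Lemma pos_incr k t d : 0 <= d -> t < T -> P k.+1 t - P k.+1 (t - d) <= d * P k t.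
Proof.
move=> d0 tT; rewrite -dsum_shift -dsumB -dsumZ; apply: dsum_le => // u _.
exact: phi_incr_le.
Qed.

Lemma pos_diff_mono k d : (0 < k <= 2)%N -> 0 <= d -> trunc_mono N (fun t => P k t - P k (t - d)).
Proof.
move=> k12 d0; apply: (@trunc_mono_ext (dsum c N (fun t => phi k t - phi k (t - d)))).
  by move=> t; rewrite dsumB dsum_shift.
apply: dsum_pos_mono => //; split=> [t t0|t t' tt _].
  by rewrite !phi_neg ?subrr //; lra.
by case: k k12 => [//|[_|[_|//]]]; [apply: phi1_diff_mono | apply: phi2_diff_mono].
Qed.

Lemma pos_rem_mono d : 0 <= d -> trunc_mono N (fun t => d * P 1 t - (P 2 t - P 2 (t - d))).
Proof.
move=> d0; apply: (@trunc_mono_ext (dsum c N (fun t => d * phi 1 t - (phi 2 t - phi 2 (t - d))))).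
  by move=> t; rewrite dsumB dsumZ dsumB dsum_shift.
apply: dsum_pos_mono => //; split=> [t t0|t t' tt _].
  by rewrite !phi_neg ?subrr ?mulr0 ?subr0 //; lra.
exact: phi2_remainder_mono.
Qed.
End Positive.

Local Notation P k := (dsum chi0 N (@phi R k)).
Local Notation Psi k := (dsum rsum N (@phi R k)).
Local Notation Theta k := (dsum chi8 N (dsum rsum N (@phi R k))).

(** Termwise comparison fails because [chi8] has both signs. The increment over t' - t is instead
    the [chi8] sum of the increment of a positive sum; that function is nondecreasing by convexity,
    so [dsum_ge0] applies. [theta_incr] treats the first-order remainder in the same way. *)
Lemma theta_mono k : (0 < k <= 2)%N -> trunc_mono N (Theta k).
Proof.
move=> k12; split=> [t t0|t t' tt tT].
  by apply: dsum_trunc => // u u0; apply: dsum_trunc => // v; apply: phi_neg.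
have d0 : 0 <= t' - t by rewrite subr_ge0.
have := dsum_ge0 (@msum_chi8_ge0 R) (pos_diff_mono (@rsum_ge0 R) k12 d0) tT.
by rewrite dsumB (dsum_shift _ _ (dsum rsum N (phi k))) subKr subr_ge0.
Qed.

Lemma theta_incr t d : 0 <= d -> t < T -> Theta 2 t - Theta 2 (t - d) <= d * Theta 1 t.
Proof.
move=> d0 tT.
have := dsum_ge0 (@msum_chi8_ge0 R) (pos_rem_mono (@rsum_ge0 R) d0) tT.
by rewrite dsumB dsumZ dsumB (dsum_shift _ _ (dsum rsum N (phi 2))) subr_ge0.
Qed.

Lemma dsum_rsum_eq k t : t < T -> Psi k t = dsum chi3 N (P k) t.
Proof. by move=> tT; rewrite /rsum dsum_dconv // => u; apply: phi_neg. Qed.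

Lemma dsum_rho_eq k t : t < T -> dsum rho N (phi k) t = dsum chi24 N (Theta k) t.
Proof.
move=> tT; have n0 u : u < 0 -> phi k u = 0 :> R by apply: phi_neg.
have n1 u : u < 0 -> dsum rsum N (phi k) u = 0 by move=> u0; apply: dsum_trunc.
rewrite /rho dsum_dconv // -(@dsum_dconv R chi24 chi8) //.
by rewrite /dsum; apply: eq_bigr => n _; rewrite rsum8_dconv.
Qed.

Lemma psi_upper k t : t < T -> Psi k.+1 t <= 114 / 125 * P k.+1 t + 2 * 2 * P k t.
Proof.
move=> tT; rewrite dsum_rsum_eq //; apply: dsum_upper => //.
- exact: msum_chi3_upper.
- exact: pos_mono (@chi0_ge0 R) _.
- exact: pos_mono (@chi0_ge0 R) _.
- by move=> u d d0 uT; apply: pos_incr => //; apply: chi0_ge0.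
Qed.

Lemma psi_lower k t : t < T -> 439 / 500 * P k.+1 t - 2 * 2 * P k t <= Psi k.+1 t.
Proof.
move=> tT; rewrite dsum_rsum_eq //; apply: dsum_lower => //.
- exact: msum_chi3_lower.
- exact: pos_mono (@chi0_ge0 R) _.
- exact: pos_mono (@chi0_ge0 R) _.
- by move=> u d d0 uT; apply: pos_incr => //; apply: chi0_ge0.
Qed.

(** In degree 0 there is no lower degree to carry the error, so the crude bound 114/125 + 2 <= 3 on
    the partial sums is used. *)
Lemma psi0_upper t : t < T -> Psi 0 t <= 3 * P 0 t.
Proof.
move=> tT; rewrite dsum_rsum_eq // (dsum_abel _ (pos_mono (@chi0_ge0 R) 0)) //.
rewrite -[in leRHS](sum_steps (pos_mono (@chi0_ge0 R) 0) tT) mulr_sumr big_nat [leRHS]big_nat.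
apply: ler_sum => n /andP [n0 _]; apply: ler_wpM2r.
  exact: trunc_mono_step (pos_mono (@chi0_ge0 R) 0) tT n0.
apply: le_trans (msum_chi3_upper R n0) _.
have : 2 / n%:R <= 2 :> R by rewrite ler_pdivrMr ?ltr0n // ler_peMr // ler1n.
lra.
Qed.

Lemma theta_upper k t : (k < 2)%N -> t < T -> Theta k.+1 t <= 149 / 200 * Psi k.+1 t + 2 * 2 * Psi k t.
Proof.
move=> k2 tT; apply: dsum_upper => //.
- exact: msum_chi8_upper.
- exact: pos_mono (@rsum_ge0 R) _.
- exact: pos_mono (@rsum_ge0 R) _.
- by move=> u d d0 uT; apply: pos_incr => //; apply: rsum_ge0.
Qed.

Lemma rho_upper t : t < T -> dsum rho N (phi 2) t <= 119 / 125 * Theta 2 t + 2 * 4 * Theta 1 t.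
Proof.
move=> tT; rewrite dsum_rho_eq //; apply: dsum_upper => //.
- exact: msum_chi24_upper.
- exact: theta_mono.
- exact: theta_mono.
- by move=> u d d0 uT; apply: theta_incr.
Qed.
End CharacterSums.

Section MainMassBound.
Variable R : realType.
Local Notation chi0 := (@chi0 R).
Local Notation rsum := (@rsum R).
Local Notation rho := (@rho R).
Local Notation dpi := (@dpi R).

(** The leading coefficient is (119/125)(149/200)(114/125)/18, about 0.0359; for t >= 608 the lower
    powers of t fit into the gap to 1/25. *)
Lemma rho_sum_bound N (t : R) : 608%:R <= t -> t < ln N.+1%:R ->
  dsum rho N (phi 2) t <= t ^+ 3 / 25.
Proof.
move=> t608 tT; have t0 : 0 <= t by apply: le_trans t608.
have p3 : phi 3 t = t ^+ 3 / 6 by rewrite phi_pos.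
have a2 := dsum_chi0_upper N 2 t; have a1 := dsum_chi0_upper N 1 t; have a0 := dsum_chi0_upper N 0 t.
rewrite (phi2E t0) p3 in a2; rewrite (phi1E t0) (phi2E t0) in a1; rewrite (phi0E t0) (phi1E t0) in a0.
have b2 := psi_upper 1 tT; have b1 := psi_upper 0 tT; have b0 := psi0_upper tT.
have c2 := @theta_upper R N 1 t isT tT; have c1 := @theta_upper R N 0 t isT tT.
apply: le_trans (rho_upper tT) _.
have h2 : 608%:R * t <= t ^+ 2 by rewrite expr2 ler_wpM2r.
have h3 : 608%:R * t ^+ 2 <= t ^+ 3 by rewrite [t ^+ 3]exprS ler_wpM2r ?exprn_ge0.
move: (t ^+ 3) (t ^+ 2) h2 h3 a0 a1 a2 => u3 u2 h2 h3 a0 a1 a2.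
move: (dsum chi0 N (phi 0) t) (dsum chi0 N (phi 1) t) (dsum chi0 N (phi 2) t) a0 a1 a2 b0 b1 b2
  => P0 P1 P2 a0 a1 a2.
move: (dsum rsum N (phi 0) t) (dsum rsum N (phi 1) t) (dsum rsum N (phi 2) t) c1 c2
  => Q0 Q1 Q2 + + b0 b1 b2.
move: (dsum _ N _ t) (dsum _ N _ t) => S2 S1 c1 c2.
clear tT p3; lra.
Qed.

(** The leading coefficient is (439/500)/6, about 0.1463; for t >= 304 the linear error fits into
    the gap to 7/50. *)
Lemma rsum_sum_bound N (t : R) : 304%:R <= t -> t < ln N.+1%:R ->
  7 / 50 * t ^+ 2 <= dsum rsum N (phi 1) t.
Proof.
move=> t304 tT; have t0 : 0 <= t by apply: le_trans t304.
apply: le_trans (psi_lower 0 tT).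
have a1 := @dsum_chi0_lower R N 1 t tT isT; have a0 := dsum_chi0_upper N 0 t.
rewrite (phi1E t0) (phi2E t0) in a1; rewrite (phi0E t0) (phi1E t0) in a0.
have h2 : 304%:R * t <= t ^+ 2 by rewrite expr2 ler_wpM2r.
move: (t ^+ 2) h2 a1 => u2 h2 a1.
move: (dsum chi0 N (phi 0) t) (dsum chi0 N (phi 1) t) a0 a1 => P0 P1 a0 a1.
clear tT; lra.
Qed.

(** With I and J the sums over the two kinds of split primes, J^2 <= (2 s)^3 / 50 = (4/25) s^3 and I
    J >= (8/9)(7/50) s^3 >= (31/250) s^3. Dividing the square of the second by the first gives
    (31/250)^2 / (4/25) >= 12/125. *)
Lemma piQ_sum_bound (Q : nat) (s := ln Q%:R : R) : 304%:R <= s ->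
  12 / 125 * s ^+ 3 <= dsum (dpi piQ) Q (phi 1) s ^+ 2.
Proof.
move=> s304; have s0 : 0 < s by apply: lt_le_trans s304.
have Q1 : (1 < Q)%N.
  by rewrite ltnNge; apply/negP => q1; move: s0; rewrite ltNge ln_le0 // lern1.
have Q0 := ltnW Q1.
have sT : s < ln Q.+1%:R by rewrite ltr_ln ?posrE ?ltr0n ?ltr_nat.
have eN : 2 * s = ln (Q ^ 2)%:R by rewrite natrX lnXn ?ltr0n // mulr_natl.
have tT : 2 * s < ln (Q ^ 2).+1%:R by rewrite eN ltr_ln ?posrE ?ltr0n ?ltr_nat ?expn_gt0 ?Q0.
have hR := rsum_sum_bound s304 sT.
have hY : dsum rho (Q ^ 2) (phi 2) (2 * s) <= (2 * s) ^+ 3 / 25.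
  by apply: rho_sum_bound tT; rewrite (_ : 608 = 2 * 304)%N // natrM ler_pM2l.
have hS := rsum_split_bound R Q1; rewrite -/s in hS.
have hJ := dsum_piS_sqr R Q0; rewrite -/s in hJ.
have I0 : 0 <= dsum (dpi piQ) Q (phi 1) s.
  by apply: sumr_ge0 => n _; rewrite !mulr_ge0 ?dpi_ge0 ?invr_ge0 ?phi_ge0.
have J0 : 0 <= dsum (dpi piS) Q (phi 1) s.
  by apply: sumr_ge0 => n _; rewrite !mulr_ge0 ?dpi_ge0 ?invr_ge0 ?phi_ge0.
move: (dsum (dpi piQ) Q (phi 1) s) (dsum (dpi piS) Q (phi 1) s) I0 J0 hS hJ => I J I0 J0 hS hJ.
have J2 : J ^+ 2 <= 4 / 25 * s ^+ 3.
  apply: le_trans hJ _; rewrite ler_pdivrMr //; apply: le_trans hY _.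
  by rewrite exprMn; lra.
have s3 : 0 < s ^+ 3 by rewrite exprn_gt0.
have IJ : 31 / 250 * s ^+ 3 <= I * J.
  have := le_trans hR hS; rewrite [leRHS]mulrAC ler_pdivlMr // => h.
  by move: s3; rewrite exprSr => s3; lra.
have IJ2 : (31 / 250 * s ^+ 3) ^+ 2 <= (I * J) ^+ 2.
  have p : 0 <= 31 / 250 * s ^+ 3 by clear - s3; lra.
  by rewrite lerXn2r ?nnegrE // mulr_ge0.
rewrite [(I * J) ^+ 2]exprMn in IJ2.
have h : (31 / 250 * s ^+ 3) ^+ 2 <= I ^+ 2 * (4 / 25 * s ^+ 3).
  by apply: le_trans IJ2 _; rewrite ler_wpM2l ?sqr_ge0.
move: h; move: (s ^+ 3) (I ^+ 2) s3 => u v u0.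
have ew : 250 * (31 / 250 * u) = 31 * u by field.
rewrite expr2; move: (31 / 250 * u) ew => w ew.
have -> : v * (4 / 25 * u) = 4 / 25 * v * u by ring.
move=> h; have h1 : 31 * w <= 40 * v.
  have w0 : 31 / 250 * u = w by lra.
  rewrite -(ler_pM2r u0); move: h; rewrite -{1}w0; lra.
lra.
Qed.
End MainMassBound.

(** * Sieve mass over the odd primes *)

Section OddPrimes.
Variable Q : nat.

Definition odd_prime_le := {i : 'I_Q.+1 | prime i && odd i}.
Local Notation I := odd_prime_le.

Definition opval (i : I) : nat := val (val i).
(* The number of residue classes mod q that are free of prime factors p > q of N: 0, and the two roots of
   x^2 + x + 1 when q is in [piQ]. *)
Definition opweight (i : I) : nat := if opval i \in piQ then 3 else 1.

Lemma opval_prime i : prime (opval i). Proof. by have /andP [] := valP i. Qed.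
Lemma opval_odd i : odd (opval i). Proof. by have /andP [] := valP i. Qed.
Lemma opval_le i : (opval i <= Q)%N. Proof. by rewrite -ltnS ltn_ord. Qed.
Lemma opval_ex p : prime p -> odd p -> (p <= Q)%N -> exists i, opval i = p.
Proof.
move=> pp op; rewrite -ltnS => pQ.
have h : prime (Ordinal pQ) && odd (Ordinal pQ) by rewrite /= pp.
by exists (exist _ (Ordinal pQ) h).
Qed.

Lemma opweight_gt0 i : (0 < opweight i)%N. Proof. by rewrite /opweight; case: ifP. Qed.

Lemma opweight_lt i : (opweight i < opval i)%N.
Proof.
rewrite /opweight; case: ifP => h; last exact: prime_gt1 (opval_prime i).
rewrite ltnNge; apply/negP => l3; move: h.
by case: (opval i) l3 => [|[|[|[|]]]].
Qed.

Lemma opval_coprime i j : i != j -> coprime (opval i) (opval j).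
Proof.
move=> ij; rewrite prime_coprime ?opval_prime // dvdn_prime2 ?opval_prime //.
Qed.

Variable R : realType.
Local Notation dpi := (@dpi R).

Lemma size_divisors_mult : @multiplicative_on_coprime R (fun n => (size (divisors n))%:R).
Proof.
move=> m n m0 n0 c; rewrite -!sum1_size -natrM; congr _%:R.
rewrite (@big_divisors_coprime _ _ addn) // big_distrl /=; apply: eq_bigr => d _.
by rewrite big_distrr.
Qed.

Lemma dpi_mult pi : multiplicative_on_coprime (dpi pi).
Proof.
move=> m n m0 n0 c; rewrite /dpi pnatM size_divisors_mult //.
by case: (pi.-nat m) => /=; case: (pi.-nat n); rewrite ?mulr0 ?mul0r.
Qed.

Lemma dpi1 pi : dpi pi 1 = 1. Proof. by []. Qed.

(** At a prime of [piQ] the divisor function gives 2, and convolution with 1 adds 1; so at the odd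
    primes [dpi_sum] has the value [opweight]. *)
Definition dpi_sum (n : nat) : R := dconv (dpi piQ) (fun=> 1) n.

Lemma dpi_sum_mult : multiplicative_on_coprime dpi_sum.
Proof. by apply: dconv_mult; [apply: dpi_mult | move=> *; rewrite mulr1]. Qed.

Definition exp_weight (n : nat) : nat := (\prod_(i : I) opweight i ^ logn (opval i) n)%N.
Definition exp_value (n : nat) : nat := (\prod_(i : I) opval i ^ logn (opval i) n)%N.

Lemma exp_prodM (F : I -> nat) m n : (0 < m)%N -> (0 < n)%N ->
  (\prod_(i : I) F i ^ logn (opval i) (m * n) =
   (\prod_(i : I) F i ^ logn (opval i) m) * \prod_(i : I) F i ^ logn (opval i) n)%N.
Proof.
by move=> m0 n0; rewrite -big_split /=; apply: eq_bigr => i _; rewrite lognM // expnD.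
Qed.

Lemma exp_prod_pfactor (F : I -> nat) i k :
  (\prod_(j : I) F j ^ logn (opval j) (opval i ^ k) = F i ^ k)%N.
Proof.
rewrite (bigD1 i) //= pfactorK ?opval_prime // big1 ?muln1 // => j ji.
rewrite lognX logn_coprime ?muln0 // opval_coprime //.
Qed.

Lemma dpi_sum_pfactor p k : prime p -> dpi_sum (p ^ k) <= (if p \in piQ then 3 ^ k else 1)%N%:R.
Proof.
move=> pp; rewrite /dpi_sum dconv_pfactor //.
under eq_bigr => j _ do rewrite mulr1.
case: ifP => pQ; last first.
  rewrite big_ord_recl big1 ?addr0 /=.
    by rewrite expn0 dpi1.
  by move=> j _; rewrite /dpi /bump /= add1n pnatX pnatE // pQ.
elim: k => [|k IH]; first by rewrite big_ord1 expn0 dpi1.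
rewrite big_ord_recr /=; apply: le_trans (lerD IH (lexx _)) _.
rewrite /dpi pnatX pnatE // pQ /= (perm_size (perm_divisors_pfactor k.+1 pp)) size_map size_iota.
rewrite -natrD ler_nat expnS; have : (k < 3 ^ k)%N by apply: ltn_expl.
lia.
Qed.

Lemma dpi_sum_le n : (0 < n)%N -> (forall p, prime p -> (p %| n)%N -> odd p && (p <= Q)%N) ->
  dpi_sum n <= (exp_weight n)%:R /\ exp_value n = n.
Proof.
elim/coprime_ind: n /.
- move=> _; rewrite /dpi_sum dconv1 /exp_value /exp_weight !big1; try by move=> i _; rewrite logn1.
  by rewrite mulr1 dpi1.
- move=> p k pp k0 /(_ p pp); rewrite dvdn_exp // => /(_ isT) /andP [op pQ].
  have [i ei] := opval_ex pp op pQ.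
  rewrite /exp_weight /exp_value -ei !exp_prod_pfactor; split=> //.
  apply: le_trans (dpi_sum_pfactor _ (opval_prime i)) _; rewrite ler_nat /opweight.
  by case: ifP => //; rewrite exp1n.
- move=> m n m0 n0 c hm hn h.
  have [hm1 hm2] := hm (fun q pq qm => h q pq (dvdn_mulr _ qm)).
  have [hn1 hn2] := hn (fun q pq qm => h q pq (dvdn_mull _ qm)).
  split; last by rewrite /exp_value exp_prodM // -/(exp_value m) -/(exp_value n) hm2 hn2.
  rewrite dpi_sum_mult // /exp_weight exp_prodM // natrM ler_pM //.
    by apply: sumr_ge0 => d _; rewrite mulr1 dpi_ge0.
  by apply: sumr_ge0 => d _; rewrite mulr1 dpi_ge0.
Qed.
End OddPrimes.

Section MassLowerBound.
Variables (R : realType) (Q : nat).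
Hypothesis Q0 : (0 < Q)%N.
Local Notation I := (odd_prime_le Q).
Local Notation q := (@opval Q).
Local Notation w := (@opweight Q).
Local Notation dpi := (@dpi R).
Local Notation s := (ln Q%:R : R).

Definition oddR (n : nat) : R := (odd n)%:R.

Lemma dconv_dpi_odd n : (0 < n)%N -> dconv (dpi piQ) oddR n <= (if odd n then dpi_sum R n else 0).
Proof.
move=> n0; case: ifP => on.
  rewrite /dpi_sum /dconv; apply: ler_sum => d _; rewrite ler_wpM2l ?dpi_ge0 // /oddR.
  by case: odd.
rewrite /dconv big_seq big1 // => d; rewrite -dvdn_divisors // => dn.
rewrite /oddR; case o2 : (odd (n %/ d)); last by rewrite mulr0.
rewrite /dpi; case: ifP => dQ; last by rewrite mul0r.
suff od : odd d by move: on; rewrite -(divnK dn) oddM o2 od.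
have d0 := dvdn_gt0 n0 dn.
apply: contraT => ed; have d2 : (2 %| d)%N by rewrite dvdn2.
by have := pnatP _ d0 dQ 2 isT d2.
Qed.

Lemma dsum_odd_lower N (t : R) : t < ln N.+1%:R -> phi 1 t / 2 <= dsum oddR N (phi 0) t.
Proof.
move=> tN.
have step n : (0 < n)%N -> (phi 1 (t - ln n%:R) - phi 1 (t - ln (n + 2)%:R)) / 2 <= n%:R^-1 * phi 0 (t - ln n%:R).
  move=> n0; have p : 0 < n%:R :> R by rewrite ltr0n.
  have d0 : 0 <= ln (n + 2)%:R - ln n%:R :> R by rewrite subr_ge0 ln_nat_le // leq_addr.
  have hd : ln (n + 2)%:R - ln n%:R <= 2 / n%:R :> R.
    rewrite -ln_div ?posrE ?ltr0n ?addn_gt0 ?n0 //.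
    have -> : (n + 2)%:R / n%:R = 1 + 2 / n%:R :> R by rewrite natrD; field; rewrite gt_eqF.
    by apply: le_ln1Dx; have : 0 <= 2 / n%:R :> R; [rewrite divr_ge0 | lra].
  have := phi_incr_le 0 (t - ln n%:R) d0.
  rewrite (_ : t - ln n%:R - (ln (n + 2)%:R - ln n%:R) = t - ln (n + 2)%:R); last by ring.
  move=> h2; rewrite ler_pdivrMr //; apply: le_trans h2 _.
  by rewrite mulrAC (mulrC _ 2) ler_wpM2r ?phi_ge0.
have h m : (phi 1 t - phi 1 (t - ln (2 * m + 1)%:R)) / 2 <=
  \sum_(1 <= n < 2 * m + 1) oddR n / n%:R * phi 0 (t - ln n%:R).
  elim: m => [|m IH]; first by rewrite muln0 add0n ln1 subr0 subrr mul0r big_geq.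
  have e : (2 * m.+1 + 1 = (2 * m + 1).+2)%N by lia.
  rewrite [X in \sum_(_ <= _ < X) _]e big_nat_recr /=; last by rewrite addn1.
  rewrite big_nat_recr /=; last by rewrite addn1.
  rewrite /oddR oddS oddD oddM /= mul0r mul0r addr0 mul1r -/oddR.
  have := step (2 * m + 1)%N ltac:(by rewrite addn1).
  rewrite (_ : 2 * m + 1 + 2 = 2 * m.+1 + 1)%N; last by lia.
  by move: IH; rewrite /oddR; lra.
have z n : (N < n)%N -> t - ln n%:R < 0.
  by move=> Nn; rewrite subr_lt0 (lt_le_trans tN) // ln_nat_le.
have -> : dsum oddR N (phi 0) t = \sum_(1 <= n < 2 * N.+1 + 1) oddR n / n%:R * phi 0 (t - ln n%:R).
  rewrite [RHS](@big_cat_nat _ _ _ N.+1) //=; last by lia.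
  rewrite [X in _ + X]big_nat [X in _ + X]big1 ?addr0 // => n /andP [Nn _].
  by rewrite phi_neg ?mulr0 ?z.
apply: le_trans (h N.+1).
by rewrite (phi_neg 1 (z _ (_ : (N < 2 * N.+1 + 1)%N))) ?subr0 //; lia.
Qed.

(** The odd cofactor supplies a logarithm: summing 1/n over odd n raises [phi 0] to [phi 1] with
    density 1/2. The result concerns the sharp cutoff that occurs in the sieve mass. *)
Lemma dsum_dconv_odd_lower :
  dsum (dpi piQ) Q (phi 1) s / 2 <= dsum (dconv (dpi piQ) oddR) Q (phi 0) s.
Proof.
have sT : s < ln Q.+1%:R by rewrite ltr_ln ?posrE ?ltr0n ?ltr_nat.
rewrite dsum_dconv //; last by move=> t; apply: phi_neg.
have -> : dsum (dpi piQ) Q (phi 1) s / 2 = dsum (dpi piQ) Q (fun t => 2^-1 * phi 1 t) s.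
  by rewrite dsumZ mulrC.
apply: dsum_le => [n|t tT|//]; first exact: dpi_ge0.
by rewrite mulrC dsum_odd_lower.
Qed.

Let x (i : I) : R := (w i)%:R / (q i)%:R.

(** Every exponent of n <= Q is below Q, so [inord] loses nothing and exponent vectors form a finite
    type. *)
Definition exponents (n : nat) : {ffun I -> 'I_Q.+1} := [ffun i => inord (logn (q i) n)].

Definition exp_term (e : {ffun I -> 'I_Q.+1}) : R := \prod_(i : I) x i ^+ e i.

Lemma exp_term_ge0 e : 0 <= exp_term e.
Proof. by apply: prodr_ge0 => i _; rewrite exprn_ge0 // divr_ge0. Qed.

Lemma exponentsE n i : (0 < n <= Q)%N -> exponents n i = logn (q i) n :> nat.
Proof.
move=> /andP [n0 nQ]; rewrite ffunE inordK // ltnS; apply: leq_trans nQ.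
by apply: ltnW; apply: ltn_logl.
Qed.

Lemma odd_factors n : (0 < n <= Q)%N -> odd n -> forall p, prime p -> (p %| n)%N -> odd p && (p <= Q)%N.
Proof.
move=> /andP [n0 nQ] on p pp pn; rewrite (dvdn_odd pn on) /=.
exact: leq_trans (dvdn_leq n0 pn) nQ.
Qed.

Definition exp_support (e : {ffun I -> 'I_Q.+1}) : {set I} := [set i | 0 < val (e i)]%N.

(** Each n goes to its exponent vector, an injective map, and the term is at most the product of
    (w/q)^e. The support of the vector is a level set because the product of its primes is at most n
    <= Q. *)
Lemma odd_sum_le_mass :
  \sum_(n <- [seq n <- index_iota 1 Q.+1 | odd n]) dpi_sum R n / n%:R <= sieve_mass R q w Q.
Proof.
apply: (@le_trans _ _ (\sum_(n <- [seq n <- index_iota 1 Q.+1 | odd n]) exp_term (exponents n))).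
  rewrite big_seq [leRHS]big_seq; apply: ler_sum => n; rewrite mem_filter mem_index_iota ltnS => /andP [on nQ].
  have n0 : (0 < n)%N by case/andP: nQ.
  have [h1 h2] := dpi_sum_le R n0 (odd_factors nQ on).
  have -> : exp_term (exponents n) = (exp_weight Q n)%:R / n%:R.
    rewrite -{3}h2 /exp_term /exp_weight /exp_value !natr_prod -prodf_div; apply: eq_bigr => i _.
    by rewrite exponentsE // /x expr_div_n !natrX.
  by rewrite ler_wpM2r ?invr_ge0.
apply: (@le_trans _ _ (\sum_(e <- [seq e <- index_enum {ffun I -> 'I_Q.+1} | sieve_level q Q (exp_support e)]) exp_term e)).
  apply: ler_sum_inj.
  - by rewrite filter_uniq ?iota_uniq.
  - by rewrite filter_uniq ?index_enum_uniq.
  - move=> n m; rewrite !mem_filter !mem_index_iota !ltnS => /andP [on nQ] /andP [om mQ] e.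
    have n0 : (0 < n)%N by case/andP: nQ.
    have m0 : (0 < m)%N by case/andP: mQ.
    have [_ <-] := dpi_sum_le R n0 (odd_factors nQ on).
    have [_ <-] := dpi_sum_le R m0 (odd_factors mQ om).
    by apply: eq_bigr => i _; rewrite -!exponentsE // e.
  - move=> n; rewrite mem_filter mem_index_iota ltnS => /andP [on nQ].
    rewrite mem_filter mem_index_enum andbT /sieve_level.
    have n0 : (0 < n)%N by case/andP: nQ.
    have [_ en] := dpi_sum_le R n0 (odd_factors nQ on).
    apply: leq_trans (_ : n <= Q)%N; last by case/andP: nQ.
    rewrite -{2}en /exp_value [X in (_ <= X)%N](bigID (mem (exp_support (exponents n)))) /=.
    apply: leq_trans _ (leq_pmulr _ _); last first.
      by apply: prodn_cond_gt0 => i _; rewrite expn_gt0 (prime_gt0 (opval_prime i)).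
    apply: leq_prod => i; rewrite inE /= exponentsE // => l0.
    by rewrite -{1}(expn1 (q i)) leq_pexp2l // prime_gt0 // opval_prime.
  - exact: exp_term_ge0.
(* The vectors with support [D] factor into truncated geometric series from exponent 1 on, each
   bounded by x/(1 - x) = w/(q - w). *)
rewrite big_filter (partition_big exp_support (sieve_level q Q)) //= /sieve_mass.
apply: ler_sum => D lD.
pose F (i : I) (j : 'I_Q.+1) := ((0 < j)%N == (i \in D)).
have -> : \sum_(e | sieve_level q Q (exp_support e) && (exp_support e == D)) exp_term e =
    \sum_(e in family (fun i => (F i : pred _))) exp_term e.
  apply: eq_bigl => e; apply/andP/familyP => [[_ /eqP eD] i|h].
    by rewrite unfold_in /F -eD inE.
  have eD : exp_support e = D by apply/setP => i; rewrite inE; have := h i; rewrite unfold_in => /eqP.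
  by rewrite eD lD.
rewrite /exp_term -(@bigA_distr_big_dep _ _ _ _ _ _ _ (fun i => (F i : pred _)) (fun i (j : 'I_Q.+1) => x i ^+ j)).
rewrite /sieve_weight [leRHS]big_mkcond /=; apply: ler_prod => i _.
have q0 : 0 < (q i)%:R :> R by rewrite ltr0n (prime_gt0 (opval_prime i)).
have wq : (w i)%:R < (q i)%:R :> R by rewrite ltr_nat opweight_lt.
have x0 : 0 <= x i by rewrite /x divr_ge0.
rewrite sumr_ge0 /=; last by move=> j _; rewrite exprn_ge0.
case: ifP => iD; last first.
  rewrite (big_pred1 ord0) ?expr0 // => j; rewrite /F iD.
  by rewrite eqbF_neg -eqn0Ngt.
have -> : (w i)%:R / ((q i)%:R - (w i)%:R) = x i / (1 - x i).
  by rewrite /x; field; apply/andP; split; apply/eqP; lra.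
have x1 : x i < 1 by rewrite /x ltr_pdivrMr // mul1r.
rewrite ler_pdivlMr ?subr_gt0 //.
have -> : \sum_(j | F i j) x i ^+ j = \sum_(j < Q) x i ^+ j.+1.
  rewrite big_mkcond big_ord_recl /F iD /= add0r; apply: eq_bigr => j _.
  by rewrite /bump /=.
have : forall m, (\sum_(j < m) x i ^+ j.+1) * (1 - x i) = x i - x i ^+ m.+1.
  elim=> [|m IH]; first by rewrite big_ord0 mul0r expr1 subrr.
  by rewrite big_ord_recr /= mulrDl IH (exprS _ m.+1); ring.
by move=> ->; rewrite lerBlDr lerDl exprn_ge0.
Qed.

Lemma sieve_mass_lower : dsum (dpi piQ) Q (phi 1) s / 2 <= sieve_mass R q w Q.
Proof.
apply: le_trans dsum_dconv_odd_lower _; apply: le_trans odd_sum_le_mass.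
rewrite big_filter [leRHS]big_mkcond /dsum [leLHS]big_nat [leRHS]big_nat; apply: ler_sum => n /andP [n0 nQ].
rewrite phi0E ?mulr1; last by rewrite subr_ge0 ln_nat_le.
have := dconv_dpi_odd n0; case: ifP => on h.
  by rewrite ler_wpM2r ?invr_ge0.
by rewrite -[leRHS](mul0r n%:R^-1) ler_wpM2r ?invr_ge0.
Qed.
End MassLowerBound.

(** Since 3 divides q - 1, Cauchy's theorem gives a unit of order 3, which is a root of (x^3 - 1)/(x
    - 1). *)
Lemma Fp_cube_root (q : nat) : prime q -> (q %% 3 = 1)%N -> exists a : 'F_q, a ^+ 2 + a + 1 = 0.
Proof.
move=> pq q3.
have d3 : (3 %| #|[set: {unit 'F_q}]|)%N.
  rewrite card_finField_unit card_Fp // -subn1 -eqn_mod_dvd ?prime_gt0 //; by rewrite q3.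
have [x _ ox] := Cauchy (G := [group of [set: {unit 'F_q}]]) (isT : prime 3) d3.
have x3 : val x ^+ 3 = 1.
  by rewrite -FinRing.val_unitX -ox expg_order.
have x1 : val x != 1.
  apply/eqP => e; have : x = 1%g by apply: val_inj.
  by move=> xe; move: ox; rewrite xe order1.
exists (val x); apply: (mulfI (x := val x - 1)); first by rewrite subr_eq0.
rewrite mulr0; have -> : (val x - 1) * (val x ^+ 2 + val x + 1) = val x ^+ 3 - 1 by ring.
by rewrite x3 subrr.
Qed.

(** * Sieving the prime factors of N *)

Section RootCount.
Variables (q : nat) (c : nat).
Hypotheses (pq : prime q) (oq : odd q).

Let dvdF n : (q %| n)%N = (n%:R == 0 :> 'F_q).
Proof. exact: dvdn_pcharf (pchar_Fp pq) n. Qed.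

Definition hits (a : 'F_q) (j : nat) : nat := (8 * j + c)%:R == a.

(** As 8 is invertible modulo the odd prime [q], a progression of difference 8 meets every class
    exactly once per period. *)
Lemma count_Fp (a : 'F_q) : (\sum_(j < q) hits a j = 1)%N.
Proof.
rewrite /hits.
have u8 : (8%:R : 'F_q) != 0.
  rewrite -dvdF; apply/negP => q8.
  have : (q %| 2 ^ 3)%N by [].
  by rewrite Euclid_dvdX // => /andP [q2 _]; move: oq; rewrite (eqP (_ : q == 2)%N) // -dvdn_prime2.
pose b := (a - c%:R) / 8%:R : 'F_q.
have bq : (b < q)%N by rewrite -[X in (_ < X)%N](Fp_cast pq) ltn_ord.
rewrite (bigD1 (Ordinal bq)) //= natrD natrM (natr_Zp b).
have -> : 8%:R * b + c%:R == a by apply/eqP; rewrite /b; field.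
rewrite big1 ?addn0 // => j jb; apply/eqP; rewrite eqb0; apply: contra jb => /eqP e.
have eb : (j%:R : 'F_q) = b by rewrite /b -e natrD natrM; field.
apply/eqP/val_inj => /=; have := congr1 val eb.
by rewrite /= val_Fp_nat // modn_small.
Qed.

Definition excluded (n : nat) : bool :=
  (q %| n)%N || ((q \in piQ) && (q %| n ^ 2 + n + 1)%N).

Lemma excluded_mod j : excluded (8 * (j %% q)%N + c) = excluded (8 * j + c).
Proof.
have e : ((8 * (j %% q)%N + c)%:R = (8 * j + c)%:R :> 'F_q).
  by rewrite (natrD _ (8 * (j %% q))%N c) (natrD _ (8 * j)%N c) !natrM Fp_nat_mod.
have E n : (n ^ 2 + n + 1)%:R = (n%:R : 'F_q) ^+ 2 + n%:R + 1.
  by rewrite (natrD _ _ 1%N) (natrD _ (n ^ 2)%N n) natrX.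
by rewrite /excluded !dvdF !E e.
Qed.

Lemma count_excluded : (\sum_(j < q) excluded (8 * j + c) = if q \in piQ then 3 else 1)%N.
Proof.
case qQ : (q \in piQ); last first.
  transitivity (\sum_(j < q) hits 0%R j)%N; last exact: count_Fp.
  by apply: eq_bigr => j _; rewrite /hits /excluded qQ orbF dvdF.
have q3 : (q %% 3 = 1)%N.
  have : q \in piQ by rewrite qQ.
  by rewrite inE /= !inE -(@modn_dvdm 24 q 3) // => /orP [] /eqP ->.
have [a ea] := Fp_cube_root pq q3.
have n1 : a != 0 by apply/eqP => a0; move/eqP: ea; rewrite a0 expr0n !add0r oner_eq0.
have n2 : - (a + 1) != 0.
  rewrite oppr_eq0; apply/eqP => a0; move/eqP: ea.
  rewrite (_ : a ^+ 2 + a = a * (a + 1)); last by ring.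
  by rewrite a0 mulr0 add0r oner_eq0.
(* A double root is impossible: 4 (a^2 + a + 1) - (2 a + 1)^2 = 3 would vanish mod q, and q is 1 mod
   3. *)
have n3 : a != - (a + 1).
  apply/eqP => e; have : (3%:R : 'F_q) = 0.
    have -> : 3%:R = 4%:R * (a ^+ 2 + a + 1) - (a - - (a + 1)) ^+ 2 :> 'F_q by ring.
    by rewrite ea -e subrr mulr0 expr0n subrr.
  move/eqP; rewrite -dvdF dvdn_prime2 // => /eqP e3.
  by move: q3; rewrite e3.
transitivity (\sum_(j < q) (hits 0%R j + hits a j + hits (- (a + 1))%R j))%N; last by rewrite !big_split /= !count_Fp.
apply: eq_bigr => j _; rewrite /hits /excluded qQ /= !dvdF.
move: (8 * j + c)%N => n; rewrite (natrD _ _ 1%N) (natrD _ (n ^ 2)%N n) natrX.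
move: (n%:R : 'F_q) => x.
have -> : (x ^+ 2 + x + 1 == 0) = ((x == a) || (x == - (a + 1))).
  rewrite -(subr_eq0 x a) -(subr_eq0 x (- _)) -mulf_eq0; congr (_ == 0).
  have -> : (x - a) * (x - - (a + 1)) = x ^+ 2 + x + 1 - (a ^+ 2 + a + 1) by ring.
  by rewrite ea subr0.
have [->|x0] := eqVneq x 0; first by rewrite (eq_sym 0 a) (eq_sym 0 (- _)) (negbTE n1) (negbTE n2).
have [->|xa] := eqVneq x a; first by rewrite (negbTE n3).
by case: (x == _).
Qed.
End RootCount.

(** * The error term of the sieve *)

Section SieveError.
Variables (R : realType) (Q : nat).
Hypothesis Q0 : (0 < Q)%N.
Local Notation I := (odd_prime_le Q).
Local Notation q := (@opval Q).
Local Notation w := (@opweight Q).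

Definition level_sum (a : I -> R) : R := \sum_(D : {set I} | sieve_level q Q D) \prod_(i in D) a i.

(* Expanding the product splits a level set D as F and D \ F, both of which are level sets. *)
Lemma level_sumD (a b : I -> R) : (forall i, 0 <= a i) -> (forall i, 0 <= b i) ->
  level_sum (fun i => a i + b i) <= level_sum a * level_sum b.
Proof.
move=> a0 b0; rewrite /level_sum; under eq_bigr => D _ do rewrite prodrD_subset.
have sub (F D : {set I}) : F \subset D -> sieve_level q Q D -> sieve_level q Q F.
  by apply: (sieve_level_sub (w := w)); apply: opweight_lt.
rewrite (exchange_big_dep (sieve_level q Q)) /=; last by move=> D F lD /sub; apply.
rewrite mulr_suml; apply: ler_sum => F lF; rewrite -mulr_sumr ler_wpM2l ?prodr_ge0 //.
rewrite -[leLHS]big_filter -[leRHS]big_filter.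
apply: (@ler_sum_inj R {set I} {set I} _ _ (fun D : {set I} => D :\: F) (fun E => \prod_(i in E) b i)).
- by rewrite filter_uniq ?index_enum_uniq.
- by rewrite filter_uniq ?index_enum_uniq.
- move=> D E; rewrite !mem_filter => /andP [/andP [_ FD] _] /andP [/andP [_ FE] _] e.
  by rewrite -(setID D F) -(setID E F) e (setIidPr FD) (setIidPr FE).
- move=> D; rewrite !mem_filter !mem_index_enum !andbT => /andP [lD _].
  by apply: sub lD; rewrite subsetDl.
- by move=> E; rewrite prodr_ge0.
Qed.

Lemma level_prod_mem (D : {set I}) i : (i \in D) = (q i %| \prod_(j in D) q j)%N.
Proof.
apply/idP/idP => [iD|]; first by rewrite (bigD1 i) //= dvdn_mulr.
apply: contraTT => iD; rewrite -prime_coprime ?opval_prime //.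
apply: (big_ind (fun n => coprime (q i) n)) => [|m n cm cn|j jD]; rewrite ?coprimen1 ?coprimeMr ?cm //.
by apply: opval_coprime; apply: contraNneq iD => ->.
Qed.

Lemma harmonic_le N : (0 < N)%N -> \sum_(1 <= n < N.+1) n%:R^-1 <= 1 + ln N%:R :> R.
Proof.
case: N => // N _; elim: N => [|N IH]; first by rewrite big_nat1 ln1 addr0 invr1.
rewrite big_nat_recr //=; apply: le_trans (lerD IH (lexx _)) _.
rewrite -addrA lerD2l -lerBrDl.
have p : 0 < N.+1%:R :> R by rewrite ltr0n.
have h : ln (1 - N.+2%:R^-1) <= - N.+2%:R^-1 :> R.
  by apply: le_ln1Dx; rewrite ltrN2 invf_lt1 ?ltr1n ?ltr0n.
rewrite -lerN2 opprB; apply: le_trans _ h; rewrite -ln_div ?posrE ?ltr0n //.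
rewrite (_ : N.+1%:R / N.+2%:R = 1 - N.+2%:R^-1) // -[N.+2%:R]natr1.
by move: (N.+1%:R) p => v v0; field; rewrite gt_eqF // addr_gt0.
Qed.

Lemma level_sum_inv : level_sum (fun i => (q i)%:R^-1) <= 1 + ln Q%:R.
Proof.
apply: le_trans (harmonic_le Q0); rewrite /level_sum -big_filter.
under eq_bigr => D _ do rewrite prodfV -natr_prod.
apply: (@ler_sum_inj R _ _ _ _ (fun D : {set I} => (\prod_(i in D) q i)%N) (fun n => n%:R^-1)).
- by rewrite filter_uniq ?index_enum_uniq.
- by rewrite iota_uniq.
- by move=> D E _ _ e; apply/setP => i; rewrite !level_prod_mem e.
- move=> D; rewrite mem_filter mem_index_iota ltnS => /andP [lD _]; apply/andP; split=> //.
  by apply: prodn_gt0 => i; rewrite prime_gt0 ?opval_prime.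
- by move=> n; rewrite invr_ge0.
Qed.

(** On a level set the product of the [w i] <= 3 is at most Q times the product of 3/q. Writing 3/q
    as three copies of 1/q, [level_sumD] bounds the sum by the cube of a sum of 1/d over d <= Q. *)
Lemma sieve_error_le :
  \sum_(D : {set I} | sieve_level q Q D) (\prod_(i in D) w i)%:R <= Q%:R * (1 + ln Q%:R) ^+ 3 :> R.
Proof.
pose a (i : I) : R := (q i)%:R^-1.
have a0 i : 0 <= a i by rewrite invr_ge0.
apply: (@le_trans _ _ (Q%:R * level_sum (fun i => a i + a i + a i))).
  rewrite /level_sum mulr_sumr; apply: ler_sum => D lD.
  apply: (@le_trans _ _ ((\prod_(i in D) q i)%:R * \prod_(i in D) (a i + a i + a i))).
    rewrite !natr_prod -big_split /=; apply: ler_prod => i _; rewrite ler0n /=.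
    have -> : (q i)%:R * (a i + a i + a i) = 3%:R.
      by rewrite /a; field; rewrite pnatr_eq0 -lt0n prime_gt0 ?opval_prime.
    by rewrite ler_nat /opweight; case: ifP.
  rewrite ler_wpM2r ?ler_nat // prodr_ge0 // => i _; rewrite !addr_ge0 //.
have l0 b : (forall i, 0 <= b i) -> 0 <= level_sum b.
  by move=> b0; apply: sumr_ge0 => D _; rewrite prodr_ge0.
have la : 0 <= level_sum a <= 1 + ln Q%:R by rewrite l0 //= level_sum_inv.
case/andP: la => la0 la1.
rewrite ler_wpM2l //.
apply: le_trans (level_sumD _ a0) _; first by move=> i; rewrite addr_ge0.
rewrite exprSr; apply: ler_pM => //; first by apply: l0 => i; rewrite addr_ge0.
apply: le_trans (level_sumD a0 a0) _.
by rewrite expr2; apply: ler_pM.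
Qed.
End SieveError.

Lemma count_not_excluded (R : realType) (Q X c : nat) : (0 < Q)%N ->
  (\sum_(j < X) [forall i : odd_prime_le Q, ~~ excluded (opval i) (8 * j + c)])%:R <=
  X%:R / sieve_mass R (@opval Q) (@opweight Q) Q + (Q%:R * (1 + ln Q%:R) ^+ 3) ^+ 2 :> R.
Proof.
move=> Q0; pose bad (i : odd_prime_le Q) j := excluded (opval i) (8 * j + c).
have eq D := @equidistributed_crt R _ (@opval Q) (@opweight Q) bad
  (fun i => prime_gt0 (opval_prime i)) (@opval_coprime Q)
  (fun i j => excluded_mod c (opval_prime i) j)
  (fun i => count_excluded c (opval_prime i) (opval_odd i)) X D.
have := selberg_sieve (@opweight_gt0 Q) (@opweight_lt Q) Q0 eq.
move=> h; apply: le_trans h _; rewrite lerD2l lerXn2r ?nnegrE //.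
- by apply: sumr_ge0.
- by rewrite mulr_ge0 // exprn_ge0 // addr_ge0 // ln_ge0 // ler1n.
- exact: sieve_error_le.
Qed.

(** From exp(-1/24) >= 23/24 one gets exp(2/3) <= (24/23)^16; four squarings with rounding down show
    (23/24)^16 >= 1/2. *)
Lemma expR_two_thirds (R : realType) : expR (2 / 3) <= 2 :> R.
Proof.
have h : expR (2 / 3) * (23 / 24) ^+ 16 <= 1 :> R.
  rewrite (_ : 2 / 3 = 16%:R * (1 / 24)); last by field.
  rewrite expRM_natl -exprMn exprn_ile1 ?mulr_ge0 ?expR_ge0 ?invr_ge0 //.
  have := expR_ge1Dx (- (1 / 24) : R); rewrite expRN => h.
  have e0 := expR_gt0 (1 / 24 : R).
  have : expR (1 / 24) * (1 - 1 / 24) <= expR (1 / 24) * (expR (1 / 24))^-1 :> R by rewrite ler_pM2l.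
  rewrite (_ : 1 - 1 / 24 = 23 / 24 :> R); last by field.
  by rewrite divff ?gt_eqF.
have sq (a b : R) n : 0 <= a -> 0 <= b -> b <= a ^+ 2 -> a <= (23 / 24) ^+ n -> b <= (23 / 24) ^+ (n * 2)%N.
  by move=> a0 b0 ba an; rewrite exprM; apply: le_trans ba _; rewrite lerXn2r ?nnegrE // ?exprn_ge0 ?divr_ge0 //.
have l2 : 45 / 49 <= (23 / 24) ^+ (1 * 2)%N :> R by rewrite expr2; lra.
have l4 : 43 / 51 <= (23 / 24) ^+ (1 * 2 * 2)%N :> R by apply: sq l2; rewrite ?expr2 //; lra.
have l8 : 27 / 38 <= (23 / 24) ^+ (1 * 2 * 2 * 2)%N :> R by apply: sq l4; rewrite ?expr2 //; lra.
have l16 : 1 / 2 <= (23 / 24) ^+ (1 * 2 * 2 * 2 * 2)%N :> R by apply: sq l8; rewrite ?expr2 //; lra.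
have := le_trans (ler_wpM2l (expR_ge0 (2 / 3 : R)) l16) h.
by rewrite mul1r ler_pdivrMr ?mul1r.
Qed.

Lemma ln2_ge (R : realType) : 2 / 3 <= ln 2 :> R.
Proof. by rewrite -[leLHS]expRK ler_ln ?posrE ?expR_gt0 // expR_two_thirds. Qed.

(** * Explicit constants at level Q = 2^(4 i) and the sum over dyadic intervals *)

Section LevelPow16.
Variables (R : realType) (i : nat).
Hypothesis i114 : (114 <= i)%N.
Local Notation Q := (2 ^ (4 * i))%N.
Local Notation L := (sieve_mass R (@opval Q) (@opweight Q) Q).

Let ln_level : ln Q%:R = (4 * i)%:R * ln 2 :> R.
Proof. by rewrite natrX lnXn // mulr_natl. Qed.

(** Here ln Q = 4 i ln 2 >= (8/3) i, which is at least 304. As L is at least half of the [piQ] sum,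
    L^2 >= (1/4)(12/125)(8/3)^3 i^3, about 0.455 i^3, and this exceeds (4/9) i^3. *)
Lemma sieve_mass_pow_ge : 2 / 3 * (i%:R * Num.sqrt i%:R) <= L.
Proof.
have Q0 : (0 < Q)%N by rewrite expn_gt0.
have iR : 114%:R <= i%:R :> R by rewrite ler_nat.
have i0 : 0 < i%:R :> R by apply: lt_le_trans iR.
have s8 : 8 / 3 * i%:R <= ln Q%:R :> R.
  by rewrite ln_level natrM; have := ln2_ge R; move: (ln 2) => l hl; nra.
have s304 : 304%:R <= ln Q%:R :> R by apply: le_trans s8; lra.
have h := piQ_sum_bound s304.
have hL := sieve_mass_lower R Q0.
have L0 : 0 <= L by apply: (le_trans ler01); apply: sieve_mass_ge1 => // j; rewrite ?opweight_gt0 ?opweight_lt.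
have s3 : (8 / 3 * i%:R) ^+ 3 <= ln Q%:R ^+ 3 :> R.
  have l0 : 0 <= 8 / 3 * i%:R :> R by rewrite mulr_ge0 ?divr_ge0.
  by rewrite lerXn2r ?nnegrE // (le_trans l0).
have I0 : 0 <= dsum (dpi R piQ) Q (phi 1) (ln Q%:R).
  by apply: sumr_ge0 => n _; rewrite !mulr_ge0 ?dpi_ge0 ?invr_ge0 ?phi_ge0.
have hI : dsum (dpi R piQ) Q (phi 1) (ln Q%:R) ^+ 2 <= 4 * L ^+ 2.
  have : dsum (dpi R piQ) Q (phi 1) (ln Q%:R) <= 2 * L by rewrite mulrC -ler_pdivrMr.
  by move: (dsum _ _ _ _) I0 => I I0 hI; clear - I0 hI L0; move: L L0 hI => l l0 hI; nra.
rewrite -ler_sqr ?nnegrE ?mulr_ge0 ?divr_ge0 ?invr_ge0 ?sqrtr_ge0 ?(ltW i0) //.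
rewrite !exprMn sqr_sqrtr ?(ltW i0) //.
have e3 : (8 / 3 * i%:R) ^+ 3 = 512 / 27 * (i%:R ^+ 2 * i%:R) :> R by field.
rewrite e3 in s3.
have u0 : 0 <= i%:R ^+ 2 * i%:R :> R by rewrite mulr_ge0 ?sqr_ge0 ?(ltW i0).
have e2 : 2^+2 * (3^-1)^+2 = 4 / 9 :> R by field.
rewrite e2.
move: (L ^+ 2) (i%:R ^+ 2 * i%:R) (ln Q%:R ^+ 3) (dsum _ _ _ _ ^+ 2) hI h s3 u0 => x u v y.
by clear; lra.
Qed.

Lemma sieve_error_pow_le : (Q%:R * (1 + ln Q%:R) ^+ 3) ^+ 2 <= 2 ^+ (8 * i) * (5 * i%:R) ^+ 6 :> R.
Proof.
have iR : 114%:R <= i%:R :> R by rewrite ler_nat.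
have l5 : 1 + ln Q%:R <= 5 * i%:R :> R.
  rewrite ln_level natrM.
  have l1 : ln 2 <= 1 :> R.
    by have := @le_ln1Dx R 1 ltac:(lra); rewrite (_ : 1 + 1 = 2).
  by move: (ln 2) l1 (ln2_ge R) => l l1 l0; nra.
have l0 : 0 <= 1 + ln Q%:R :> R by rewrite addr_ge0 // ln_ge0 // ler1n expn_gt0.
rewrite exprMn -exprM natrX -exprM (_ : 4 * i * 2 = 8 * i)%N; last by lia.
rewrite ler_pM2l ?exprn_gt0 // -natrX lerXn2r ?nnegrE //.
exact: le_trans l5.
Qed.

(** At i = 114 the exponents compare as 7 * 8 + 29 = 85 <= 114, since 114 <= 2^7; each further step
    multiplies the left side by at most (101/100)^8 <= 2. *)
Lemma pow2_dominates : i%:R ^+ 8 * 2 ^+ 29 <= 2 ^+ i :> R.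
Proof.
rewrite -(subnKC i114); elim: (i - 114)%N => [|m IH].
  rewrite addn0; apply: (@le_trans _ _ ((2 ^+ 7) ^+ 8 * 2 ^+ 29)).
    rewrite ler_wpM2r ?exprn_ge0 // lerXn2r ?nnegrE ?exprn_ge0 //.
    by rewrite -natrX ler_nat.
  by rewrite -exprM -exprD ler_weXn2l ?ler1n.
rewrite addnS [leRHS]exprSr; apply: le_trans (ler_wpM2r (ler0n _ 2) IH).
rewrite [leRHS]mulrAC ler_wpM2r ?exprn_ge0 //.
set n := (114 + m)%N; have n1 : n.+1%:R <= 101 / 100 * n%:R :> R.
  have : 114%:R <= n%:R :> R by rewrite ler_nat leq_addr.
  by rewrite -[n.+1%:R]natr1; lra.
apply: (@le_trans _ _ ((101 / 100 * n%:R) ^+ 8)).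
  by rewrite lerXn2r ?nnegrE // mulr_ge0 ?divr_ge0.
rewrite exprMn mulrC ler_wpM2l ?exprn_ge0 //.
have sq (a b : R) k : 0 <= a -> a ^+ 2 <= b -> (101 / 100) ^+ k <= a -> (101 / 100) ^+ (k * 2)%N <= b.
  move=> a0 ab ka; rewrite exprM; apply: le_trans ab; rewrite lerXn2r ?nnegrE //.
  by rewrite exprn_ge0 ?divr_ge0.
have l2 : (101 / 100) ^+ (1 * 2)%N <= 11 / 10 :> R by rewrite expr2; lra.
have l4 : (101 / 100) ^+ (1 * 2 * 2)%N <= 5 / 4 :> R by apply: sq l2; rewrite ?expr2; lra.
by apply: (sq _ _ _ _ _ l4); rewrite ?expr2; lra.
Qed.
End LevelPow16.

Lemma sum_residues_1_7 (V : nmodType) (F : nat -> V) (a Y : nat) : (8 %| a)%N ->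
  (forall n, (n %% 8)%N \notin [:: 1; 7]%N -> F n = 0) ->
  \sum_(a <= n < a + 8 * Y) F n =
  \sum_(j < Y) F (8 * j + (a + 1))%N + \sum_(j < Y) F (8 * j + (a + 7))%N.
Proof.
move=> a8 F0; rewrite -big_split /=.
elim: Y => [|Y IH]; first by rewrite muln0 addn0 big_geq // big_ord0.
rewrite big_ord_recr /= -IH mulnS [(8 + _)%N]addnC addnA.
rewrite (big_cat_nat (n := (a + 8 * Y)%N)) ?leq_addr //=; congr (_ + _).
have -> : (8 * Y + (a + 1) = 1 + (a + 8 * Y))%N by lia.
have -> : (8 * Y + (a + 7) = 7 + (a + 8 * Y))%N by lia.
have b8 : (8 %| a + 8 * Y)%N by rewrite dvdn_addr // dvdn_mulr.
move: (a + 8 * Y)%N b8 => b b8.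
have Fz k : (k %% 8)%N \notin [:: 1; 7]%N -> F (k + b)%N = 0.
  by move=> hk; apply: F0; rewrite -modnDmr (eqP b8) addn0.
rewrite -{1}(add0n b) big_addn addKn.
rewrite !big_nat_recr //= big_geq // add0r.
by rewrite (Fz 0%N) // (Fz 2%N) // (Fz 3%N) // (Fz 4%N) // (Fz 5%N) // (Fz 6%N) // !(add0r, addr0).
Qed.

Section DyadicBlocks.
Variables (R : realType) (P : pred nat).
Hypothesis Pres : forall n, P n -> (n %% 8)%N \in [:: 1; 7]%N.
Hypothesis Pexc : forall n q, P n -> prime q -> odd q -> (q < n)%N -> ~~ excluded q n.
Variable i : nat.
Hypothesis i114 : (114 <= i)%N.
Local Notation Q := (2 ^ (4 * i))%N.
Local Notation L := (sieve_mass R (@opval Q) (@opweight Q) Q).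

Let iR : 114%:R <= i%:R :> R. Proof. by rewrite ler_nat. Qed.
Let i0 : 0 < i%:R :> R. Proof. exact: lt_le_trans iR. Qed.
Let r0 : 0 < i%:R * Num.sqrt i%:R :> R. Proof. by rewrite mulr_gt0 ?sqrtr_gt0. Qed.
Let mass_gt0 : 0 < L.
Proof. by apply: lt_le_trans (sieve_mass_pow_ge R i114); rewrite mulr_gt0 ?divr_gt0. Qed.

(** All terms exceed Q, hence every sieving prime, so [Pexc] applies to each of these primes. *)
Lemma count_progression (Y c : nat) : (Q < c)%N ->
  (\sum_(j < Y) P (8 * j + c)%N)%:R <= Y%:R / L + 2 ^+ (8 * i) * (5 * i%:R) ^+ 6 :> R.
Proof.
move=> Qc; apply: le_trans (lerD (lexx _) (sieve_error_pow_le R i114)).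
have Q0 : (0 < Q)%N by rewrite expn_gt0.
apply: le_trans (count_not_excluded R Y c Q0); rewrite ler_nat; apply: leq_sum => j _.
case Pn : (P _) => //; rewrite lt0b; apply/forallP => x.
apply: Pexc => //; [exact: opval_prime | exact: opval_odd |].
by apply: leq_ltn_trans (opval_le x) _; apply: leq_trans Qc (leq_addl _ _).
Qed.

(** With 5 <= 2^3 and k >= 9 i the quotient is at most 2^18 i^6 / 2^i, and [pow2_dominates] makes it
    2^(-11) / i^2. *)
Lemma error_term_le k : (9 * i <= k)%N ->
  2 ^+ (8 * i) * (5 * i%:R) ^+ 6 / 2 ^+ k <= (2 ^+ 11)^-1 / (i%:R * Num.sqrt i%:R) :> R.
Proof.
move=> ik; have p2 n : 0 < 2 ^+ n :> R by rewrite exprn_gt0.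
have h8 : (5 * i%:R) ^+ 6 <= (2 ^+ 3 * i%:R) ^+ 6 :> R.
  rewrite lerXn2r ?nnegrE ?mulr_ge0 ?exprn_ge0 ?(ltW i0) // ler_wpM2r ?(ltW i0) //.
  by rewrite -natrX ler_nat.
have hr : i%:R * Num.sqrt i%:R <= i%:R ^+ 2 :> R.
  rewrite expr2 ler_pM2l // -[leRHS]ger0_norm ?(ltW i0) // -sqrtr_sqr ler_sqrt ?exprn_ge0 ?(ltW i0) //.
  by rewrite expr2 ler_peMl ?(ltW i0) // (le_trans _ iR) // ler1n.
apply: (@le_trans _ _ (2 ^+ (8 * i) * (2 ^+ 3 * i%:R) ^+ 6 / (2 ^+ (8 * i) * (i%:R ^+ 8 * 2 ^+ 29)))).
  rewrite ler_pM ?invr_ge0 ?mulr_ge0 ?exprn_ge0 ?mulr_ge0 ?(ltW i0) ?exprn_ge0 //.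
    by rewrite ler_pM2l.
  rewrite lef_pV2 ?posrE ?mulr_gt0 ?exprn_gt0 //.
  apply: (@le_trans _ _ (2 ^+ (9 * i))); last by rewrite ler_weXn2l ?ler1n.
  rewrite (_ : 9 * i = 8 * i + i)%N; last by lia.
  by rewrite exprD ler_pM2l // pow2_dominates.
have -> : 2 ^+ (8 * i) * (2 ^+ 3 * i%:R) ^+ 6 / (2 ^+ (8 * i) * (i%:R ^+ 8 * 2 ^+ 29)) =
    (2 ^+ 11)^-1 / i%:R ^+ 2 :> R.
  move: (2 ^+ (8 * i)) (p2 (8 * i)%N) => T T0; rewrite exprMn -exprM.
  rewrite (_ : 2 ^+ 29 = 2 ^+ (3 * 6) * 2 ^+ 11); last by rewrite -exprD.
  move: (2 ^+ (3 * 6)) (2 ^+ 11) (p2 (3 * 6)%N) (p2 11) => a b a0 b0.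
  by field; rewrite !gt_eqF.
by rewrite ler_pM2l ?invr_gt0 // lef_pV2 ?posrE ?exprn_gt0.
Qed.

(** Two progressions mod 8 of 2^(k-3) terms, each term at most 2^(-k): the main terms add up to 2
    (1/8)(3/2) = 3/8, and the two errors to 2^(-10) <= 1/900. *)
Lemma dyadic_reciprocal_sum k : (9 * i <= k)%N ->
  \sum_(2 ^ k <= n < 2 ^ k.+1 | P n) n%:R^-1 <= (3 / 8 + 1 / 900%:R) / (i%:R * Num.sqrt i%:R) :> R.
Proof.
move=> ik; have k3 : (3 <= k)%N by lia.
pose z : R := (2 ^+ k)^-1; have z0 : 0 < z by rewrite invr_gt0 exprn_gt0.
pose F n : R := (P n)%:R * z.
apply: (@le_trans _ _ (\sum_(2 ^ k <= n < 2 ^ k.+1) F n)).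
  rewrite big_mkcond [leLHS]big_nat [leRHS]big_nat; apply: ler_sum => n /andP [kn _].
  rewrite /F; case: (P n); last by rewrite mul0r.
  by rewrite mul1r /z lef_pV2 ?posrE ?exprn_gt0 ?ltr0n ?(leq_trans _ kn) ?expn_gt0 // -natrX ler_nat.
have e2 : (2 ^ k.+1 = 2 ^ k + 8 * 2 ^ (k - 3))%N.
  by rewrite -(subnKC k3) addKn expnS expnD (_ : 2 ^ 3 = 8)%N //; lia.
rewrite e2 sum_residues_1_7; first last.
- move=> n hn; rewrite /F; case Pn : (P n); last by rewrite mul0r.
  by rewrite (Pres Pn) in hn.
- by rewrite -(subnKC k3) expnD dvdn_mulr.
have Sum c : (2 ^ k < c)%N -> \sum_(j < 2 ^ (k - 3)) F (8 * j + c)%N <=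
    (3 / 16 + 1 / 2 ^+ 11) / (i%:R * Num.sqrt i%:R).
  move=> kc; rewrite -mulr_suml -natr_sum.
  have Qc : (Q < c)%N by apply: leq_ltn_trans kc; rewrite leq_exp2l //; lia.
  apply: le_trans (ler_wpM2r (ltW z0) (count_progression _ Qc)) _.
  rewrite mulrDl [leRHS]mulrDl; apply: lerD; last by rewrite mul1r error_term_le.
  have -> : (2 ^ (k - 3))%:R / L * z = 1 / 8 / L.
    have e : z = (2 ^+ (k - 3))^-1 / 8 by rewrite /z -{1}(subnKC k3) exprD -natrX invfM mulrC.
    rewrite e natrX; have : 2 ^+ (k - 3) != 0 :> R by rewrite expf_neq0 // pnatr_eq0.
    by move: (2 ^+ _) L mass_gt0 => a l l0 a0; field; rewrite a0 gt_eqF.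
  rewrite (_ : 3 / 16 = 1 / 8 * (3 / 2)); last by field.
  rewrite -[leRHS]mulrA ler_pM2l ?divr_gt0 // -[3 / 2]invf_div -invfM lef_pV2 ?posrE ?mulr_gt0 ?divr_gt0 ?invr_gt0 ?sqrtr_gt0 //.
  exact: sieve_mass_pow_ge.
apply: le_trans (lerD (Sum _ _) (Sum _ _)) _; rewrite ?addn1 // ?ltnS ?leq_addr //.
  by rewrite addnS ltnS leq_addr.
rewrite -mulrDl ler_wpM2r ?invr_ge0 ?(ltW r0) //.
have : 1 / 2 ^+ 11 <= 1 / 1800%:R :> R.
  by rewrite ler_pM2l // lef_pV2 ?posrE ?exprn_gt0 // -natrX ler_nat.
by lra.
Qed.
End DyadicBlocks.

(** A discrete form of comparing u^(-3/2) with its integral. With x and y the two roots, y^2 - x^2 =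
    1 gives 1/x - 1/y = 1/(x y (x + y)), and x <= y. *)
Lemma inv_sqrt_telescope (R : realType) (a : R) : 0 < a ->
  ((a + 1) * Num.sqrt (a + 1))^-1 <= 2 * ((Num.sqrt a)^-1 - (Num.sqrt (a + 1))^-1).
Proof.
move=> a0; have a1 : 0 < a + 1 by rewrite addr_gt0.
have ex : Num.sqrt a ^+ 2 = a by rewrite sqr_sqrtr ?ltW.
have ey : Num.sqrt (a + 1) ^+ 2 = a + 1 by rewrite sqr_sqrtr ?ltW.
have x0 : 0 < Num.sqrt a by rewrite sqrtr_gt0.
have xy : Num.sqrt a <= Num.sqrt (a + 1) by rewrite ler_sqrt ?ltW ?ltrDl.
rewrite -{1}ey; move: (Num.sqrt a) (Num.sqrt (a + 1)) ex ey x0 xy => x y ex ey x0 xy.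
have y0 : 0 < y by apply: lt_le_trans xy.
have -> : x^-1 - y^-1 = (x * y * (x + y))^-1.
  have e : (y - x) * (x + y) = 1 by rewrite -[RHS](addrK a) [1 + a]addrC -ey -ex; ring.
  have n0 : x + y != 0 by rewrite gt_eqF ?addr_gt0.
  rewrite -[RHS]mul1r -[X in X / _]e; field.
  by rewrite n0 !gt_eqF.
rewrite -[leLHS]mul1r ler_pdivrMr ?mulr_gt0 ?exprn_gt0 // mulrAC ler_pdivlMr ?mulr_gt0 ?addr_gt0 // mul1r.
have yy : x * y <= y ^+ 2 by rewrite expr2 ler_pM2r.
have h : (x * y) * (x + y) <= y ^+ 2 * (y + y).
  by apply: ler_pM => //; rewrite ?lerD2r // ?mulr_ge0 ?addr_ge0 ?ltW.
by apply: le_trans h _; rewrite -mulr2n -[y *+ 2]mulr_natl mulrCA.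
Qed.

Section ReciprocalSum.
Variables (R : realType) (P : pred nat).
Hypothesis Pres : forall n, P n -> (n %% 8)%N \in [:: 1; 7]%N.
Hypothesis Pexc : forall n q, P n -> prime q -> odd q -> (q < n)%N -> ~~ excluded q n.

Lemma block_reciprocal_sum i : (114 <= i)%N ->
  \sum_(2 ^ (9 * i) <= n < 2 ^ (9 * i.+1) | P n) n%:R^-1 <=
  9 * ((3 / 8 + 1 / 900%:R) / (i%:R * Num.sqrt i%:R)) :> R.
Proof.
move=> i114; set B := (X in 9 * X).
have h r : \sum_(2 ^ (9 * i) <= n < 2 ^ (9 * i + r) | P n) n%:R^-1 <= r%:R * B.
  elim: r => [|r IH]; first by rewrite addn0 big_geq // mul0r.
  rewrite (big_cat_nat (n := (2 ^ (9 * i + r))%N)) ?leq_exp2l ?leq_add2l ?leq_addr //=.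
  rewrite -[r.+1%:R]natr1 mulrDl mul1r lerD // addnS.
  by apply: dyadic_reciprocal_sum => //; apply: leq_addr.
by have := h 9; rewrite -[(9 * i + 9)%N]mulnSr.
Qed.

(* The level Q = 2^(4 i) serves for the nine dyadic intervals between 2^(9 i) and 2^(9 (i + 1)): then Q^2 is small
   against the length of the intervals, and the reciprocal sum over them is O(i^(-3/2)). *)
Lemma reciprocal_sum_le a m : (113 <= a)%N ->
  \sum_(2 ^ (9 * a.+1) <= n < 2 ^ (9 * (a.+1 + m)) | P n) n%:R^-1 <=
  677%:R / 100 * ((Num.sqrt a%:R)^-1 - (Num.sqrt (a + m)%:R)^-1) :> R.
Proof.
move=> a113; elim: m => [|m IH]; first by rewrite !addn0 big_geq // subrr mulr0.
rewrite (big_cat_nat (n := (2 ^ (9 * (a.+1 + m)))%N)) ?leq_exp2l ?leq_mul2l ?leq_add2l ?leq_addr //=.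
apply: le_trans (lerD IH _) _; first by rewrite addnS; apply: block_reciprocal_sum; rewrite addSn ltnS ltn_addr.
have := @inv_sqrt_telescope R (a + m)%:R ltac:(by rewrite ltr0n; lia).
rewrite natr1 -addSn.
have i0 : 0 <= ((a.+1 + m)%:R * Num.sqrt (a.+1 + m)%:R)^-1 :> R by rewrite invr_ge0 mulr_ge0 ?sqrtr_ge0.
rewrite addnS -addSn; clear IH; set x := (_ * _)^-1 in i0 *.
move: x i0 (Num.sqrt a%:R)^-1 (Num.sqrt (a + m)%:R)^-1 (Num.sqrt (a.+1 + m)%:R)^-1 => x i0 b c d; lra.
Qed.

(** The constant 6.77 is 2 * 9 * (3/8 + 1/900), the factor 2 coming from the telescoping; since sqrt
    113 >= 10.6, it leaves at most 6.77 / 10.6 < 0.64. *)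
Lemma reciprocal_sum_lt a m : (113 <= a)%N ->
  \sum_(2 ^ (9 * a.+1) <= n < 2 ^ (9 * (a.+1 + m)) | P n) n%:R^-1 <= 64 / 100 :> R.
Proof.
move=> a113; apply: le_trans (reciprocal_sum_le m a113) _.
have aR : 113%:R <= a%:R :> R by rewrite ler_nat.
have s : 106%:R / 10 <= Num.sqrt a%:R :> R.
  rewrite -[leLHS]ger0_norm ?divr_ge0 // -sqrtr_sqr ler_sqrt // expr2; lra.
have s' : (Num.sqrt a%:R)^-1 <= 10 / 106%:R :> R.
  by rewrite -[leRHS]invf_div lef_pV2 ?posrE ?(lt_le_trans _ s) ?divr_gt0.
have t : 0 <= (Num.sqrt (a + m)%:R)^-1 :> R by rewrite invr_ge0 sqrtr_ge0.
by clear s; move: s' t; move: (Num.sqrt _)^-1 (Num.sqrt _)^-1 => u v; lra.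
Qed.
End ReciprocalSum.

(** * The contradiction when all prime factors are large *)

Lemma geometric_sum_lt (R : realFieldType) (x : R) k : 1 < x ->
  \sum_(j < k.+1) x ^+ j <= x ^+ k * (1 + (x - 1)^-1).
Proof.
move=> x1; have x0 : 0 < x - 1 by rewrite subr_gt0.
have -> : 1 + (x - 1)^-1 = x / (x - 1) by field; rewrite gt_eqF.
rewrite mulrA ler_pdivlMr // mulrC -exprSr.
suff -> : (x - 1) * \sum_(j < k.+1) x ^+ j = x ^+ k.+1 - 1 by rewrite lerBlDr lerDl.
by rewrite subrX1.
Qed.

Section NoLargePrimes.
Variables (R : realType) (t a N m : nat) (p : 'I_t -> nat) (b : nat).
Hypotheses (pp : forall i, prime (p i)) (ip : injective p) (b113 : (113 <= b)%N).
Hypothesis pb : forall i, (2 ^ (9 * b.+1) <= p i)%N.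
Hypotheses (eN : N = ((\prod_(i < t) p i) ^ (2 * a))%N) (em : N = (m ^ 2)%N).
Hypothesis qN : quasiperfect N.

Let p64 i : (64 <= p i)%N.
Proof. by apply: leq_trans (pb i); rewrite (@leq_exp2l 2 6) //; lia. Qed.
Let p3 i : (3 < p i)%N. Proof. by apply: leq_trans (p64 i). Qed.

Lemma sum_prime_reciprocals : \sum_(i < t) (p i)%:R^-1 <= 64 / 100 :> R.
Proof.
pose P : pred nat := [pred n | n \in codom p].
have Pres n : P n -> (n %% 8)%N \in [:: 1; 7]%N.
  by move=> /codomP [i ->]; apply: (prime_factor_mod8 pp ip p3 eN em qN).
have Pexc n q : P n -> prime q -> odd q -> (q < n)%N -> ~~ excluded q n.
  move=> /codomP [i ->] pq oq qn; rewrite /excluded dvdn_prime2 // (ltn_eqF qn) /=.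
  (* The residues 7, 13 mod 24 are 7, 5 mod 8, whereas divisors of p^2 + p + 1 are 1 or 3 mod 8. *)
  apply/andP => -[qQ qd]; have := dvd_p2p1_mod8 pp ip p3 eN em qN qd.
  have := @modn_dvdm 24 q 8 isT; move: qQ; rewrite /piQ !inE => /orP [] /eqP -> <- //.
pose M := (\sum_i p i)%N.
apply: le_trans (reciprocal_sum_lt R Pres Pexc M b113).
rewrite -[leRHS]big_filter.
apply: (@ler_sum_inj R _ _ _ _ p (fun n => n%:R^-1)).
- exact: index_enum_uniq.
- by rewrite filter_uniq ?iota_uniq.
- by move=> i j _ _; apply: ip.
- move=> i _; rewrite mem_filter mem_index_iota pb andTb; apply/andP; split; first exact: codom_f.
  apply: leq_trans (ltn_expl (p i) (isT : 1 < 2)%N) _.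
  rewrite leq_exp2l //; have : (p i <= M)%N by rewrite /M (bigD1 i) //= leq_addr.
  by lia.
- by move=> n; rewrite invr_ge0.
Qed.

(** For p >= 64 one has 1/(p - 1) <= (51/50)/p, and 1.02 * 0.64 = 0.6528 is below 2/3. *)
Lemma prod_abundancy_lt : \prod_(i < t) (1 + ((p i)%:R - 1)^-1) < 2 :> R.
Proof.
apply: (@le_lt_trans _ _ (expR (\sum_(i < t) ((p i)%:R - 1)^-1))).
  rewrite expR_sum; apply: ler_prod => i _; rewrite expR_ge1Dx andbT.
  by rewrite addr_ge0 // invr_ge0 subr_ge0 ler1n prime_gt0.
apply: lt_le_trans (expR_two_thirds R); rewrite ltr_expR.
apply: (@le_lt_trans _ _ (51 / 50 * (64 / 100))); last by lra.
apply: le_trans (ler_wpM2l _ sum_prime_reciprocals); last by rewrite divr_ge0.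
rewrite mulr_sumr; apply: ler_sum => i _.
have h : 64%:R <= (p i)%:R :> R by rewrite ler_nat.
rewrite -[leLHS]mul1r ler_pdivrMr; last by lra.
by rewrite mulrAC ler_pdivlMr; lra.
Qed.

Lemma not_quasiperfect_large : False.
Proof.
have e := sigma_quasiperfect pp ip eN qN.
have h : (2 * N + 1)%:R <= N%:R * \prod_(i < t) (1 + ((p i)%:R - 1)^-1) :> R.
  rewrite -e eN expn_prod !natr_prod -big_split /=; apply: ler_prod => i _; rewrite ler0n /=.
  rewrite natr_sum natrX; under eq_bigr => j _ do rewrite natrX.
  by apply: geometric_sum_lt; rewrite ltr1n prime_gt1.
have N0 : 0 < N%:R :> R by rewrite ltr0n; case: qN.
have := le_lt_trans h (_ : _ < N%:R * 2); rewrite ltr_pM2l // => /(_ prod_abundancy_lt).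
by rewrite natrD natrM; lra.
Qed.
End NoLargePrimes.

(** * Numerical bounds for the exponential *)

Section ExpBounds.
Import boolp classical_sets topology normedtype.
Variable R : realType.

Lemma expR_ge_series (x : R) n : 0 <= x -> series (exp_coeff x) n <= expR x.
Proof.
move=> x0; rewrite /expR; apply: limr_ge; first exact: is_cvg_series_exp_coeff.
near=> m; have nm : (n <= m)%N by near: m; apply: nbhs_infty_ge.
rewrite /series /= [leRHS](big_cat_nat (n := n)) //= lerDl sumr_ge0 // => i _.
by rewrite /exp_coeff divr_ge0 ?exprn_ge0.
Unshelve. all: by end_near. Qed.

Lemma exp_coeffS (x : R) n : exp_coeff x n.+1 = exp_coeff x n * x / n.+1%:R.
Proof.
rewrite /exp_coeff /= exprSr factS natrM invfM; ring.
Qed.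

(** For x <= 1 and n >= 1 consecutive terms shrink by at least 1/2, so the partial sum plus twice
    the next term is nonincreasing in n. *)
Lemma expR_le_series (x : R) n : 0 <= x <= 1 -> (0 < n)%N ->
  expR x <= series (exp_coeff x) n + 2 * exp_coeff x n.
Proof.
move=> /andP [x0 x1] n0.
have c0 k : 0 <= exp_coeff x k by rewrite /exp_coeff divr_ge0 ?exprn_ge0.
have step k : series (exp_coeff x) (n + k)%N + 2 * exp_coeff x (n + k)%N <=
              series (exp_coeff x) n + 2 * exp_coeff x n.
  elim: k => [|k IH]; first by rewrite !addn0.
  apply: le_trans IH; rewrite addnS seriesSr exp_coeffS -addrA lerD2l.
  rewrite [leRHS]mulr_natl mulr2n lerD2l mulrA ler_pdivrMr ?ltr0n // mulrCA ler_wpM2l //.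
  have h2 : 2 * x <= 2 by lra.
  by apply: le_trans h2 _; rewrite ler_nat; lia.
rewrite /expR; apply: limr_le; first exact: is_cvg_series_exp_coeff.
near=> m; have nm : (n <= m)%N by near: m; apply: nbhs_infty_ge.
rewrite -(subnKC nm); apply: le_trans _ (step (m - n)%N).
by rewrite lerDl mulr_ge0.
Unshelve. all: by end_near. Qed.
End ExpBounds.

Section FixedPointExp.
Variable R : realType.
Local Notation NR := (fun n : BinNums.N => (BinNat.N.to_nat n)%:R : R).

Lemma to_natM (a b : BinNums.N) : BinNat.N.to_nat (BinNat.N.mul a b) = (BinNat.N.to_nat a * BinNat.N.to_nat b)%N.
Proof. exact: Nnat.N2Nat.inj_mul. Qed.

Lemma to_natD (a b : BinNums.N) : BinNat.N.to_nat (BinNat.N.add a b) = (BinNat.N.to_nat a + BinNat.N.to_nat b)%N.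
Proof. exact: Nnat.N2Nat.inj_add. Qed.

Lemma to_natX (a b : BinNums.N) : BinNat.N.to_nat (BinNat.N.pow a b) = (BinNat.N.to_nat a ^ BinNat.N.to_nat b)%N.
Proof.
rewrite Nnat.N2Nat.inj_pow; elim: (BinNat.N.to_nat b) => //= n ->.
by rewrite expnS.
Qed.

Lemma to_nat_lt (a b : BinNums.N) : BinNat.N.lt a b -> (BinNat.N.to_nat a < BinNat.N.to_nat b)%N.
Proof. by move=> h; apply/ssrnat.ltP; lia. Qed.

Definition div_up (a b : BinNums.N) : BinNums.N := BinNat.N.succ (BinNat.N.div a b).

Lemma div_up_ge (a b : BinNums.N) : b <> BinNums.N0 ->
  (BinNat.N.to_nat a)%:R / (BinNat.N.to_nat b)%:R <= (BinNat.N.to_nat (div_up a b))%:R :> R.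
Proof.
move=> b0; have b0' : (0 < BinNat.N.to_nat b)%N by apply/ssrnat.ltP; lia.
rewrite ler_pdivrMr ?ltr0n // -natrM ler_nat ltnW // mulnC -to_natM.
by apply/to_nat_lt/BinNat.N.mul_succ_div_gt.
Qed.

Variables A D s : BinNums.N.
Hypotheses (D0 : D <> BinNums.N0) (s0 : s <> BinNums.N0).

(* Terms and partial sums of the exponential series at A / D, as fixed-point numbers with denominator s rounded up. *)
Fixpoint exp_upper (n : nat) : BinNums.N * BinNums.N :=
  if n is k.+1 then
    let: (t, u) := exp_upper k in
    (div_up (BinNat.N.mul t A) (BinNat.N.mul D (BinNat.N.of_nat k.+1)), BinNat.N.add u t)
  else (s, BinNums.N0).

Let pos (b : BinNums.N) : b <> BinNums.N0 -> 0 < (BinNat.N.to_nat b)%:R :> R.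
Proof. by move=> b0; rewrite ltr0n; apply/ssrnat.ltP; lia. Qed.

Lemma exp_upperP n (x := NR A / NR D) :
  exp_coeff x n <= NR (exp_upper n).1 / NR s /\ series (exp_coeff x) n <= NR (exp_upper n).2 / NR s.
Proof.
have sp := pos s0; have Dp := pos D0.
elim: n => [|n] /=.
  by rewrite /exp_coeff /= expr0 fact0 divr1 divff ?gt_eqF // /series /= big_geq // mul0r.
case: (exp_upper n) => t u /= [h1 h2]; split; last first.
  by rewrite seriesSr to_natD natrD mulrDl; apply: lerD.
rewrite exp_coeffS ler_pdivlMr //.
have nz : BinNat.N.mul D (BinNat.N.of_nat n.+1) <> BinNums.N0 by lia.
apply: le_trans (div_up_ge _ nz); rewrite !to_natM Nnat.Nat2N.id !natrM.
have -> : NR t * NR A / (NR D * n.+1%:R) = NR t / NR s * x / n.+1%:R * NR s.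
  have : 0 < n.+1%:R :> R by [].
  by rewrite /x; move: (n.+1%:R) => v v0; field; rewrite !gt_eqF.
rewrite ler_pM2r // ler_pM2r ?invr_gt0 //; apply: ler_wpM2r => //.
by rewrite /x divr_ge0.
Qed.

Fixpoint sqr_upper (n : nat) (u : BinNums.N) : BinNums.N :=
  if n is k.+1 then sqr_upper k (div_up (BinNat.N.mul u u) s) else u.

Lemma sqr_upperP n (x : R) u : 0 <= x -> x <= NR u / NR s -> x ^+ (2 ^ n) <= NR (sqr_upper n u) / NR s.
Proof.
have sp := pos s0; elim: n x u => [|n IH] x u x0 xu //=.
rewrite expnS exprM; apply: IH; first exact: exprn_ge0.
rewrite ler_pdivlMr //; apply: le_trans (div_up_ge _ s0).
apply: (@le_trans _ _ ((NR u / NR s) ^+ 2 * NR s)).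
  by rewrite ler_pM2r // lerXn2r // ?nnegrE // divr_ge0.
rewrite to_natM natrM (_ : (NR u / NR s) ^+ 2 * NR s = NR u * NR u / NR s) //.
by field; rewrite gt_eqF.
Qed.

(** Argument reduction: the series is evaluated at A / D <= 1, with [t + t] as tail bound, and then
    squared k times, always rounding up. Binary integers make the evaluation feasible. *)
Definition expR_fixed (n k : nat) : BinNums.N :=
  let: (t, u) := exp_upper n in sqr_upper k (BinNat.N.add u (BinNat.N.add t t)).

Lemma expR_fixedP n k : (0 < n)%N -> BinNat.N.le A D ->
  expR (NR A / NR D * 2 ^+ k) <= NR (expR_fixed n k) / NR s.
Proof.
move=> n0 AD; have [] := exp_upperP n; rewrite /expR_fixed; case: (exp_upper n) => t u /= h1 h2.
have Dp := pos D0.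
have x01 : 0 <= NR A / NR D <= 1.
  by rewrite divr_ge0 //= ler_pdivrMr // mul1r ler_nat; apply/ssrnat.leP; lia.
rewrite -natrX expRM_natr; apply: sqr_upperP; first exact: expR_ge0.
apply: le_trans (expR_le_series x01 n0) _.
by rewrite [2 * _]mulr_natl mulr2n !to_natD !natrD !mulrDl; apply: lerD => //; apply: lerD.
Qed.
End FixedPointExp.

Lemma expR_C_lt (R : realType) : expR (716 + 7944 / 10 ^+ 4) < 1995 / 10 ^+ 3 * 10 ^+ 311 :> R.
Proof.
pose c := BinNat.N.of_nat; pose mul := BinNat.N.mul; pose pow a b := BinNat.N.pow (c a) (c b).
(* The exponent 716.7944 is divided by 2^10 to bring it below 1; 7944 is written as 8 * 993 to keep
   the numerals small. *)
pose A := BinNat.N.add (mul (c 716) (pow 10 4)) (mul (c 8) (c 993)).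
pose D := mul (pow 10 4) (pow 2 10).
pose s := pow 10 12.
pose NR n : R := (BinNat.N.to_nat n)%:R.
have cE n : NR (c n) = n%:R by rewrite /NR Nnat.Nat2N.id.
have addE a b : NR (BinNat.N.add a b) = NR a + NR b by rewrite /NR to_natD natrD.
have mulE a b : NR (mul a b) = NR a * NR b by rewrite /NR to_natM natrM.
have powE a b : NR (pow a b) = a%:R ^+ b.
  by rewrite /NR to_natX natrX !Nnat.Nat2N.id.
have eA : NR A = 716 * 10 ^+ 4 + 8 * 993%:R by rewrite addE (mulE (c 716)) (mulE (c 8)) powE !cE.
have eD : NR D = 10 ^+ 4 * 2 ^+ 10 by rewrite mulE !powE.
have e : 7944 = 8 * 993%:R :> R by rewrite -natrM; congr _%:R; vm_compute.
have -> : 716 + 7944 / 10 ^+ 4 = NR A / NR D * 2 ^+ 10 :> R.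
  rewrite eA eD e; move: (8 * 993%:R) (716) => v u.
  have p n k : n.+1%:R ^+ k != 0 :> R by rewrite expf_neq0 ?pnatr_eq0.
  move: (10 ^+ 4) (2 ^+ 10) (p 9 4) (p 1 10) => a b a0 b0.
  by field; rewrite a0 b0.
have sp : 0 < NR s by rewrite powE exprn_gt0.
have hC : expR (NR A / NR D * 2 ^+ 10) <= NR (expR_fixed A D s 9 10) / NR s by apply: expR_fixedP.
apply: le_lt_trans hC _.
have : BinNat.N.lt (expR_fixed A D s 9 10) (mul (mul (c 1995) (pow 10 308)) s) by vm_compute.
move: (expR_fixed _ _ _ _ _) => V; move: s sp => s sp ltV.
rewrite ltr_pdivrMr //.
apply: (@lt_le_trans _ _ (NR (mul (mul (c 1995) (pow 10 308)) s))).
  by rewrite ltr_nat; apply: to_nat_lt.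
rewrite !mulE powE cE ler_pM2r //.
rewrite (_ : 311 = 3 + 308)%N // exprD mulrA ler_pM2r ?exprn_gt0 //.
by rewrite divfK // expf_neq0 ?pnatr_eq0.
Qed.

Lemma expR_ge2 (R : realType) : 2 <= expR (25 / 36) :> R.
Proof.
apply: le_trans (@expR_ge_series R (25 / 36) 5 _); last by rewrite divr_ge0.
rewrite /series /= !big_nat_recl // big_geq // addr0 /=.
rewrite !exp_coeffS {1 2 3 4 5}/exp_coeff /= expr0 fact0 divr1 !mul1r divr1.
lra.
Qed.

Lemma pow2_le_C (R : realType) n : (n <= 1026)%N -> 2 ^+ n <= expR (716 + 7944 / 10 ^+ 4) :> R.
Proof.
move=> n1026; apply: (@le_trans _ _ (expR (25 / 36) ^+ n)).
  by rewrite lerXn2r ?nnegrE ?expR_ge0 // expR_ge2.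
rewrite -expRM_natl ler_expR.
apply: (@le_trans _ _ 716); last by rewrite lerDl divr_ge0 // exprn_ge0.
(* 1026 * 25 / 36 = 712.5 stays below 716. *)
apply: (@le_trans _ _ (1026%:R * (25 / 36))).
  by rewrite ler_wpM2r ?divr_ge0 // ler_nat.
by lra.
Qed.

Theorem theorem1p2 (R : realType) :
  let C : R := expR (716 + 7944 / 10 ^+ 4) in
  (forall (t a N m : nat) (p : 'I_t -> nat),
     (forall i : 'I_t, prime (p i)) ->
     injective p ->
     (0 < a)%N ->
     N = ((\prod_(i < t) p i) ^ (2 * a))%N ->
     N = (m ^ 2)%N ->
     quasiperfect N ->
     exists q : nat, [/\ prime q, (q %| N)%N & q%:R < C])
  /\ C < 1995 / 10 ^+ 3 * 10 ^+ 311.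
Proof.
move=> C; split; last exact: expR_C_lt.
move=> t a N m p pp ip a0 eN em qN.
case: (boolP [exists i, (p i)%:R < C]) => [/existsP [i piC]|/existsPn large].
  exists (p i); split=> //.
  by rewrite eN (bigD1 i) //= dvdn_exp ?muln_gt0 // dvdn_mulr.
exfalso; apply: (@not_quasiperfect_large R t a N m p 113 pp ip _ _ eN em qN) => // i.
have := large i; rewrite -leNgt; apply: contraTT; rewrite -!ltnNge -ltNge => h.
apply: lt_le_trans (pow2_le_C R _); last exact: (_ : 9 * 114 <= 1026)%N.
by rewrite -natrX ltr_nat.
Qed.
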